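(* Let $f \in k[x^{\pm 1},y^{\pm 1}]$ be an irreducible Laurent polynomial that is non-degenerate with respect to its Newton polygon $\Delta = \Delta(f)$, and assume that $\Delta^{(1)}$ is two-dimensional. Let $v$ be a lattice direction. Then $g_v$ is complete if and only if the width invariants of $\Delta$ with respect to $v$ are all non-negative.
   Context: $k$ is an algebraically closed field of characteristic zero and $\mathbb{T}^2=(k^\ast)^2$. $U(f)\subset\mathbb{T}^2$ is the curve defined by $f$, and $\Delta(f)\subset\mathbb{R}^2$ is the Newton polygon of $f$. $f$ is non-degenerate with respect to its Newton polygon if for every face $\tau\subset\Delta(f)$ (vertices, edges and $\Delta(f)$ itself) the system $f_\tau = \partial f_\tau/\partial x = \partial f_\tau/\partial y = 0$ has no solutions in $\mathbb{T}^2$, where $f_\tau$ is obtained from $f$ by keeping only the terms supported on $\tau$. $\Delta^{(1)}$ is the convex hull of the lattice points in the interior of $\Delta$. A lattice direction is a primitive vector $v=(a,b)\in\mathbb{Z}^2$; $w(\Delta,v)$ is the minimal $d$ for which there is $m\in\mathbb{Z}$ with $\Delta$ contained in the strip $m\le aY-bX\le m+d$. For this $m$ and $d=w(\Delta,v)\ge2$, the width invariants of $\Delta$ with respect to $v$ are the numbers $E_\ell=\sharp\{(i,j)\in\Delta^{(1)}\cap\mathbb{Z}^2\mid aj-bi=m+\ell\}-1$, $\ell=1,\dots,d-1$. The combinatorial pencil $g_v$ is the pencil formed by the fibers of the morphism $C\to\mathbb{P}^1$ extending $U(f)\to k^\ast:(x,y)\mapsto x^ay^b$ to the smooth projective model $C$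 of $U(f)$; it is complete if $g_v=|D|$ for $D\in g_v$. *)

(* Defs.v *)
From HB Require Import structures.
From mathcomp Require Import all_boot all_order all_algebra finmap.
From mathcomp Require Import boolp classical_sets cardinality reals topology.
From mathcomp Require Import normedtype convex.

Set Implicit Arguments.
Unset Strict Implicit.
Unset Printing Implicit Defensive.

Import Order.TTheory GRing.Theory Num.Theory numFieldNormedType.Exports.

Local Open Scope classical_set_scope.
Local Open Scope ring_scope.

(* The ring k[x^{+-1}, y^{+-1}]: finitely supported functions on Z^2, where   *)
(* (i, j) is the exponent of x^i y^j, with the convolution product.           *)

Definition laurent (k : comNzRingType) := {fsfun int * int -> k with 0}.

Section LaurentRing.
Variable k : comNzRingType.
Implicit Types (f g h : laurent k) (u v z : int * int) (c : k).

HB.instance Definition _ := Choice.copy (laurent k) {fsfun int * int -> k with 0}.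

Definition lcoef f z : k := (f : {fsfun int * int -> k with 0}) z.
Definition lsupp f : {fset int * int} :=
  finsupp (f : {fsfun int * int -> k with 0}).

Definition lzero : laurent k := [fsfun].
Definition lopp f : laurent k := [fsfun z in lsupp f => - lcoef f z].
Definition ladd f g : laurent k :=
  [fsfun z in (lsupp f `|` lsupp g)%fset => lcoef f z + lcoef g z].
Definition lmono z c : laurent k := [fsfun w in [fset z]%fset => c].

Lemma laurentP f g : (forall z, lcoef f z = lcoef g z) -> f = g.
Proof. by move=> fg; apply/fsfunP. Qed.

Lemma lcoef_notin f z : z \notin lsupp f -> lcoef f z = 0.
Proof. by rewrite memNfinsupp => /eqP. Qed.

Lemma lcoef_zero z : lcoef lzero z = 0.
Proof. by rewrite /lcoef fsfun0E. Qed.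

Lemma lcoef_opp f z : lcoef (lopp f) z = - lcoef f z.
Proof.
rewrite {1}/lcoef fsfun_fun; case: ifPn => // /lcoef_notin ->.
by rewrite oppr0.
Qed.

Lemma lcoef_add f g z : lcoef (ladd f g) z = lcoef f z + lcoef g z.
Proof.
rewrite {1}/lcoef fsfun_fun in_fsetU; case: ifPn => //.
by rewrite negb_or => /andP[/lcoef_notin-> /lcoef_notin->]; rewrite addr0.
Qed.

Lemma lcoef_mono u c z : lcoef (lmono u c) z = c *+ (u == z).
Proof. by rewrite /lcoef fsfun_fun in_fset1 eq_sym; case: eqP. Qed.

Lemma laddA : associative ladd.
Proof. by move=> f g h; apply: laurentP => z; rewrite !lcoef_add addrA. Qed.
Lemma laddC : commutative ladd.
Proof. by move=> f g; apply: laurentP => z; rewrite !lcoef_add addrC. Qed.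
Lemma ladd0 : left_id lzero ladd.
Proof.
by move=> f; apply: laurentP => z; rewrite lcoef_add lcoef_zero add0r.
Qed.
Lemma laddN : left_inverse lzero lopp ladd.
Proof.
move=> f; apply: laurentP => z.
by rewrite lcoef_add lcoef_opp lcoef_zero addNr.
Qed.

HB.instance Definition _ :=
  GRing.isZmodule.Build (laurent k) laddA laddC ladd0 laddN.

Lemma lcoef_sum (I : Type) (r : seq I) (F : I -> laurent k) z :
  lcoef (\sum_(i <- r) F i) z = \sum_(i <- r) lcoef (F i) z.
Proof.
by apply: (big_morph (lcoef^~ z) (fun a b => lcoef_add a b z) (lcoef_zero z)).
Qed.

Definition lone : laurent k := lmono 0 1.
Definition lmul f g : laurent k :=
  \sum_(u <- lsupp f) \sum_(v <- lsupp g) lmono (u + v) (lcoef f u * lcoef g v).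

Lemma lmono0 z : lmono z 0 = 0.
Proof.
by apply: laurentP => w; rewrite lcoef_mono mul0rn [RHS]lcoef_zero.
Qed.

Lemma lmonoD z c c' : lmono z (c + c') = lmono z c + lmono z c'.
Proof.
by apply: laurentP => w; rewrite [RHS]lcoef_add !lcoef_mono mulrnDl.
Qed.

Lemma sum_lsupp (T : nmodType) f (D : {fset int * int})
    (F : int * int -> k -> T) : (lsupp f `<=` D)%fset ->
  (forall u, F u 0 = 0) ->
  \sum_(u <- lsupp f) F u (lcoef f u) = \sum_(u <- D) F u (lcoef f u).
Proof.
move=> sD F0; apply: big_fset_incl => // u _ /lcoef_notin ->; exact: F0.
Qed.

Lemma lmulE f g (D E : {fset int * int}) :
  (lsupp f `<=` D)%fset -> (lsupp g `<=` E)%fset ->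
  lmul f g = \sum_(u <- D) \sum_(v <- E) lmono (u + v) (lcoef f u * lcoef g v).
Proof.
move=> sD sE; rewrite /lmul.
rewrite (sum_lsupp (D := D)
  (F := fun u c => \sum_(v <- lsupp g) lmono (u + v) (c * lcoef g v))) //; last first.
  by move=> u; apply: big1 => v _; rewrite mul0r lmono0.
apply: eq_bigr => u _.
apply: (sum_lsupp (F := fun v c => lmono (u + v) (lcoef f u * c))) => // v.
by rewrite mulr0 lmono0.
Qed.

Lemma lmulC : commutative lmul.
Proof.
move=> f g; rewrite /lmul exchange_big; apply: eq_bigr => u _.
by apply: eq_bigr => v _; rewrite addrC mulrC.
Qed.

Lemma lmulDl : left_distributive lmul +%R.
Proof.
move=> f g h; pose D := (lsupp f `|` lsupp g `|` lsupp (f + g)%R)%fset.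
have [sf sg sfg] : [/\ lsupp f `<=` D, lsupp g `<=` D & lsupp (f + g)%R `<=` D]%fset.
  by split; apply/fsubsetP => u; rewrite !in_fsetU => ->; rewrite ?orbT.
rewrite (lmulE sfg (fsubset_refl _)) (lmulE sf (fsubset_refl _)).
rewrite (lmulE sg (fsubset_refl _)) -big_split; apply: eq_bigr => u _ /=.
rewrite -big_split; apply: eq_bigr => v _ /=.
by rewrite [lcoef (f + g) u]lcoef_add mulrDl lmonoD.
Qed.

Lemma lmulDr : right_distributive lmul +%R.
Proof. by move=> f g h; rewrite ![lmul f _]lmulC lmulDl. Qed.

Lemma lmul0l f : lmul 0 f = 0.
Proof. by apply: (@addrI _ (lmul 0 f)); rewrite -lmulDl !addr0. Qed.

Lemma lmul0r f : lmul f 0 = 0.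
Proof. by rewrite lmulC lmul0l. Qed.

Lemma lmul_suml (I : Type) (r : seq I) (F : I -> laurent k) g :
  lmul (\sum_(i <- r) F i) g = \sum_(i <- r) lmul (F i) g.
Proof.
exact: (big_morph (lmul^~ g) (fun a b => lmulDl a b g) (lmul0l g)).
Qed.

Lemma lmul_sumr (I : Type) (r : seq I) (F : I -> laurent k) g :
  lmul g (\sum_(i <- r) F i) = \sum_(i <- r) lmul g (F i).
Proof. exact: (big_morph (lmul g) (lmulDr g) (lmul0r g)). Qed.

Lemma lmul_mono u v c c' :
  lmul (lmono u c) (lmono v c') = lmono (u + v) (c * c').
Proof.
have s z b : (lsupp (lmono z b) `<=` [fset z])%fset.
  apply/fsubsetP => w; rewrite in_fset1 mem_finsupp.
  rewrite -/(lcoef _ _) lcoef_mono [w == z]eq_sym.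
  by case: (z == w) => //; rewrite mulr0n eqxx.
rewrite (lmulE (s _ _) (s _ _)) !big_seq_fset1.
by rewrite !lcoef_mono !eqxx.
Qed.

Lemma lmono_sum f : f = \sum_(u <- lsupp f) lmono u (lcoef f u).
Proof.
apply: laurentP => z; rewrite lcoef_sum.
under eq_bigr do rewrite lcoef_mono.
rewrite (sum_lsupp (D := (lsupp f `|` [fset z])%fset)
  (F := fun u c => c *+ (u == z))); last 2 first.
- exact: fsubsetUl.
- by move=> u; rewrite mul0rn.
rewrite (big_fsetD1 z) /=; last by rewrite in_fsetU in_fset1 eqxx orbT.
rewrite eqxx big_seq big1 ?addr0 // => u.
by rewrite in_fsetD1 => /andP[/negbTE -> _].
Qed.

Lemma lmulA : associative lmul.
Proof.
move=> f g h; rewrite (lmono_sum f) !lmul_suml; apply: eq_bigr => u _.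
rewrite (lmono_sum g) lmul_suml !lmul_sumr lmul_suml; apply: eq_bigr => v _.
rewrite (lmono_sum h) !lmul_sumr; apply: eq_bigr => w _.
by rewrite !lmul_mono addrA mulrA.
Qed.

Lemma lmul1 : left_id lone lmul.
Proof.
move=> f; rewrite {1}(lmono_sum f) lmul_sumr [RHS](lmono_sum f).
by apply: eq_bigr => u _; rewrite lmul_mono add0r mul1r.
Qed.

Lemma lone_neq0 : lone != 0.
Proof.
apply/eqP => /(congr1 (lcoef^~ 0)); rewrite lcoef_mono [RHS]lcoef_zero => /eqP.
by rewrite oner_eq0.
Qed.

HB.instance Definition _ := GRing.Zmodule_isComNzRing.Build (laurent k)
  lmulA lmulC lmul1 lmulDl lone_neq0.

Definition dx f : laurent k :=
  \sum_(z <- lsupp f) lmono (z.1 - 1, z.2) (lcoef f z *~ z.1).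
Definition dy f : laurent k :=
  \sum_(z <- lsupp f) lmono (z.1, z.2 - 1) (lcoef f z *~ z.2).

End LaurentRing.

Definition leval (k : comNzRingType) (S : comUnitRingType)
    (iota : {rmorphism k -> S}) (x y : S) (f : laurent k) : S :=
  \sum_(z <- lsupp f) iota (lcoef f z) * (x ^ z.1 * y ^ z.2).

Definition invertible (A : comNzRingType) (a : A) := exists b, a * b = 1.

Definition irreducible (A : comNzRingType) (a : A) :=
  [/\ a <> 0, ~ invertible a &
      forall b c, a = b * c -> invertible b \/ invertible c].

Section Polygons.
Variable R : realType.
Implicit Types (Delta tau : set (R * R)) (v z : int * int).

Definition lattice_pt z : R * R := (z.1%:~R, z.2%:~R).

Definition convex_hull (A : set (R * R)) : set (R * R) :=
  smallest [set C | convex_set (C : set (convex_lmodType (R * R)%type))] A.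

Definition newton_polygon (k : comNzRingType) (f : laurent k) : set (R * R) :=
  convex_hull (lattice_pt @` [set` lsupp f]).

Definition interior_hull Delta : set (R * R) :=
  convex_hull (lattice_pt @` [set z | Delta^° (lattice_pt z)]).

Definition two_dimensional Delta := exists p q r : R * R,
  [/\ Delta p, Delta q, Delta r &
      (q.1 - p.1) * (r.2 - p.2) - (q.2 - p.2) * (r.1 - p.1) <> 0].

(* The faces of a polytope are the loci where a linear functional attains its *)
(* minimum; the zero functional gives Delta itself.                           *)
Definition face Delta tau := exists w : R * R,
  tau = [set p | Delta p /\
    forall q, Delta q -> w.1 * p.1 + w.2 * p.2 <= w.1 * q.1 + w.2 * q.2].

Definition face_part (k : comNzRingType) (f : laurent k) tau : laurent k :=
  [fsfun z in lsupp f => if `[< tau (lattice_pt z) >] then lcoef f z else 0].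

Definition newton_nondegenerate (k : fieldType) (f : laurent k) :=
  forall tau, face (newton_polygon f) tau ->
  ~ exists x y : k, [/\ x <> 0, y <> 0 &
      [/\ leval idfun x y (face_part f tau) = 0,
          leval idfun x y (dx (face_part f tau)) = 0 &
          leval idfun x y (dy (face_part f tau)) = 0]].

Definition lattice_direction v := coprimez v.1 v.2.

Definition in_strip Delta v (m : int) (d : nat) := forall p, Delta p ->
  m%:~R <= v.1%:~R * p.2 - v.2%:~R * p.1 <= (m + d%:Z)%:~R.

(* d = w(Delta, v), and Delta lies in the strip m <= aY - bX <= m + d.        *)
Definition width_strip Delta v (m : int) (d : nat) :=
  in_strip Delta v m d /\
  forall (m' : int) (d' : nat), in_strip Delta v m' d' -> (d <= d')%N.

Definition width_invariant Delta v (m : int) (l : nat) : int :=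
  #|` fset_set [set z : int * int |
        interior_hull Delta (lattice_pt z) /\
        v.1 * z.2 - v.2 * z.1 = m + l%:Z] |%:Z - 1.

End Polygons.

Arguments newton_polygon R {k} f _.
Arguments newton_nondegenerate R {k} f.

(* (K, x, y) is the function field of the curve U(f) together with its        *)
(* coordinate functions: K is the fraction field of the domain                *)
(* k[x^{+-1}, y^{+-1}] / (f).                                                 *)
Definition is_function_field (k K : fieldType) (iota : {rmorphism k -> K})
    (f : laurent k) (x y : K) :=
  [/\ x <> 0, y <> 0,
      forall g : laurent k,
        leval iota x y g = 0 <-> exists h : laurent k, g = f * h &
      forall t : K, exists g h : laurent k,
        leval iota x y h <> 0 /\ t = leval iota x y g / leval iota x y h].

(* The points of the smooth projective model C of a curve with function field *)
(* K are the normalized discrete valuations of K that are trivial on k; a     *)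
(* point coerces to its order function.  The true order of 0 is +oo; the      *)
(* value 0 below is a convention, so that order functions determine points.   *)
Section SmoothModel.
Variables (k K : fieldType) (iota : {rmorphism k -> K}).

Record point := Point {
  ord :> K -> int;
  ord0 : ord 0 = 0;
  ordM : forall s t, s != 0 -> t != 0 -> ord (s * t) = ord s + ord t;
  ordD : forall s t, s != 0 -> t != 0 -> s + t != 0 ->
    Num.min (ord s) (ord t) <= ord (s + t);
  ord_const : forall c, c != 0 -> ord (iota c) = 0;
  ord_uniformizer : exists2 t, t != 0 & ord t = 1
}.

Implicit Types D E : point -> int.

Definition is_divisor D := finite_set [set P | D P != 0].

Definition effective D := forall P, 0 <= D P.

Definition linearly_equivalent D E :=
  exists2 t : K, t != 0 & forall P, D P - E P = ord P t.

Definition complete_linear_system D : set (point -> int) :=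
  [set E | [/\ is_divisor E, effective E & linearly_equivalent E D]].

(* The divisor of the fiber of phi : C -> P^1 over c : k, or over the point   *)
(* at infinity for None; the local parameters of P^1 at these points are      *)
(* T - c and T^-1.                                                            *)
Definition fiber (phi : K) (c : option k) : point -> int := fun P =>
  if c is Some c then Num.max 0 (ord P (phi - iota c))
  else Num.max 0 (ord P phi^-1).

Definition fiber_pencil (phi : K) : set (point -> int) := range (fiber phi).

Definition combinatorial_pencil (x y : K) (v : int * int) :=
  fiber_pencil (x ^ v.1 * y ^ v.2).

Definition complete_pencil (g : set (point -> int)) :=
  forall D, g D -> g = complete_linear_system D.

End SmoothModel.

Arguments combinatorial_pencil {k K} iota x y v _.

(* Main.v *)
From HB Require Import structures.
From mathcomp Require Import all_boot all_order all_algebra all_field.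
From mathcomp Require Import finmap boolp classical_sets functions cardinality reals.
From mathcomp Require Import interval_inference topology normedtype convex.
From mathcomp Require Import ring zify.
Require Import Defs.

(** Complete v = (a, b) to a unimodular matrix and put X = x^a y^b and
    Y = x^p y^q.  Up to a monomial f becomes a polynomial F(X, Y) of degree d in
    Y, whose row of degree l corresponds to the lattice line aj - bi = m + l, and
    g_v is the pencil of the fibers of X.  Call t in K a section if
    ord_P t >= min(0, ord_P X) at all points P, that is, if t lies in the
    Riemann-Roch space of the polar divisor of X.  The pencil is complete if and
    only if all sections have the form alpha + beta X (complete_pencil_affine).
    A width invariant is non-negative if and only if its row contains an
    interior lattice point, as all points of the hull of the interior lattice
    points are interior (width_invariant_ge0, interior_hull_weight).

    Suppose that a row l has no interior lattice point.  A lattice point of the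
    row strictly between two points where segments between exponents cross it
    would be interior (segment_interior), so all crossings lie between two
    consecutive lattice points e and e + 1 (empty_row_narrow).  Let
    h = X^-e (sum of F_j Y^(j-l) over j > l); since F(X, Y) = 0, this is also
    - X^-e (sum of F_j Y^(j-l) over j <= l).  At a point P, every crossing has an
    order of at least min(0, ord_P X) relative to (e, l), so by convexity the
    same holds for all monomials of the first expression or for all of the
    second.  Hence h is a section, and it is not affine in X (extra_section).

    Conversely, suppose that all rows l with 0 < l < d contain an interior
    lattice point (i, l), and let t be a section.  It can be written as
    n(X, Y) / q(X) with n of degree m < d in Y (representation); assume m > 0 and
    take l = d - m.  By Euler's formula the trace from K to k(X) of
    t X^i Y^(l-1) / F_Y is rho = X^i n_m / (q F_d) (trace_formula).  This rational
    function is controlled by the orders of t X^i Y^(l-1) / F_Y.  Where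
    ord X != 0, non-degeneracy says that Y F_Y has the order of the initial form
    of F (boundary_order), so that X^i Y^l / (Y F_Y) has positive order, (i, l)
    being interior.  Over the other points of the line the curve is smooth in the
    product of the line and P^1, and the differential X^i Y^(l-1) dX / F_Y is
    regular (derivative_order).  So rho is a polynomial in X that vanishes at 0
    and is bounded at infinity.  It is zero, and so is n_m
    (top_coefficient_eq0).  By induction t is in k(X), and then it is affine in X
    (section_affine).

    Orders on K and rational functions of X are compared by valuation rings of a
    splitting field of F(X, T) over K.  Such a ring exists over each place of the
    line by Chevalley's theorem (valuation_ring_exists); its preimages under the
    d embeddings of K over k(X) are valuation rings of K, and these are discrete,
    as K is finite over k(X) (valuation_ring_point). *)

Set Implicit Arguments.
Unset Strict Implicit.
Unset Printing Implicit Defensive.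

Import Order.TTheory GRing.Theory Num.Theory numFieldNormedType.Exports.

Local Open Scope classical_set_scope.
Local Open Scope ring_scope.

(** * Splitting a polynomial *)

(** Either p is irreducible and a root can be adjoined, or it has a
    nonconstant factor of smaller degree. *)
Lemma root_extension (E : fieldType) (p : {poly E}) : (1 < size p)%N ->
  exists (L : fieldType) (j : {rmorphism E -> L}) (z : L),
    root (map_poly j p) z.
Proof.
move: {2}(size p) (leqnn (size p)) => n; elim: n p => [|n IHn] p.
  by rewrite leqn0 => /eqP->.
move=> sp p_gt1.
have [irr_p|nirr_p] := pselect (irreducible_poly p).
  by have [L _ [z pz _]] := irredp_FAdjoin irr_p; exists L, (in_alg L), z.
suff [q [q_gt1 qp q_lt]] :
    exists q : {poly E}, [/\ (1 < size q)%N, q %| p & (size q < size p)%N].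
  have [|L [j [z qz]]] := IHn q _ q_gt1; first by rewrite -ltnS (leq_trans q_lt).
  exists L, j, z; rewrite -dvdp_XsubCl.
  by apply: (@dvdp_trans _ (map_poly j q)); rewrite ?dvdp_XsubCl ?dvdp_map.
have p_neq0 : p != 0 by rewrite -size_poly_gt0 ltnW.
apply: contra_notP nirr_p => noq; split => // q q_neq1 qp.
have q_neq0 : q != 0 by apply: contraNneq p_neq0 => q0; rewrite -dvd0p -q0.
rewrite -dvdp_size_eqp // eqn_leq dvdp_leq //= leqNgt; apply/negP => q_lt.
apply: noq; exists q; split=> //.
by rewrite ltn_neqAle eq_sym q_neq1 size_poly_gt0.
Qed.

Lemma splitting_extension (E : fieldType) (p : {poly E}) : p != 0 ->
  exists (L : fieldType) (j : {rmorphism E -> L}) (rs : seq L),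
    map_poly j p = j (lead_coef p) *: \prod_(z <- rs) ('X - z%:P).
Proof.
move: {2}(size p) (leqnn (size p)) => n; elim: n E p => [|n IHn] E p.
  by rewrite leqn0 size_poly_eq0 => ->.
move=> sp p_neq0; have [p_le1|p_gt1] := leqP (size p) 1.
  exists E, idfun, [::]; rewrite big_nil /= map_poly_id //.
  by rewrite (size1_polyC p_le1) lead_coefC alg_polyC.
have [L [j [z pz]]] := root_extension p_gt1.
have [q Dq] := factor_theorem _ _ pz.
have jp_neq0 : map_poly j p != 0 by rewrite map_poly_eq0.
have q_neq0 : q != 0.
  by apply: contraNneq jp_neq0 => q0; rewrite Dq q0 mul0r.
have sq : (size q <= n)%N.
  have := size_map_poly j p; rewrite Dq size_Mmonic ?monicXsubC // size_XsubC.
  by rewrite addn2 /= => e; rewrite -ltnS e.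
have [L' [j' [rs Dj'q]]] := IHn L q sq q_neq0.
exists L', (j' \o j), (j' z :: rs).
have -> : map_poly (j' \o j) p = map_poly j' (map_poly j p).
  exact: map_poly_comp.
have lq : j (lead_coef p) = lead_coef q.
  have <- : lead_coef (map_poly j p) = j (lead_coef p) by exact: lead_coef_map.
  have -> : lead_coef (map_poly j p) = lead_coef (q * ('X - z%:P)).
    exact: congr1 Dq.
  by rewrite lead_coefM lead_coefXsubC mulr1.
transitivity (map_poly j' (q * ('X - z%:P))); first exact: congr1 Dq.
rewrite rmorphM /= Dj'q rmorphB /= map_polyX map_polyC /= lq.
by rewrite big_cons -scalerAl mulrC.
Qed.

(** * Valuation rings *)

Record valuation_ring (L : fieldType) (V : set L) : Prop := ValuationRing {
  vring1 : V 1;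
  vringB : forall a b, V a -> V b -> V (a - b);
  vringM : forall a b, V a -> V b -> V (a * b);
  vringV : forall a, V a \/ V a^-1 }.

Definition vmax (L : fieldType) (V : set L) (a : L) := a = 0 \/ ~ V a^-1.

Section ValuationRing.
Variables (L : fieldType) (V : set L).
Hypothesis vV : valuation_ring V.

Lemma vring0 : V 0.
Proof. by rewrite -(subrr 1); apply: (vringB vV); apply: (vring1 vV). Qed.

Lemma vringN a : V a -> V (- a).
Proof. by move=> Va; rewrite -sub0r; apply: (vringB vV) => //; exact: vring0. Qed.

Lemma vringD a b : V a -> V b -> V (a + b).
Proof. by move=> Va Vb; rewrite -[b]opprK; apply: (vringB vV) => //; exact: vringN. Qed.

Lemma vringX a n : V a -> V (a ^+ n).
Proof.
move=> Va; elim: n => [|n IHn]; first exact: (vring1 vV).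
by rewrite exprS; apply: (vringM vV).
Qed.

Lemma vring_sum (I : Type) (r : seq I) (P : pred I) (F : I -> L) :
  (forall i, P i -> V (F i)) -> V (\sum_(i <- r | P i) F i).
Proof. by move=> VF; apply: big_ind => //; [exact: vring0|exact: vringD]. Qed.

Lemma vmaxW a : vmax V a -> V a.
Proof. by case=> [->|]; [exact: vring0|case: (vringV vV a)]. Qed.

Lemma vmaxM a b : V a -> vmax V b -> vmax V (a * b).
Proof.
move=> Va [->|Vb]; first by left; rewrite mulr0.
have [->|a0] := eqVneq a 0; first by left; rewrite mul0r.
right; apply: contra_not Vb; rewrite invfM => /(vringM vV Va).
by rewrite mulrA divff // mul1r.
Qed.

Lemma vmaxD a b : vmax V a -> vmax V b -> vmax V (a + b).
Proof.
have [->|a0] := eqVneq a 0; first by rewrite add0r.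
have [->|b0] := eqVneq b 0; first by rewrite addr0.
wlog Vba : a b a0 b0 / V (b / a).
  move=> H ma mb; have [Vba|] := vringV vV (b / a); first exact: H.
  by rewrite invf_div addrC => Vab; apply: H.
move=> ma mb; have -> : a + b = (1 + b / a) * a by field.
by apply: vmaxM => //; apply: vringD => //; exact: (vring1 vV).
Qed.

Lemma vmaxN a : vmax V a -> vmax V (- a).
Proof.
by move=> ma; rewrite -mulN1r; apply: vmaxM => //; apply: vringN; exact: (vring1 vV).
Qed.

Lemma vmax_sum (I : Type) (r : seq I) (P : pred I) (F : I -> L) :
  (forall i, P i -> vmax V (F i)) -> vmax V (\sum_(i <- r | P i) F i).
Proof. by move=> VF; apply: big_ind => //; [left|exact: vmaxD]. Qed.

Lemma vunit a : V a -> ~ vmax V a -> V a^-1.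
Proof. by move=> Va ma; apply: contra_notP ma => ?; right. Qed.

Lemma vmax_unit a : V a^-1 -> a != 0 -> ~ vmax V a.
Proof. by move=> Va a0 [/eqP|]; [rewrite (negPf a0)|]. Qed.

Lemma vmaxE a : a != 0 -> vmax V a <-> ~ V a^-1.
Proof. by move=> a0; split=> [[/eqP|//]|]; [rewrite (negPf a0)|right]. Qed.

Lemma vmax_prime a b : vmax V (a * b) -> V a -> V b -> vmax V a \/ vmax V b.
Proof.
move=> mab Va Vb; have [ma|ma] := pselect (vmax V a); [by left|right].
have a0 : a != 0 by apply: contra_notN ma => /eqP ->; left.
have -> : b = a^-1 * (a * b) by rewrite mulKf.
by apply: vmaxM => //; apply: vunit.
Qed.

End ValuationRing.

(** * Existence of valuation rings *)

Section Chevalley.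
Variables (L : fieldType) (A0 : set L) (s : L).
Hypothesis A01 : A0 1.
Hypothesis A0B : forall a b, A0 a -> A0 b -> A0 (a - b).
Hypothesis A0M : forall a b, A0 a -> A0 b -> A0 (a * b).
Hypothesis A0s : A0 s.
Hypothesis A0sV : ~ A0 s^-1.

Let good (A : set L) := [/\ A0 `<=` A, forall a b, A a -> A b -> A (a - b),
  forall a b, A a -> A b -> A (a * b) & ~ A s^-1].

Let goodX A a n : good A -> A a -> A (a ^+ n).
Proof.
move=> [A0A _ AM _] Aa; elim: n => [|n IHn]; first exact: A0A.
by rewrite exprS; apply: (AM).
Qed.

Let good_sum A (I : Type) (r : seq I) (P : pred I) (F : I -> L) : good A ->
  (forall i, P i -> A (F i)) -> A (\sum_(i <- r | P i) F i).
Proof.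
move=> [A0A AB AM _] AF.
have A_0 : A 0 by rewrite -(subrr 1); apply: (AB); exact: A0A.
apply: big_ind => // a b Aa Ab.
by rewrite -[b]opprK; apply: (AB) => //; rewrite -sub0r; apply: (AB).
Qed.

Let adjoin A (u : L) : set L :=
  [set t | exists p : {poly L}, (forall i, A p`_i) /\ t = p.[u]].

Let adjoin_sub A u : good A -> A `<=` adjoin A u.
Proof.
move=> gA a Aa; exists a%:P; rewrite hornerC; split=> // i.
have [_ AB _ _] := gA.
by rewrite coefC; case: eqP => // _; have := AB a a Aa Aa; rewrite subrr.
Qed.

Let adjoin_gen A u : good A -> adjoin A u u.
Proof.
move=> [A0A AB _ _]; exists 'X; rewrite hornerX; split=> // i.
have A1 : A 1 by exact: A0A.
by rewrite coefX; case: eqP => // _; have := AB 1 1 A1 A1; rewrite subrr.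
Qed.

Let adjoin_good A u : good A -> ~ adjoin A u s^-1 -> good (adjoin A u).
Proof.
move=> gA nu; have [A0A AB AM _] := gA; split=> //.
- by apply: (subset_trans A0A); exact: adjoin_sub.
- move=> _ _ [p [Ap ->]] [q [Aq ->]]; exists (p - q); split.
    by move=> i; rewrite coefB; apply: (AB).
  by rewrite hornerD hornerN.
- move=> _ _ [p [Ap ->]] [q [Aq ->]]; exists (p * q); rewrite hornerM.
  by split=> // i; rewrite coefM; apply: good_sum => // j _; apply: (AM).
Qed.

(** This is Chevalley's extension theorem for an element s that is not
    invertible in A0. By Zorn's lemma there is a subring A that is maximal
    among those that contain A0 and miss s^-1. If neither u nor u^-1 were in
    A, both A[u] and A[u^-1] would contain s^-1; of two expressions of s^-1 by
    powers of u and of u^-1, the shorter allows to lower the degree of the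
    longer, until one of them is constant and s^-1 is in A. *)
Lemma valuation_ring_exists :
  exists V : set L, [/\ valuation_ring V, A0 `<=` V & ~ V s^-1].
Proof.
have s0 : s != 0.
  by apply: contra_notN A0sV => /eqP->; rewrite invr0 -(subrr 1); apply: A0B.
have gA0 : good A0 by split.
have [F FP totF|A [PA Amax]] := @Zorn_bigcup L [set A | A = set0 \/ good A].
  have [F0|[B FB B0]] : (forall B, F B -> B = set0) \/ exists2 B, F B & B <> set0.
    have [|nF] := pselect (exists2 B, F B & B <> set0); first by right.
    by left=> B FB; apply: contra_notP nF => ?; exists B.
  - by left; apply/seteqP; split=> // x [B /F0 ->].
  - have gF C : F C -> C <> set0 -> good C by move=> /FP[].
    have chain a b : (\bigcup_(X in F) X) a -> (\bigcup_(X in F) X) b ->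
        exists C, [/\ F C, good C, C a & C b].
      move=> [C FC Ca] [D FD Db].
      have [CD|DC] := totF _ _ FC FD; [exists D|exists C].
        by split=> //; [apply: gF => // D0; rewrite D0 in Db|exact: CD].
      by split=> //; [apply: gF => // C0; rewrite C0 in Ca|exact: DC].
    right; split.
    + by have [sB _ _ _] := gF B FB B0; move=> x /sB Bx; exists B.
    + by move=> a b /chain H/H[C [FC [_ CB _ _] Ca Cb]]; exists C => //; apply: CB.
    + by move=> a b /chain H/H[C [FC [_ _ CM _] Ca Cb]]; exists C => //; apply: CM.
    + by move=> /[dup] /chain H/H[C [_ [_ _ _ nC] _]].
have gA : good A.
  case: PA => // A_0; exfalso; apply: (Amax A0); last by right.
  by rewrite A_0; split=> // H; have := H _ A01.
have [A0A AB AM nA] := gA.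
have A_1 : A 1 by apply: A0A.
have maxA u : ~ adjoin A u s^-1 -> A u.
  move=> nu; apply: contrapT => Au.
  apply: (Amax (adjoin A u)); last by right; exact: adjoin_good.
  split; first exact: adjoin_sub.
  by move=> H; apply: Au; apply: H; exact: adjoin_gen.
have A_0 : A 0 by rewrite -(subrr 1); apply: (AB).
have AN a : A a -> A (- a) by move=> Aa; rewrite -sub0r; apply: (AB).
have AD a b : A a -> A b -> A (a + b).
  by move=> Aa Ab; rewrite -[b]opprK; apply: (AB) => //; apply: (AN).
have As : A s by apply: A0A.
(* If w = 1 - s * c had no inverse in A, then s^-1 would be a polynomial in w^-1;
   as w ^+ N lies in 1 + s A, multiplying by it would put s^-1 into A. *)
have A_unit c : A c -> A (1 - s * c)^-1.
  move=> Ac; set w := 1 - s * c; apply: (maxA) => -[p [Ap sp]].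
  have Aw : A w by apply: (AB) => //; apply: (AM).
  have w0 : w != 0.
    apply: contra_notN nA; rewrite subr_eq0 => /eqP e.
    by rewrite (_ : s^-1 = c) // -[RHS](mulKf s0) -e mulr1.
  have [e [Ae De]] : exists e, A e /\ w ^+ size p = 1 - s * e.
    elim: (size p) => [|m [e [Ae De]]]; first by exists 0; rewrite mulr0 subr0.
    exists (c + e - s * c * e); split; last by rewrite exprS De /w; ring.
    by apply: (AB); [exact: AD|do 2 ?apply: (AM)].
  apply: nA; have -> : s^-1 = s^-1 * w ^+ size p + e.
    by rewrite De mulrBr mulr1 mulKf // subrK.
  apply: (AD) => //; rewrite sp horner_coef mulr_suml.
  apply: good_sum => // i _; rewrite -mulrA; apply: (AM) => //.
  have -> : w ^+ size p = w ^+ i * w ^+ (size p - i).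
    by rewrite -exprD subnKC // ltnW.
  rewrite mulrA -exprMn mulVf // expr1n mul1r.
  exact: goodX.
have key N : forall (u : L) (p q : {poly L}), u != 0 -> (size p + size q <= N)%N ->
    (forall i, A p`_i) -> (forall i, A q`_i) ->
    s^-1 = p.[u] -> s^-1 = q.[u^-1] -> False.
  elim: N => [|N IHN] u p q u0 sN Ap Aq pu qu.
    move: sN; rewrite leqn0 addn_eq0 size_poly_eq0 => /andP[/eqP p0 _].
    by move/eqP: pu; rewrite p0 horner0 invr_eq0 (negPf s0).
  wlog le_qp : u p q u0 sN Ap Aq pu qu / (size q <= size p)%N.
    move=> H; have [|/ltnW le_pq] := leqP (size q) (size p); first exact: (H u).
    by apply: (H u^-1 q p); rewrite ?invr_eq0 ?invrK // addnC.
  have [q_le1|q_gt1] := leqP (size q) 1.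
    by apply: nA; rewrite qu (size1_polyC q_le1) hornerC.
  have [m Dm] : exists m, size q = m.+2 by exists (size q).-2; lia.
  have [n Dn] : exists n, size p = n.+1 by exists (size p).-1; lia.
  have le_mn : (m.+1 <= n)%N by rewrite -ltnS -Dm -Dn.
  have w0 : 1 - s * q`_0 != 0.
    apply: contra_notN nA; rewrite subr_eq0 => /eqP e.
    by rewrite (_ : s^-1 = q`_0) // -[RHS](mulKf s0) -e mulr1.
  (* Multiplied by s * u ^+ m.+1, the relation for u^-1 expresses
     (1 - s * q`_0) * u ^+ m.+1 by lower powers of u. *)
  have Du : u ^+ m.+1 = (1 - s * q`_0)^-1 * s *
      \sum_(i < m.+1) q`_i.+1 * u ^+ (m - i).
    apply: (mulfI w0); rewrite !mulrA divff // mul1r.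
    have E : \sum_(i < m.+1) q`_i.+1 * u ^+ (m - i) =
        (\sum_(i < m.+1) q`_i.+1 * u^-1 ^+ i.+1) * u ^+ m.+1.
      rewrite mulr_suml; apply: eq_bigr => i _; rewrite -mulrA; congr (_ * _).
      have -> : u ^+ m.+1 = u ^+ i.+1 * u ^+ (m - i).
        by rewrite -exprD addSn subnKC // -ltnS.
      by rewrite exprVn mulKf // expf_neq0.
    have : s * q.[u^-1] = 1 by rewrite -qu divff.
    rewrite E horner_coef Dm big_ord_recl expr0 mulr1 => e.
    by rewrite mulrA; congr (_ * _); rewrite -e; ring.
  pose r := (p`_n * ((1 - s * q`_0)^-1 * s)) *:
     \poly_(j < m.+1) q`_(m - j).+1 * 'X^(n - m.+1).
  have Dr : r.[u] = p`_n * u ^+ n.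
    rewrite /r hornerM hornerZ horner_poly hornerXn.
    have -> : u ^+ n = u ^+ m.+1 * u ^+ (n - m.+1) by rewrite -exprD subnKC.
    rewrite Du !mulrA; congr (_ * _ * _).
    rewrite (reindex_inj rev_ord_inj) /=; apply: eq_bigr => i _.
    by rewrite subSS subKn // -ltnS.
  apply: (IHN u (\poly_(i < n) p`_i + r) q) => //.
  - apply: (leq_trans (n := n + size q)); last by rewrite -ltnS -addSn -Dn.
    rewrite leq_add2r; apply: (leq_trans (size_polyD _ _)).
    rewrite geq_max size_poly /=; apply: (leq_trans (size_polyMleq _ _)).
    rewrite size_polyXn addnS /= ; apply: leq_trans (_ : m.+1 + (n - m.+1) <= n)%N.
      by rewrite leq_add2r (leq_trans (size_scale_leq _ _)) ?size_poly.
    by rewrite subnKC.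
  - move=> i; rewrite coefD; apply: (AD).
      by rewrite coef_poly; case: ifP.
    rewrite coefMXn; case: ifP => // _; rewrite coefZ coef_poly.
    by case: ifP => _; rewrite ?mulr0 //; do ?apply: (AM) => //; apply: (A_unit).
  - rewrite hornerD Dr horner_poly pu horner_coef Dn big_ord_recr /=.
    by [].
exists A; split=> //; split=> // u.
have [->|u0] := eqVneq u 0; first by left.
have [nu|nu] := pselect (adjoin A u s^-1); last by left; apply: (maxA).
have [nu'|nu'] := pselect (adjoin A u^-1 s^-1); last by right; apply: (maxA).
have [[p [Ap pu]] [q [Aq qu]]] := (nu, nu').
by case: (key _ u p q u0 (leqnn _) Ap Aq pu qu).
Qed.

End Chevalley.

(** * Discrete valuations of finite extensions of k(s) *)

Definition ev (A : comNzRingType) (B : comNzRingType) (iota : {rmorphism A -> B})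
    (s : B) : {poly A} -> B :=
  horner_morph (fun c => mulrC s (iota c) : GRing.comm s (iota c)).

HB.instance Definition _ (A B : comNzRingType) (iota : {rmorphism A -> B})
  (s : B) := GRing.RMorphism.on (ev iota s).

Section Evaluation.
Variables (A B : comNzRingType) (iota : {rmorphism A -> B}).
Implicit Types (s : B) (a : {poly A}).

Lemma evC s c : ev iota s c%:P = iota c.
Proof. exact: horner_morphC. Qed.

Lemma evX s : ev iota s 'X = s.
Proof. exact: horner_morphX. Qed.

Lemma evD s a b : ev iota s (a + b) = ev iota s a + ev iota s b.
Proof. exact: (raddfD (ev iota s)). Qed.

Lemma evB s a b : ev iota s (a - b) = ev iota s a - ev iota s b.
Proof. exact: (raddfB (ev iota s)). Qed.

Lemma evM s a b : ev iota s (a * b) = ev iota s a * ev iota s b.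
Proof. exact: (rmorphM (ev iota s)). Qed.

Lemma evXn s a n : ev iota s (a ^+ n) = ev iota s a ^+ n.
Proof. exact: (rmorphXn (ev iota s)). Qed.

Lemma evE s a : ev iota s a = \sum_(i < size a) iota a`_i * s ^+ i.
Proof.
exact: horner_poly.
Qed.

Lemma poly_headE a : a = drop_poly 1 a * 'X + (a`_0)%:P.
Proof.
rewrite -{1}(poly_take_drop 1 a) expr1 addrC; congr (_ + _).
apply/polyP => i; rewrite coef_take_poly coefC.
by case: i.
Qed.

Lemma coef0_size_gt0 a : a`_0 != 0 -> (0 < size a)%N.
Proof. by apply: contraNltn; rewrite leqn0 => /eqP/size0nil ->; rewrite nth_nil. Qed.

End Evaluation.

(** For s transcendental over k this says that K has degree at most n over
    k(s), with denominators cleared. *)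
Definition finite_over (k K : fieldType) (iota : {rmorphism k -> K})
    (s : K) (n : nat) :=
  forall t : 'I_n.+1 -> K, exists a : 'I_n.+1 -> {poly k},
    (exists i, a i != 0) /\ \sum_i ev iota s (a i) * t i = 0.

(** Dividing a relation by the common power of s in its coefficients makes one
    of them a unit at every zero of s. *)
Lemma finite_over_primitive (k K : fieldType) (iota : {rmorphism k -> K})
    (s : K) (n : nat) : finite_over iota s n -> s != 0 ->
  forall t : 'I_n.+1 -> K, exists a : 'I_n.+1 -> {poly k},
    (exists i, (a i)`_0 != 0) /\ \sum_i ev iota s (a i) * t i = 0.
Proof.
move=> fin s0 t; have [a [[i ai0] Da]] := fin t.
move: {2}(size (a i)) (leqnn (size (a i))) => m.
elim: m a ai0 Da => [|m IHm] a ai0 Da.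
  by rewrite leqn0 size_poly_eq0 (negPf ai0).
move=> sm; have [Ha|] := pselect (exists i, (a i)`_0 != 0); first by exists a.
move=> /forallNP Ha; have {}Ha j : (a j)`_0 = 0 by apply/eqP/negPn/negP/Ha.
pose b j := drop_poly 1 (a j).
have Db j : a j = b j * 'X.
  by rewrite [LHS]poly_headE Ha polyC0 addr0.
apply: (IHm b).
- by apply: contraNneq ai0 => b0; rewrite Db b0 mul0r.
- apply: (mulIf s0); rewrite mul0r -[RHS]Da mulr_suml; apply: eq_bigr => j _.
  by rewrite [a j]Db rmorphM /= evX mulrAC.
- rewrite size_drop_poly; lia.
Qed.

Section Discreteness.
Variables (k K : fieldType) (iota : {rmorphism k -> K}).
Variables (V : set K) (s : K) (n : nat).
Hypotheses (vV : valuation_ring V) (Vk : forall c, V (iota c)).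
Hypotheses (ms : vmax V s) (s0 : s != 0) (fin : finite_over iota s n).

Lemma vring_ev u (a : {poly k}) : V u -> V (ev iota u a).
Proof.
move=> Vu; rewrite evE; apply: (vring_sum vV) => i _.
by apply: (vringM vV) => //; apply: (vringX vV).
Qed.

Lemma ev_unit u (a : {poly k}) : vmax V u -> a`_0 != 0 -> ~ vmax V (ev iota u a).
Proof.
move=> mu a0; rewrite (poly_headE a); set b := drop_poly 1 a.
rewrite rmorphD rmorphM /= evX evC => m.
have : vmax V (iota a`_0).
  have -> : iota a`_0 = ev iota u b * u + iota a`_0 + - (ev iota u b * u) by ring.
  apply: (vmaxD vV) => //; apply: (vmaxN vV); apply: (vmaxM vV) => //.
  by apply: vring_ev; apply: (vmaxW vV).
by apply: vmax_unit; rewrite ?fmorph_eq0 // -fmorphV.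
Qed.

(** Here t 0, ..., t n have increasing values that differ by less than the
    value of s. Then the terms of a linear relation over k[s] would have
    distinct values, as their coefficients only shift values by multiples of
    that of s. *)
Lemma chain_bound (t : nat -> K) : (forall i, (i <= n)%N -> t i != 0) ->
  (forall i, (i < n)%N -> vmax V (t i.+1 / t i)) -> ~ vmax V (s * t 0 / t n).
Proof.
move=> t0 tm sm.
have up i j : (i < j)%N -> (j <= n)%N -> vmax V (t j / t i).
  elim: j => // j IHj; rewrite ltnS => le_ij le_jn.
  have [lt_ij|ge_ij] := ltnP i j; last first.
    have -> : i = j by apply/eqP; rewrite eqn_leq le_ij.
    exact: tm.
  have -> : t j.+1 / t i = t j.+1 / t j * (t j / t i).
    by rewrite mulrA divfK // t0 // ltnW.
  apply: (vmaxM vV); first by apply: (vmaxW vV); exact: tm.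
  by apply: IHj => //; exact: ltnW.
have down i j : (i < j)%N -> (j <= n)%N -> vmax V (s * t i / t j).
  have le_V a b : (a <= b)%N -> (b <= n)%N -> V (t b / t a).
    rewrite leq_eqVlt => /orP[/eqP->|lt_ab] le_bn.
      by rewrite divff ?t0 //; exact: (vring1 vV).
    by apply: (vmaxW vV); apply: up.
  move=> lt_ij le_jn.
  have -> : s * t i / t j = (t i / t 0) * (t n / t j) * (s * t 0 / t n).
    by field; rewrite !t0.
  apply: (vmaxM vV) => //; apply: (vringM vV); apply: le_V => //.
  exact: leq_trans (ltnW _) le_jn.
have [a [[i0 ai0] Da]] := finite_over_primitive fin s0 (fun i => t i).
case: (@arg_minnP _ i0 (fun i => (a i)`_0 != 0) (fun i => nat_of_ord i) ai0) => i ai imin.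
have ti0 : t i != 0 by rewrite t0 // -ltnS.
apply: (ev_unit ms ai).
have -> : ev iota s (a i) = - \sum_(j < n.+1 | j != i) ev iota s (a j) * t j / t i.
  apply: (mulIf ti0); rewrite mulNr mulr_suml; apply/eqP.
  rewrite -addr_eq0; apply/eqP; rewrite -[RHS]Da [RHS](bigD1 i) //=.
  by congr (_ + _); apply: eq_bigr => j _; rewrite divfK.
apply: (vmaxN vV); apply: (vmax_sum vV) => j ji.
have [lt_ij|lt_ji|e] := ltngtP i j; last by rewrite -val_eqE /= e eqxx in ji.
  rewrite -mulrA; apply: (vmaxM vV); first exact: vring_ev (vmaxW vV ms).
  by apply: up => //; rewrite -ltnS.
have aj0 : (a j)`_0 = 0.
  by apply/eqP; apply: contraTT lt_ji => /imin; rewrite -leqNgt.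
rewrite [a j]poly_headE aj0 polyC0 addr0 rmorphM /= evX -!mulrA.
apply: (vmaxM vV); first exact: vring_ev (vmaxW vV ms).
by rewrite mulrA; apply: down => //; rewrite -ltnS.
Qed.

(** By the chain bound, at most n values lie between 0 and the value of s, so
    there is no infinite descent of positive values. *)
Lemma uniformizer_exists : exists p : K,
  [/\ p != 0, vmax V p & forall t, vmax V t -> V (t / p)].
Proof.
apply: contrapT => nop.
have step p : p != 0 -> vmax V p -> exists q, [/\ q != 0, vmax V q & vmax V (p / q)].
  move=> p0 mp; apply: contrapT => noq; apply: nop; exists p; split=> // t mt.
  have [->|t0] := eqVneq t 0; first by rewrite mul0r; exact: (vring0 vV).
  apply: contrapT => ntp; apply: noq; exists t; split=> //.
  by right; rewrite invf_div.
have /choice [g gP] : forall p, exists q, p != 0 -> vmax V p ->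
    [/\ q != 0, vmax V q & vmax V (p / q)].
  move=> p; have [[p0 mp]|np] := pselect (p != 0 /\ vmax V p).
    by have [q Hq] := step p p0 mp; exists q.
  by exists 0 => p0 mp; case: np.
pose u i := iter i g s.
have uP i : u i != 0 /\ vmax V (u i).
  by elim: i => [//|i [ui0 mui]]; have [] := gP (u i) ui0 mui.
pose t i := if i is j.+1 then u (n.+1 - j)%N else 1.
apply: (@chain_bound t).
- by case=> [|i] _ /=; [exact: oner_neq0|exact: (uP _).1].
- move=> [|i] lt_in; rewrite /t /=; first by rewrite divr1; exact: (uP n.+1).2.
  have -> : (n.+1 - i)%N = (n.+1 - i.+1).+1 by lia.
  by have [_ _] := gP _ (uP (n.+1 - i.+1)%N).1 (uP (n.+1 - i.+1)%N).2.
- rewrite /t mulr1; case: (n) => [|m]; first by rewrite divr1.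
  have -> : (m.+2 - m)%N = 2 by lia.
  have [q0 mq mpq] := gP _ (uP 0).1 (uP 0).2.
  have [q0' mq' mpq'] := gP _ (uP 1).1 (uP 1).2.
  have -> : s / u 2 = (u 0 / u 1) * (u 1 / u 2) by rewrite mulrA divfK // (uP 1).1.
  by apply: (vmaxM vV) => //; exact: (vmaxW vV).
Qed.

Lemma algebraic_dep (t : K) : t != 0 -> exists2 p : {poly {poly k}},
  p`_0 != 0 & \sum_(i < size p) ev iota s p`_i * t ^+ i = 0.
Proof.
move=> t0; have [a [[i0 ai0] Da]] := fin (fun i => t ^+ i).
pose p := \poly_(i < n.+1) a (inord i).
have p0 : p != 0.
  apply: contraNneq ai0 => /(congr1 (fun q : {poly {poly k}} => q`_i0)).
  by rewrite coef_poly ltn_ord inord_val coef0 => ->.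
have sp : (size p <= n.+1)%N by exact: size_poly.
have Dp m : (size p <= m)%N -> \sum_(i < m) ev iota s p`_i * t ^+ i =
    \sum_(i < size p) ev iota s p`_i * t ^+ i.
  move=> le_pm; rewrite (big_ord_widen m (fun i => ev iota s p`_i * t ^+ i) le_pm).
  rewrite [LHS](bigID (fun i : 'I_m => (i < size p)%N)) /= addrC big1 ?add0r // => i.
  by rewrite -leqNgt => /(nth_default 0) ->; rewrite rmorph0 mul0r.
have {Dp} : \sum_(i < size p) ev iota s p`_i * t ^+ i = 0.
  rewrite -(Dp _ sp) -[RHS]Da; apply: eq_bigr => i _.
  by rewrite coef_poly ltn_ord inord_val.
move: {2}(size p) (leqnn (size p)) => m; elim: m (p) p0 => {p sp} [|m IHm] p p0.
  by rewrite leqn0 size_poly_eq0 (negPf p0).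
move=> sp Dp; have [p00|p00] := eqVneq p`_0 0; last by exists p.
have Ep : p = drop_poly 1 p * 'X by rewrite [LHS]poly_headE p00 polyC0 addr0.
have q0 : drop_poly 1 p != 0 by apply: contraNneq p0 => q0; rewrite Ep q0 mul0r.
apply: (IHm (drop_poly 1 p)) => //; first by rewrite size_drop_poly; lia.
have Sp : size p = (size (drop_poly 1 p)).+1 by rewrite {1}Ep size_mulX.
apply: (mulIf t0); rewrite mul0r -[RHS]Dp Sp big_ord_recl p00 rmorph0 mul0r add0r.
rewrite mulr_suml; apply: eq_bigr => i _.
by rewrite coef_drop_poly addn1 lift0 exprSr mulrA.
Qed.

Section Uniformizer.
Variable p : K.
Hypotheses (p0 : p != 0) (mp : vmax V p).
Hypothesis pmin : forall t, vmax V t -> V (t / p).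

Lemma exact_power t : t != 0 -> V t -> (exists N, ~ V (t / p ^+ N)) ->
  exists e, V (t / p ^+ e) /\ V (p ^+ e / t).
Proof.
move=> t0 Vt [N HN]; have exN : exists N, `[< ~ V (t / p ^+ N) >].
  by exists N; apply/asboolP.
case: (ex_minnP exN) => -[|e] /asboolP nV emin; first by rewrite divr1 in nV.
have Ve : V (t / p ^+ e).
  by apply: contrapT => nVe; have := emin e; rewrite ltnn => H; apply/negP/H/asboolP.
exists e; split=> //; apply: contrapT => nVe; apply: nV.
have -> : t / p ^+ e.+1 = t / p ^+ e / p by rewrite exprSr invfM mulrA mulrAC.
by apply: pmin; right; rewrite invf_div.
Qed.

Lemma s_power : exists e, V (s / p ^+ e) /\ V (p ^+ e / s).
Proof.
apply: (exact_power s0 (vmaxW vV ms)); exists n.+1 => Vs.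
apply: (@chain_bound (fun i => p ^+ i)).
- by move=> i _; rewrite expf_neq0.
- by move=> i _; rewrite exprS mulfK ?expf_neq0.
- have -> : s * p ^+ 0 / p ^+ n = s / p ^+ n.+1 * p.
    by rewrite expr0 mulr1 exprSr invfM mulrA divfK.
  exact: (vmaxM vV).
Qed.

Lemma ev_power (a : {poly k}) : a != 0 ->
  ev iota s a != 0 /\ exists j, V (s ^+ j / ev iota s a).
Proof.
move: {2}(size a) (leqnn (size a)) => m; elim: m a => [|m IHm] a.
  by rewrite leqn0 size_poly_eq0 => ->.
move=> sa a0; have [a00|a00] := eqVneq a`_0 0.
  have Ea : a = drop_poly 1 a * 'X by rewrite [LHS]poly_headE a00 polyC0 addr0.
  have b0 : drop_poly 1 a != 0 by apply: contraNneq a0 => b0; rewrite Ea b0 mul0r.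
  have [|evb0 [j Vj]] := IHm _ _ b0; first by rewrite size_drop_poly; lia.
  have -> : ev iota s a = ev iota s (drop_poly 1 a) * s.
    by rewrite [in LHS]Ea rmorphM /= evX.
  split; first by rewrite mulf_neq0.
  exists j.+1; rewrite exprSr invfM mulrACA divff // mulr1.
  exact: Vj.
have u := ev_unit ms a00; split.
  by apply: contra_notN u => /eqP ->; left.
exists 0%N; rewrite expr0 mul1r; apply: vunit u.
exact: vring_ev (vmaxW vV ms).
Qed.

(** The constant term of an equation of t over k[s] is a multiple of t, and it
    has a finite order because s has. *)
Lemma order_bounded t : t != 0 -> exists N, ~ V (t / p ^+ N).
Proof.
move=> t0; apply: contrapT => /forallNP nN.
have {}nN N : V (t / p ^+ N) by apply: contrapT; exact: nN.
have Vt : V t by have := nN 0; rewrite divr1.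
have [q q0 Dq] := algebraic_dep t0; have [ne0 [j Vj]] := ev_power q0.
have sq := coef0_size_gt0 q0.
have {}Dq : V (ev iota s q`_0 / t).
  case: (size q) sq Dq => // m _; rewrite big_ord_recl expr0 mulr1 => /eqP.
  rewrite addr_eq0 => /eqP ->; rewrite mulNr mulr_suml; apply: (vringN vV).
  apply: (vring_sum vV) => i _; rewrite lift0 exprSr mulrA mulfK //.
  by apply: (vringM vV); [exact: vring_ev (vmaxW vV ms)|exact: (vringX vV)].
have [e [Ve Ve']] := s_power.
have : V (p^-1).
  have -> : p^-1 = (p ^+ e / s) ^+ j * ((s ^+ j / ev iota s q`_0) *
     (ev iota s q`_0 / t) * (t / p ^+ (e * j).+1)).
    rewrite expr_div_n -exprM exprS; field.
    by apply/and5P; split; rewrite ?expf_neq0.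
  apply: (vringM vV); first exact: (vringX vV).
  by apply: (vringM vV) => //; apply: (vringM vV).
by case: mp => [/eqP|//]; rewrite (negPf p0).
Qed.

Lemma order_exists t : t != 0 -> exists m : int, V (t / p ^ m) /\ V (p ^ m / t).
Proof.
move=> t0; have [Vt|Vt] := vringV vV t.
  by have [e He] := exact_power t0 Vt (order_bounded t0); exists e%:Z.
have tV0 : t^-1 != 0 by rewrite invr_eq0.
have [e []] := exact_power tV0 Vt (order_bounded tV0); rewrite invrK => V1 V2.
by exists (- e%:Z); rewrite -invr_expz invrK; split; rewrite mulrC.
Qed.

Lemma vring_unif_pow (m : int) : V (p ^ m) <-> 0 <= m.
Proof.
case: m => m; split=> //.
- by move=> _; exact: (vringX vV) (vmaxW vV mp).
- rewrite NegzE -invr_expz => Vp; case: mp => [/eqP|[]]; first by rewrite (negPf p0).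
  have -> : p^-1 = p ^+ m * (p ^+ m.+1)^-1.
    by rewrite exprS invfM mulrCA mulrV ?unitfE ?expf_neq0 // mulr1.
  by apply: (vringM vV) => //; exact: (vringX vV) (vmaxW vV mp).
Qed.

End Uniformizer.

(** A least positive value generates the value group: an element of infinite
    order with respect to it would contradict its algebraicity over k(s). *)
Lemma valuation_ring_point :
  exists P : point iota, forall t, t != 0 -> V t <-> 0 <= P t.
Proof.
have [p [p0 mp pmin]] := uniformizer_exists.
have /choice [o oP] : forall t, exists m : int,
    (t = 0 -> m = 0) /\ (t != 0 -> V (t / p ^ m) /\ V (p ^ m / t)).
  move=> t; have [->|t0] := eqVneq t 0; first by exists 0.
  have [m Hm] := order_exists p0 mp pmin t0; exists m; split=> // /eqP.
  by rewrite (negPf t0).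
have o_uniq t m : t != 0 -> V (t / p ^ m) -> V (p ^ m / t) -> o t = m.
  move=> t0 V1 V2; have [V3 V4] := (oP t).2 t0.
  have pn (i : int) : p ^ i != 0 by rewrite expfz_neq0.
  apply/eqP; rewrite eq_le; apply/andP; split; rewrite -subr_ge0.
    apply/(vring_unif_pow p0 mp); rewrite expfzDr // -invr_expz.
    have -> : p ^ m / p ^ o t = p ^ m / t * (t / p ^ o t) by rewrite mulrA divfK.
    exact: (vringM vV).
  apply/(vring_unif_pow p0 mp); rewrite expfzDr // -invr_expz.
  have -> : p ^ o t / p ^ m = p ^ o t / t * (t / p ^ m) by rewrite mulrA divfK.
  exact: (vringM vV).
have oV t : t != 0 -> V t <-> 0 <= o t.
  move=> t0; have [V3 V4] := (oP t).2 t0.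
  have pn : p ^ o t != 0 by rewrite expfz_neq0.
  split=> [Vt|/(vring_unif_pow p0 mp) Vp].
    apply/(vring_unif_pow p0 mp).
    by rewrite -(divfK t0 (p ^ o t)); exact: (vringM vV).
  by rewrite -(divfK pn t); exact: (vringM vV).
have oM u t : u != 0 -> t != 0 -> o (u * t) = o u + o t.
  move=> u0 t0; have [V1 V2] := (oP u).2 u0; have [V3 V4] := (oP t).2 t0.
  apply: o_uniq; rewrite ?mulf_neq0 // expfzDr //.
    by rewrite invfM mulrACA; exact: (vringM vV V1 V3).
  by rewrite invfM mulrACA; exact: (vringM vV V2 V4).
have oD u t : u != 0 -> t != 0 -> u + t != 0 -> Num.min (o u) (o t) <= o (u + t).
  move=> u0 t0 ut0.
  wlog le_ut : u t u0 t0 ut0 / o u <= o t.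
    move=> H; have [le|/ltW le] := leP (o u) (o t).
      by have := H _ _ u0 t0 ut0 le; rewrite min_l.
    by have := H t u t0 u0; rewrite addrC min_l //; apply.
  rewrite min_l //; have := oM u (1 + t / u) u0.
  have E : u * (1 + t / u) = u + t by field.
  rewrite E; have ut1 : 1 + t / u != 0.
    by apply: contraNneq ut0 => e; rewrite -E e mulr0.
  move=> -> //; rewrite lerDl; apply/(oV _ ut1).
  apply: (vringD vV); first exact: (vring1 vV).
  apply/(oV _ _); first by rewrite mulf_neq0 ?invr_eq0.
  have := oM (t / u) u; rewrite divfK // => e.
  by move: le_ut; rewrite e ?mulf_neq0 ?invr_eq0 // lerDr.
have o_const c : c != 0 -> o (iota c) = 0.
  move=> c0; apply: o_uniq; rewrite ?fmorph_eq0 // expr0z ?divr1 ?mul1r //.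
  by rewrite -fmorphV.
have o_unif : exists2 t, t != 0 & o t = 1.
  exists p => //; apply: o_uniq; rewrite // expr1z divff //; exact: (vring1 vV).
by exists (Point ((oP 0).1 erefl) oM oD o_const o_unif).
Qed.

End Discreteness.

(** * Order functions *)

Lemma point_ext (k K : fieldType) (iota : {rmorphism k -> K}) (P Q : point iota) :
  (forall t, P t = Q t) -> P = Q.
Proof.
case: P Q => oP a1 a2 a3 a4 a5 [oQ b1 b2 b3 b4 b5] /= e.
have {}e : oP = oQ by apply/funext.
by case: _ / e b1 b2 b3 b4 b5 => *; congr Point; exact: Prop_irrelevance.
Qed.

(** The order of 0 is infinite, whatever value an order function takes there. *)
Definition ordge (k K : fieldType) (iota : {rmorphism k -> K}) (P : point iota)
  (t : K) (n : int) := t = 0 \/ n <= P t.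

Section Orders.
Variables (k K : fieldType) (iota : {rmorphism k -> K}) (P : point iota).
Implicit Types (s t : K) (n m : int).

Lemma ord1 : P 1 = 0.
Proof. by have := ord_const P (oner_neq0 k); rewrite rmorph1. Qed.

Lemma ordV t : P t^-1 = - P t.
Proof.
have [->|t0] := eqVneq t 0; first by rewrite invr0 ord0 oppr0.
apply/eqP; rewrite -addr_eq0 -ordM ?invr_eq0 // mulVf //; apply/eqP/ord1.
Qed.

Lemma ordN t : P (- t) = P t.
Proof.
have [->|t0] := eqVneq t 0; first by rewrite oppr0.
rewrite -mulN1r ordM ?oppr_eq0 ?oner_neq0 //.
have -> : -1 = iota (-1) by rewrite rmorphN rmorph1.
by rewrite ord_const ?add0r // oppr_eq0 oner_neq0.
Qed.

Lemma ord_div s t : s != 0 -> t != 0 -> P (s / t) = P s - P t.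
Proof. by move=> s0 t0; rewrite ordM ?invr_eq0 // ordV. Qed.

Lemma ordX t (n : nat) : P (t ^+ n) = P t *+ n.
Proof.
have [->|t0] := eqVneq t 0.
  by case: n => [|n]; rewrite ?ord1 // exprS mul0r ord0 mul0rn.
elim: n => [|n IHn]; first exact: ord1.
by rewrite exprS ordM ?expf_neq0 // IHn mulrS.
Qed.

Lemma ordXz t m : P (t ^ m) = m * P t.
Proof.
case: m => m; first by rewrite -exprnP ordX pmulrn -mulrzr mulrC intz.
by rewrite NegzE -invr_expz ordV -exprnP ordX mulNr pmulrn -mulrzr mulrC intz.
Qed.

Lemma ordge_neq0 t n : t != 0 -> ordge P t n <-> n <= P t.
Proof. by move=> t0; split=> [[/eqP|//]|]; [rewrite (negPf t0)|right]. Qed.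

Lemma ordge0 n : ordge P 0 n.
Proof. by left. Qed.

Lemma ordgeW t n m : m <= n -> ordge P t n -> ordge P t m.
Proof. by move=> mn [->|nt]; [left|right; exact: le_trans nt]. Qed.

Lemma ordge_ord t : ordge P t (P t).
Proof. by right. Qed.

Lemma ordgeD s t n : ordge P s n -> ordge P t n -> ordge P (s + t) n.
Proof.
have [->|s0] := eqVneq s 0; first by rewrite add0r.
have [->|t0] := eqVneq t 0; first by rewrite addr0.
have [->|st0] := eqVneq (s + t) 0; first by left.
move=> /ordge_neq0 ns /ordge_neq0 nt; right.
by apply: le_trans (ordD P s0 t0 st0); rewrite le_min ns ?nt.
Qed.

Lemma ordgeN t n : ordge P t n -> ordge P (- t) n.
Proof. by move=> [->|nt]; [left; rewrite oppr0|right; rewrite ordN]. Qed.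

Lemma ordgeB s t n : ordge P s n -> ordge P t n -> ordge P (s - t) n.
Proof. by move=> ns nt; apply: ordgeD => //; exact: ordgeN. Qed.

Lemma ordgeM s t n m : ordge P s n -> ordge P t m -> ordge P (s * t) (n + m).
Proof.
have [->|s0] := eqVneq s 0; first by rewrite mul0r; left.
have [->|t0] := eqVneq t 0; first by rewrite mulr0; left.
move=> /ordge_neq0 ns /ordge_neq0 nt; right; rewrite ordM //.
by apply: lerD; [exact: ns|exact: nt].
Qed.

Lemma ordgeMl s t n : ordge P s 0 -> ordge P t n -> ordge P (s * t) n.
Proof. by move=> s0 tn; have := ordgeM s0 tn; rewrite add0r. Qed.

Lemma ordgeMr s t n : ordge P s n -> ordge P t 0 -> ordge P (s * t) n.
Proof. by move=> s0 tn; rewrite mulrC; apply: ordgeMl. Qed.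

Lemma ordge_sum (I : Type) (r : seq I) (Q : pred I) (F : I -> K) n :
  (forall i, Q i -> ordge P (F i) n) -> ordge P (\sum_(i <- r | Q i) F i) n.
Proof.
move=> QF; apply: (big_ind (fun x => ordge P x n)) => //; first exact: ordge0.
by move=> ? ?; exact: ordgeD.
Qed.

Lemma ordge_const c : ordge P (iota c) 0.
Proof.
have [->|c0] := eqVneq c 0; first by rewrite rmorph0; left.
by right; rewrite ord_const.
Qed.

Lemma ordgeX t (n : nat) : ordge P t 0 -> ordge P (t ^+ n) 0.
Proof.
move=> t0; elim: n => [|n IHn]; first by right; rewrite ord1.
by rewrite exprS; exact: ordgeMl.
Qed.

Lemma ordge_ev s (a : {poly k}) : ordge P s 0 -> ordge P (ev iota s a) 0.
Proof.
move=> s0; rewrite evE; apply: ordge_sum => i _.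
by apply: ordgeMl; [exact: ordge_const|exact: ordgeX].
Qed.

Lemma ord_dominant s t : s != 0 -> ordge P t (P s + 1) ->
  s + t != 0 /\ P (s + t) = P s.
Proof.
move=> s0 [->|st]; first by rewrite addr0.
have [->|t0] := eqVneq t 0; first by rewrite addr0.
have st0 : s + t != 0.
  apply: contraTneq st => /eqP; rewrite addr_eq0 => /eqP->.
  by rewrite ordN -ltNge ltzD1.
split=> //; apply/eqP; rewrite eq_le; apply/andP; split; last first.
  by apply: le_trans (ordD P s0 t0 st0); rewrite le_min lexx /= (le_trans _ st) // lerDl.
have := ordD P st0 (_ : - t != 0) _; rewrite addrK ordN oppr_eq0 => /(_ t0 s0).
by rewrite ge_min => /orP[//|] le_ts; exfalso; lia.
Qed.

Lemma ord_unit_const c t : c != 0 -> ordge P (t - iota c) 1 -> t != 0 /\ P t = 0.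
Proof.
move=> c0 tc; have ic0 : iota c != 0 by rewrite fmorph_eq0.
have := @ord_dominant (iota c) (t - iota c) ic0.
have -> : iota c + (t - iota c) = t by ring.
by rewrite ord_const // add0r; apply.
Qed.

Lemma ev_headE s (a : {poly k}) :
  ev iota s a = ev iota s (drop_poly 1 a) * s + iota a`_0.
Proof. by rewrite {1}(poly_headE a) rmorphD rmorphM /= evX evC. Qed.

Lemma ord_ev_unit s (a : {poly k}) : ordge P s 1 -> a`_0 != 0 ->
  ev iota s a != 0 /\ P (ev iota s a) = 0.
Proof.
move=> s1 a0; apply: (ord_unit_const a0); rewrite ev_headE addrK.
by apply: ordgeMl => //; apply: ordge_ev; exact: ordgeW s1.
Qed.

End Orders.

(** The orders of the factors add up, and none of them is negative. *)
Lemma ordge_prod_root (k K : fieldType) (iota : {rmorphism k -> K})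
    (P : point iota) (t : K) (c : k) (rs : seq k) : c != 0 -> ordge P t 0 ->
  ordge P (iota c * \prod_(z <- rs) (t - iota z)) 1 ->
  exists2 z, z \in rs & ordge P (t - iota z) 1.
Proof.
move=> c0 t0; elim: rs => [|z rs IHrs].
  by rewrite big_nil mulr1 => /ordge_neq0; rewrite fmorph_eq0 ord_const // => /(_ c0).
rewrite big_cons => H; have [Hz|Hz] := pselect (ordge P (t - iota z) 1).
  by exists z; rewrite ?mem_head.
have [|z' z'rs Hz'] := IHrs; last by exists z'; rewrite // in_cons z'rs orbT.
have tz0 : t - iota z != 0 by apply: contra_notN Hz => /eqP ->; left.
have otz : P (t - iota z) = 0.
  have [/eqP|] := ordgeB t0 (ordge_const P z); first by rewrite (negPf tz0).
  rewrite le_eqVlt => /orP[/eqP //|lt]; case: Hz; right; lia.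
have := ordgeM (ordge_ord P (t - iota z)^-1) H.
by rewrite ordV otz oppr0 add0r mulrCA mulKf.
Qed.

Section Residues.
Variables (k : closedFieldType) (K : fieldType) (iota : {rmorphism k -> K}).
Variables (s : K) (n : nat).
Hypotheses (s0 : s != 0) (fin : finite_over iota s n).

Lemma ev_roots (t : K) (p : {poly k}) : p != 0 -> exists rs : seq k,
  p = lead_coef p *: \prod_(z <- rs) ('X - z%:P) /\
  ev iota t p = iota (lead_coef p) * \prod_(z <- rs) (t - iota z).
Proof.
move=> p0; have [rs Dp] := closed_field_poly_normal p; exists rs; split=> //.
rewrite {1}Dp -mul_polyC rmorphM /= evC rmorph_prod; congr (_ * _).
by apply: eq_bigr => z _; rewrite rmorphB /= evX evC.
Qed.

(** As K is algebraic over k(s) and k is algebraically closed, the residue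
    field of a zero of s is k. *)
Lemma residue_exists (P : point iota) (t : K) : 0 < P s -> ordge P t 0 ->
  exists c, ordge P (t - iota c) 1.
Proof.
move=> sP tP; have [a [[i0 ai0] Da]] := finite_over_primitive fin s0 (fun i => t ^+ i).
pose r := \poly_(i < n.+1) (a (inord i))`_0.
have r0 : r != 0.
  apply: contraNneq ai0 => /(congr1 (fun q : {poly k} => q`_i0)).
  by rewrite coef_poly ltn_ord inord_val coef0 => ->.
have s1 : ordge P s 1 by right; lia.
have [rs [_ Dr]] := ev_roots t r0.
suff: ordge P (ev iota t r) 1.
  by rewrite Dr => /ordge_prod_root[] // => [|z _ ?]; [rewrite lead_coef_eq0|exists z].
have -> : ev iota t r = \sum_(i < n.+1) iota (a i)`_0 * t ^+ i.
  rewrite /ev /horner_morph; transitivity (\poly_(i < n.+1) iota (a (inord i))`_0).[t].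
    congr _.[_]; apply/polyP => i; rewrite coef_map /= !coef_poly.
    by case: ifP => // _; rewrite rmorph0.
  by rewrite horner_poly; apply: eq_bigr => i _; rewrite inord_val.
have -> : \sum_(i < n.+1) iota (a i)`_0 * t ^+ i =
    - \sum_(i < n.+1) ev iota s (drop_poly 1 (a i)) * s * t ^+ i.
  apply/eqP; rewrite -addr_eq0 -big_split /= -[X in _ == X]Da; apply/eqP.
  by apply: eq_bigr => i _; rewrite [in RHS]ev_headE mulrDl addrC.
apply: ordgeN; apply: ordge_sum => i _; apply: ordgeMr; last exact: ordgeX.
by apply: ordgeMl => //; apply: ordge_ev; exact: ordgeW s1.
Qed.

End Residues.

(** * Finiteness of fibers *)

Section Approximation.
Variables (k K : fieldType) (iota : {rmorphism k -> K}).
Implicit Types P Q : point iota.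

(** Otherwise the ring of P would be contained in that of Q; but a discrete
    valuation ring has no proper overring besides its field of fractions. *)
Lemma separate_weak P Q : P <> Q -> exists t, [/\ t != 0, 0 <= P t & Q t < 0].
Proof.
move=> PQ; apply: contrapT => not; apply: PQ.
have le t : t != 0 -> 0 <= P t -> 0 <= Q t.
  move=> t0 Pt; rewrite leNgt; apply/negP => Qt; apply: not; by exists t.
have u t : t != 0 -> P t = 0 -> Q t = 0.
  move=> t0 Pt; apply/eqP; rewrite eq_le le ?Pt // andbT -oppr_ge0 -ordV.
  by apply: le; rewrite ?invr_eq0 // ordV Pt.
have [p p0 Pp] := ord_uniformizer P.
have mul t : t != 0 -> Q t = P t * Q p.
  move=> t0; have pt0 : p ^ (P t) != 0 by rewrite expfz_neq0.
  have := u (t / p ^ (P t)); rewrite !ord_div // !ordXz Pp mulr1 subrr.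
  by rewrite mulf_neq0 ?invr_eq0 // => /(_ isT erefl) /eqP; rewrite subr_eq0 => /eqP.
have [q q0 Qq] := ord_uniformizer Q.
have Qp : 0 <= Q p by apply: le; rewrite ?Pp.
have Qp1 : Q p = 1.
  have := mul q q0; rewrite Qq => /esym e.
  have : (Q p %| 1)%Z by apply/dvdzP; exists (P q).
  by rewrite dvdz1 => /eqP e1; rewrite -[Q p]gez0_abs // e1.
apply: point_ext => t; have [->|t0] := eqVneq t 0; first by rewrite !ord0.
by rewrite mul // Qp1 mulr1.
Qed.

Lemma separate P Q : P <> Q -> exists t, [/\ t != 0, 0 < P t & Q t < 0].
Proof.
move=> PQ; have [a [a0 Pa Qa]] := separate_weak PQ.
have [|b [b0 Qb Pb]] := @separate_weak Q P; first by move=> e; apply: PQ.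
by exists (a / b); split; rewrite ?mulf_neq0 ?invr_eq0 // ord_div //; lia.
Qed.

Lemma separate_family P (Q : nat -> point iota) m :
  (forall i, (i < m)%N -> P <> Q i) ->
  exists t, [/\ t != 0, 0 < P t & forall i, (i < m)%N -> Q i t < 0].
Proof.
elim: m => [|m IHm] PQ.
  have [p p0 Pp] := ord_uniformizer P; exists p; split=> //; by rewrite Pp.
have [|z [z0 Pz Qz]] := IHm; first by move=> i lt_im; apply: PQ; exact: ltnW.
have [Qmz|Qmz] := ltP (Q m z) 0.
  exists z; split=> // i; rewrite ltnS leq_eqVlt => /orP[/eqP->//|]; exact: Qz.
have [y [y0 Py Qy]] := separate (PQ m (ltnSn m)).
pose r := (1 + \sum_(i < m) `|Q i z|)%N.
have yr0 : y ^+ r != 0 by rewrite expf_neq0.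
have r_big i : (i < m)%N -> - Q i z < r%:Z.
  move=> lt_im; have := leq_bigmax (Ordinal lt_im).
  have : (`|Q i z| <= \sum_(i < m) `|Q i z|)%N.
    by rewrite (bigD1 (Ordinal lt_im)) //= leq_addr.
  rewrite /r; lia.
(* The exponent r is so large that z and y ^+ r have different orders at each
   Q i. *)
have Qzy i : (i < m.+1)%N -> z + y ^+ r != 0 /\ Q i (z + y ^+ r) < 0.
  rewrite ltnS leq_eqVlt => /orP[/eqP->|lt_im].
    rewrite addrC; have [|n0 ->] := ord_dominant (P := Q m) (t := z) yr0.
      right; rewrite ordX; apply: le_trans Qmz; rewrite /r mulrS; nia.
    split=> //; rewrite ordX /r mulrS; nia.
  have Qiz := Qz i lt_im; have ri := r_big i lt_im.
  have [Qiy|Qiy] := ltP (Q i y) 0.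
    rewrite addrC; have [|n0 ->] := ord_dominant (P := Q i) (t := z) yr0.
      by right; rewrite ordX; nia.
    by split=> //; rewrite ordX; nia.
  have [|n0 ->] := ord_dominant (P := Q i) (s := z) (t := y ^+ r) z0.
    by right; rewrite ordX; nia.
  by split.
exists (z + y ^+ r); have [n0 _] := Qzy m (ltnSn m); split=> //; last first.
  by move=> i /Qzy[].
apply: lt_le_trans (ordD P z0 yr0 n0); rewrite lt_min Pz ordX /r mulrS; nia.
Qed.

(** Weak approximation yields t_i of order 0 at the i-th of n+1 distinct zeros
    of s and of positive order at the others; they are independent over k(s). *)
Lemma zeros_bound (s : K) n (Q : nat -> point iota) : s != 0 ->
  finite_over iota s n -> injective Q -> (forall i, 0 < Q i s) -> False.
Proof.
move=> s0 fin Qinj Qs.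
have /choice [t tP] : forall i, exists t : K, (i <= n)%N -> [/\ t != 0, Q i t = 0 &
    forall j, (j <= n)%N -> j != i -> 0 < Q j t].
  move=> i; have [|z [z0 Qz Qjz]] := @separate_family (Q i) (Q \o bump i) n.
    by move=> j _ /Qinj; apply/eqP; exact: neq_bump.
  have [|n0 oz] := ord_dominant (P := Q i) (t := z) (oner_neq0 K).
    by right; rewrite ord1; lia.
  exists (1 + z)^-1 => le_in; split; rewrite ?invr_eq0 //; first by rewrite ordV oz ord1.
  move=> j le_jn ji; rewrite ordV oppr_gt0.
  have : Q j z < 0.
    have := Qjz (unbump i j); rewrite /= unbumpKcond (negPf ji) add0n; apply.
    move: ji le_jn; rewrite /unbump; case: (ltnP i j) => /=; lia.
  move=> Qjz'; rewrite addrC; have [|_ ->] := ord_dominant (P := Q j) (t := 1) z0.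
    by right; rewrite ord1; lia.
  by [].
have [a [[i ai0] Da]] := finite_over_primitive fin s0 (fun i => t i).
have s1 j : ordge (Q j) s 1 by right; have := Qs j; lia.
have lei (j : 'I_n.+1) : (j <= n)%N by rewrite -ltnS.
have [ti0 Qti _] := tP i (lei i); have [evi0 oevi] := ord_ev_unit (s1 i) ai0.
have [||n0 _] := @ord_dominant _ _ _ (Q i) (ev iota s (a i) * t i)
  (\sum_(j < n.+1 | j != i) ev iota s (a j) * t j).
- by rewrite mulf_neq0.
- apply: ordge_sum => j ji; rewrite ordM // oevi Qti !add0r.
  have [_ _ tj] := tP j (lei j); apply: ordgeMl.
    by apply: ordge_ev; exact: ordgeW (s1 i).
  by right; have := tj i; rewrite -ltnS ltn_ord eq_sym ji => /(_ isT isT); lia.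
by move: Da n0; rewrite (bigD1 i) //= => ->; rewrite eqxx.
Qed.

Lemma finite_zeros (s : K) n : s != 0 -> finite_over iota s n ->
  finite_set [set P : point iota | 0 < P s].
Proof.
move=> s0 fin; apply: contrapT => /infiniteP /card_leP[Q].
apply: (@zeros_bound s n (fun i => sval (Q (to_setT i)))) => //.
  move=> i j /val_inj /(@inj _ _ _ Q); rewrite !inE => /(_ I I).
  by move/(congr1 sval).
by move=> i; have := svalP (Q (to_setT i)); rewrite inE.
Qed.

End Approximation.

(** * Plane models of function fields *)

Definition ev2 (A B : comNzRingType) (iota : {rmorphism A -> B}) (X Y : B) :
    {poly {poly A}} -> B := ev (ev iota X) Y.

HB.instance Definition _ (A B : comNzRingType) (iota : {rmorphism A -> B})
  (X Y : B) := GRing.RMorphism.on (ev2 iota X Y).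

Section Ev2.
Variables (A B : comNzRingType) (iota : {rmorphism A -> B}) (X Y : B).
Implicit Types (g : {poly {poly A}}).

Lemma ev2C (a : {poly A}) : ev2 iota X Y a%:P = ev iota X a.
Proof. exact: evC. Qed.

Lemma ev2X : ev2 iota X Y 'X = Y.
Proof. exact: evX. Qed.

Lemma ev2N g : ev2 iota X Y (- g) = - ev2 iota X Y g.
Proof. exact: (raddfN (ev2 iota X Y)). Qed.

Lemma ev2D g h : ev2 iota X Y (g + h) = ev2 iota X Y g + ev2 iota X Y h.
Proof. exact: (raddfD (ev2 iota X Y)). Qed.

Lemma ev2B g h : ev2 iota X Y (g - h) = ev2 iota X Y g - ev2 iota X Y h.
Proof. exact: (raddfB (ev2 iota X Y)). Qed.

Lemma ev2M g h : ev2 iota X Y (g * h) = ev2 iota X Y g * ev2 iota X Y h.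
Proof. exact: (rmorphM (ev2 iota X Y)). Qed.

Lemma ev2Z (a : {poly A}) g : ev2 iota X Y (a *: g) = ev iota X a * ev2 iota X Y g.
Proof. by rewrite -mul_polyC rmorphM /= ev2C. Qed.

Lemma ev2E g : ev2 iota X Y g = \sum_(i < size g) ev iota X g`_i * Y ^+ i.
Proof. exact: evE. Qed.

End Ev2.

Lemma ev_comp_poly (A B : comNzRingType) (iota : {rmorphism A -> B}) (s : B)
    (a b : {poly A}) : ev iota s (a \Po b) = ev iota (ev iota s b) a.
Proof.
rewrite comp_polyE rmorph_sum [RHS]evE; apply: eq_bigr => i _.
by rewrite -mul_polyC rmorphM rmorphXn /= evC.
Qed.

Lemma ev_rmorph (A B C : comNzRingType) (iota : {rmorphism A -> B})
    (j : {rmorphism B -> C}) (s : B) (a : {poly A}) :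
  j (ev iota s a) = ev (j \o iota) (j s) a.
Proof.
by rewrite !evE rmorph_sum; apply: eq_bigr => i _; rewrite rmorphM rmorphXn.
Qed.

Lemma ev_widen (A B : comNzRingType) (iota : {rmorphism A -> B}) (s : B)
    (a : {poly A}) N : (size a <= N)%N ->
  ev iota s a = \sum_(i < N) iota a`_i * s ^+ i.
Proof.
move=> sN; rewrite evE (big_ord_widen N (fun i => iota a`_i * s ^+ i) sN).
rewrite big_mkcond; apply: eq_bigr => i _; case: ltnP => // le.
by rewrite nth_default // rmorph0 mul0r.
Qed.

Lemma ev2_widen (A B : comNzRingType) (iota : {rmorphism A -> B}) (X Y : B)
    (g : {poly {poly A}}) N : (size g <= N)%N ->
  ev2 iota X Y g = \sum_(i < N) ev iota X g`_i * Y ^+ i.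
Proof. exact: ev_widen. Qed.

Lemma ev2_comp_poly (A B : comNzRingType) (iota : {rmorphism A -> B}) (X Y : B)
    (g h : {poly {poly A}}) :
  ev2 iota X Y (g \Po h) = ev2 iota X (ev2 iota X Y h) g.
Proof. exact: ev_comp_poly. Qed.

Lemma finite_over_shift (k K : fieldType) (iota : {rmorphism k -> K}) (s : K) n c :
  finite_over iota s n -> finite_over iota (s - iota c) n.
Proof.
move=> fin t; have [a [[i ai0] Da]] := fin t.
exists (fun i => a i \Po ('X + c%:P)); split.
  by exists i; rewrite comp_poly2_eq0 // size_XaddC.
rewrite -[RHS]Da; apply: eq_bigr => j _; congr (_ * _).
by rewrite ev_comp_poly rmorphD /= evX evC subrK.
Qed.

Lemma finite_over_inv (k K : fieldType) (iota : {rmorphism k -> K}) (s : K) n :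
  s != 0 -> finite_over iota s n -> finite_over iota s^-1 n.
Proof.
move=> s0 fin t; have [a [[i ai0] Da]] := fin t.
pose N := \max_j size (a j).
have sN j : (size (a j) <= N)%N by exact: (leq_bigmax j).
pose b j := \poly_(m < N) (a j)`_(N.-1 - m).
exists b; split.
  have ai_gt0 : (0 < size (a i))%N by rewrite size_poly_gt0.
  have lt1 : ((size (a i)).-1 < N)%N by rewrite prednK.
  exists i; apply: contraNneq ai0 => /(congr1 (fun q : {poly k} => q`_(N.-1 - (size (a i)).-1))).
  rewrite coef0 coef_poly; case: ifP => [_|]; last lia.
  by rewrite subKn -?lead_coefE; [move/eqP; rewrite lead_coef_eq0|lia].
have Eb j : ev iota s^-1 (b j) = s ^- N.-1 * ev iota s (a j).
  have [N0|N_gt0] := posnP N.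
    have := sN j; rewrite N0 leqn0 size_poly_eq0 => /eqP aj0.
    have -> : b j = 0 by apply/polyP => m; rewrite coef_poly N0 coef0.
    by rewrite aj0 !rmorph0 mulr0.
  rewrite (ev_widen _ _ (size_poly _ _ : (size (b j) <= N)%N)).
  rewrite (ev_widen _ _ (sN j)).
  rewrite (reindex_inj rev_ord_inj) mulr_sumr; apply: eq_bigr => m _ /=.
  have lt_mN := ltn_ord m.
  rewrite coef_poly (_ : N - m.+1 < N)%N; last lia.
  rewrite (_ : N.-1 - (N - m.+1) = m)%N; last lia.
  rewrite mulrCA; congr (_ * _); apply: (mulfI (expf_neq0 N.-1 s0)).
  rewrite mulrA divff ?expf_neq0 // mul1r exprVn.
  have -> : s ^+ N.-1 = s ^+ m * s ^+ (N - m.+1) by rewrite -exprD; congr (_ ^+ _); lia.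
  by rewrite mulfK ?expf_neq0.
under eq_bigr => j _ do rewrite Eb -mulrA.
by rewrite -mulr_sumr Da mulr0.
Qed.

(** The function field of the plane curve F = 0, with Y of degree d over k(X).
    Irreducibility of F enters through pc_min: no relation between X and Y has
    a smaller degree in Y. *)
Record plane_curve (k K : fieldType) (iota : {rmorphism k -> K}) (X Y : K)
    (F : {poly {poly k}}) (d : nat) : Prop := PlaneCurve {
  pc_gt0 : (0 < d)%N;
  pc_size : size F = d.+1;
  pc_X0 : X != 0;
  pc_Y0 : Y != 0;
  pc_root : ev2 iota X Y F = 0;
  pc_min : forall g : {poly {poly k}}, (size g <= d)%N -> ev2 iota X Y g = 0 -> g = 0;
  pc_gen : forall t, exists g h, ev2 iota X Y h != 0 /\
    t = ev2 iota X Y g / ev2 iota X Y h }.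

Section PlaneCurve.
Variables (k K : fieldType) (iota : {rmorphism k -> K}) (X Y : K).
Variables (F : {poly {poly k}}) (d : nat).
Hypothesis pc : plane_curve iota X Y F d.

Lemma evX_eq0 (a : {poly k}) : (ev iota X a == 0) = (a == 0).
Proof.
apply/eqP/eqP => [a0|->]; last exact: rmorph0.
have /(congr1 (fun g : {poly {poly k}} => g`_0)) : a%:P = 0.
  apply: (pc_min pc); last by rewrite ev2C.
  exact: leq_trans (size_polyC_leq1 _) (pc_gt0 pc).
by rewrite coefC coef0.
Qed.

Lemma pc_lead : F`_d != 0.
Proof.
have -> : F`_d = lead_coef F by rewrite lead_coefE (pc_size pc).
by rewrite lead_coef_eq0 -size_poly_eq0 (pc_size pc).
Qed.

Lemma reduce (g : {poly {poly k}}) : exists (c : {poly k}) (q r : {poly {poly k}}),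
  [/\ c != 0, (size r <= d)%N & c *: g = q * F + r].
Proof.
have F0 : F != 0 by rewrite -size_poly_eq0 (pc_size pc).
exists (lead_coef F ^+ scalp g F), (g %/ F), (g %% F); split.
- by rewrite expf_neq0 ?lead_coef_eq0.
- by rewrite -ltnS -(pc_size pc) ltn_modpN0.
- exact: Pdiv.WeakIdomain.divp_eq.
Qed.

(** Over k(X), K is generated by 1, Y, ..., Y^d-1, so d+1 elements are the
    values of the rows of a singular matrix over k[X]. *)
Lemma finite_over_X : finite_over iota X d.
Proof.
move=> t; have /choice [g gP] := fun i : 'I_d.+1 => pc_gen pc (t i).
have /choice [h hP] := gP; pose H := \prod_i h i.
pose G i := g i * \prod_(j | j != i) h j.
have EG i : ev2 iota X Y (G i) = t i * ev2 iota X Y H.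
  have [hi0 ->] := hP i; rewrite /H (bigD1 i) //= /G !rmorphM /=.
  by rewrite mulrA divfK.
have H0 : ev2 iota X Y H != 0.
  by rewrite rmorph_prod prodf_seq_neq0; apply/allP => i _; exact: (hP i).1.
have /choice [c cP] := fun i => reduce (G i).
have /choice [q qP] := cP; have /choice [r rP] := qP.
pose A : 'M[{poly k}]_d.+1 := \matrix_(i, j) (r i)`_j.
have [v v0 vA] : exists2 v : 'rV[{poly k}]_d.+1, v != 0 & v *m A = 0.
  apply/det0P; apply/eqP; rewrite (expand_det_col _ ord_max) big1 // => i _.
  by rewrite mxE nth_default ?mul0r //; have [] := rP i.
have /rV0Pn [i vi0] := v0.
exists (fun i => v 0 i * c i); split.
  by exists i; rewrite mulf_neq0 //; have [] := rP i.
have vr : \sum_i v 0 i *: r i = 0.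
  apply/polyP => j; rewrite coef_sum coef0; have [le_jd|lt_dj] := leqP j d.
    have /(congr1 (fun M : 'rV_d.+1 => M 0 (inord j))) := vA.
    rewrite !mxE => E; rewrite -[RHS]E; apply: eq_bigr => m _.
    by rewrite mxE coefZ inordK.
  rewrite big1 // => m _; rewrite coefZ nth_default ?mulr0 //.
  by have [_ sr _] := rP m; apply: leq_trans sr (ltnW lt_dj).
apply: (mulIf H0); rewrite mul0r mulr_suml -[RHS](rmorph0 (ev2 iota X Y)) -vr.
rewrite rmorph_sum; apply: eq_bigr => j _ /=; have [_ _ E] := rP j.
rewrite -mulrA -EG ev2Z rmorphM -mulrA; congr (_ * _).
by rewrite /= -ev2Z E rmorphD rmorphM /= (pc_root pc) mulr0 add0r.
Qed.

(** The linear dependence over k[X] between 1, Y, ..., Y^d-1 and t, solved for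
    t. *)
Lemma representation t : exists (n : {poly {poly k}}) (q : {poly k}),
  [/\ q != 0, (size n <= d)%N & t = ev2 iota X Y n / ev iota X q].
Proof.
pose u (i : 'I_d.+1) := if (i < d)%N then Y ^+ i else t.
have [a [[i ai0] Da]] := finite_over_X u.
pose g := \poly_(i < d) a (inord i).
have E : ev2 iota X Y g + ev iota X (a ord_max) * t = 0.
  rewrite -Da big_ord_recr /= /u ltnn; congr (_ + _).
  rewrite /ev2 (ev_widen _ _ (size_poly _ _ : (size g <= d)%N)).
  apply: eq_bigr => j _; rewrite coef_poly /= ltn_ord; congr (ev _ _ (a _) * _).
  by apply: val_inj; rewrite /= inordK // ltnS ltnW.
exists (- g), (a ord_max).
have q0 : a ord_max != 0.
  apply: contraNneq ai0 => a0; move: E; rewrite a0 rmorph0 mul0r addr0 => Eg.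
  have g0 := pc_min pc (size_poly _ _) Eg.
  have [lt_id|le_di] := ltnP i d.
    have := congr1 (fun q : {poly {poly k}} => q`_i) g0.
    by rewrite coef_poly lt_id coef0 inord_val => ->.
  have -> : i = ord_max by apply: val_inj => /=; have := ltn_ord i; lia.
  by rewrite a0.
split=> //; first by rewrite size_polyN size_poly.
have aX0 : ev iota X (a ord_max) != 0 by rewrite evX_eq0.
by move/eqP: E; rewrite addr_eq0 ev2N => /eqP ->; rewrite opprK mulrC mulKf.
Qed.

Section Conjugates.
Variables (S : fieldType) (j : {rmorphism K -> S}) (y : S).
Hypothesis y_root : ev2 (j \o iota) (j X) y F = 0.
Let iota' : {rmorphism k -> S} := j \o iota.

Lemma conj_ev (a : {poly k}) : ev iota' (j X) a = j (ev iota X a).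
Proof. by rewrite ev_rmorph. Qed.

(** A nonzero element of K satisfies an equation over k[X] with nonzero
    constant term, and this term survives the evaluation at a conjugate of
    Y. *)
Lemma conj_eq0 g : (ev2 iota' (j X) y g == 0) = (ev2 iota X Y g == 0).
Proof.
have le p : ev2 iota X Y p = 0 -> ev2 iota' (j X) y p = 0.
  move=> p0; have [c [q [r [c0 sr E]]]] := reduce p.
  have r0 : r = 0.
    apply: (pc_min pc) => //; have := congr1 (ev2 iota X Y) E.
    by rewrite ev2Z p0 mulr0 rmorphD rmorphM /= (pc_root pc) mulr0 add0r.
  have := congr1 (ev2 iota' (j X) y) E.
  rewrite r0 addr0 ev2Z rmorphM /= y_root mulr0 => /eqP.
  by rewrite mulf_eq0 conj_ev fmorph_eq0 evX_eq0 (negPf c0) => /eqP.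
apply/idP/eqP => [/eqP g0|/le->//].
apply/eqP; apply: contraTT isT => h0.
have [p p0 Dp] := algebraic_dep (pc_X0 pc) finite_over_X h0.
have Q0 : ev2 iota X Y (\sum_(i < size p) p`_i *: g ^+ i) = 0.
  by rewrite -[RHS]Dp rmorph_sum; apply: eq_bigr => i _; rewrite /= ev2Z rmorphXn.
have sp := coef0_size_gt0 p0.
have := le _ Q0; rewrite rmorph_sum /=; case: (size p) sp => // m _.
rewrite big_ord_recl big1 => [|i _].
  rewrite addr0 ev2Z expr0 rmorph1 mulr1 conj_ev => /eqP.
  by rewrite fmorph_eq0 evX_eq0 (negPf p0).
by rewrite ev2Z rmorphXn /= g0 expr0n mulr0.
Qed.

Lemma conjugate_exists : exists sigma : {rmorphism K -> S},
  [/\ forall c, sigma (iota c) = j (iota c), sigma X = j X & sigma Y = y].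
Proof.
have /choice [g gP] := pc_gen pc; have {gP} /choice [h hP] := gP.
pose s t := ev2 iota' (j X) y (g t) / ev2 iota' (j X) y (h t).
have sE p q : ev2 iota X Y q != 0 ->
    s (ev2 iota X Y p / ev2 iota X Y q) = ev2 iota' (j X) y p / ev2 iota' (j X) y q.
  move=> q0; have [] := hP (ev2 iota X Y p / ev2 iota X Y q).
  rewrite /s; move: (h _) (g _) => h' g' h'0 E.
  apply/eqP; rewrite eqr_div ?conj_eq0 // -!ev2M -subr_eq0 -ev2B conj_eq0.
  by rewrite ev2B !ev2M subr_eq0 -eqr_div // -E.
have sP p : s (ev2 iota X Y p) = ev2 iota' (j X) y p.
  have := sE p 1; rewrite !rmorph1 !divr1; apply; exact: oner_neq0.
have sB : zmod_morphism s.
  move=> a b; have [ha ->] := hP a; have [hb ->] := hP b.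
  rewrite -mulNr addf_div // -ev2N -!ev2M -ev2D !sE ?ev2M ?mulf_neq0 //.
  by rewrite -mulNr addf_div ?conj_eq0 // ev2D !ev2M ev2N.
have sM : monoid_morphism s.
  split; first by have := sP 1; rewrite !rmorph1.
  move=> a b; have [ha ->] := hP a; have [hb ->] := hP b.
  rewrite mulf_div -!ev2M !sE ?ev2M ?mulf_neq0 //.
  by rewrite mulf_div.
pose sA := GRing.isZmodMorphism.Build _ _ s sB.
pose sMM := GRing.isMonoidMorphism.Build _ _ s sM.
pose sigma : {rmorphism K -> S} := HB.pack s sA sMM.
exists sigma; split.
- by move=> c; have := sP c%:P%:P; rewrite !ev2C !evC.
- by have := sP 'X%:P; rewrite !ev2C !evX.
- by have := sP 'X; rewrite !ev2X.
Qed.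

End Conjugates.

End PlaneCurve.

(** * Orders at smooth points *)

Section SmoothOrder.
Variables (k K : fieldType) (iota : {rmorphism k -> K}) (P : point iota).
Hypothesis char_k : [pchar k] =i pred0.
Implicit Types (G : {poly {poly k}}).

Lemma ordge_ev2 (U W : K) (G : {poly {poly k}}) :
  ordge P U 0 -> ordge P W 0 -> ordge P (ev2 iota U W G) 0.
Proof.
move=> U0 W0; rewrite ev2E; apply: ordge_sum => i _.
by apply: ordgeMl; [exact: ordge_ev|exact: ordgeX].
Qed.

(** As a polynomial in U, G is restr0 G + U * quot0 G. *)
Definition restr0 (G : {poly {poly k}}) : {poly k} := \poly_(j < size G) (G`_j)`_0.
Definition quot0 (G : {poly {poly k}}) : {poly {poly k}} :=
  \poly_(j < size G) drop_poly 1 (G`_j).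

Lemma coef_restr0 G j : (restr0 G)`_j = (G`_j)`_0.
Proof. by rewrite coef_poly; case: ltnP => // /(nth_default 0) ->; rewrite coef0. Qed.

Lemma coef_quot0 G j : (quot0 G)`_j = drop_poly 1 (G`_j).
Proof.
rewrite coef_poly; case: ltnP => // /(nth_default 0) ->.
by apply/polyP => i; rewrite coef_drop_poly !coef0.
Qed.

Lemma ev2_restr0 (U W : K) G :
  ev2 iota U W G = ev iota W (restr0 G) + U * ev2 iota U W (quot0 G).
Proof.
rewrite (ev_widen _ _ (size_poly _ _ : (size (restr0 G) <= size G)%N)).
rewrite (ev2_widen _ _ _ (size_poly _ _ : (size (quot0 G) <= size G)%N)).
rewrite ev2E mulr_sumr -big_split; apply: eq_bigr => j _ /=.
by rewrite coef_restr0 coef_quot0 ev_headE; ring.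
Qed.

Lemma restr0_deriv G : restr0 G^`() = (restr0 G)^`().
Proof.
by apply/polyP => j; rewrite coef_restr0 !coef_deriv coefMn coef_restr0.
Qed.

Lemma ord_ev2_unit (U W : K) G : ordge P U 1 -> ordge P W 1 -> (G`_0)`_0 != 0 ->
  ev2 iota U W G != 0 /\ P (ev2 iota U W G) = 0.
Proof.
move=> U1 W1 G0; have [|n0 o0] := @ord_ev_unit _ _ _ P W (restr0 G) W1.
  by rewrite coef_restr0.
have := @ord_dominant _ _ _ P _ (U * ev2 iota U W (quot0 G)) n0.
rewrite -ev2_restr0 o0 add0r; apply; apply: ordgeMr => //.
by apply: ordge_ev2; [exact: ordgeW U1|exact: ordgeW W1].
Qed.

Lemma root0_split (g : {poly k}) : g != 0 ->
  exists m h, g = h * 'X^m /\ h`_0 != 0.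
Proof.
move=> g0; have [m [h]] := multiplicity_XsubC g 0.
rewrite g0 /= => h0 E; exists m, h; split; first by rewrite E subr0.
by rewrite -horner_coef0.
Qed.

(** Either G_W does not vanish at the origin, or G_U does not. In the second
    case U equals G(0, W) up to a unit; if m is the order of vanishing of G(0,
    W), the orders of U and G_W are m and m - 1 times that of W, as m is not 0
    in k. *)
Lemma smooth_order (U W : K) G : U != 0 -> 0 < P U -> ordge P W 1 ->
  ev2 iota U W G = 0 ->
  ((G`_0)`_0 = 0 -> (G`_0)`_1 != 0 \/ (G`_1)`_0 != 0) ->
  ev2 iota U W G^`() != 0 /\ P (ev2 iota U W G^`()) < P U.
Proof.
move=> U0 PU W1 G0 smooth; have U1 : ordge P U 1 by right; lia.
have U_ge0 : ordge P U 0 by exact: ordgeW U1.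
have W_ge0 : ordge P W 0 by exact: ordgeW W1.
have {}smooth : (G`_0)`_1 != 0 \/ (G`_1)`_0 != 0.
  apply: smooth; apply/eqP; apply: contraTT isT => G00.
  by have [] := ord_ev2_unit U1 W1 G00; rewrite G0 eqxx.
have [GW|GW] := eqVneq (G`_1)`_0 0; last first.
  have [|n0 ->//] := @ord_ev2_unit U W G^`() U1 W1.
  by rewrite coef_deriv mulr1n.
have GU : (G`_0)`_1 != 0 by case: smooth => //; rewrite GW eqxx.
have [|q0 oq] := @ord_ev2_unit U W (quot0 G) U1 W1.
  by rewrite coef_quot0 coef_drop_poly.
have Eg : ev iota W (restr0 G) = - (U * ev2 iota U W (quot0 G)).
  by apply/eqP; rewrite -addr_eq0 -ev2_restr0 G0.
have Eg0 : ev iota W (restr0 G) != 0 by rewrite Eg oppr_eq0 mulf_neq0.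
have g0 : restr0 G != 0 by apply: contraNneq Eg0 => ->; rewrite rmorph0.
have [m [h [Dg h0]]] := root0_split g0.
have [hW0 ohW] := ord_ev_unit W1 h0.
have oU : P U = P (ev iota W (restr0 G)) by rewrite Eg ordN ordM // oq addr0.
have EgW : ev iota W (restr0 G) = ev iota W h * W ^+ m.
  by rewrite Dg evM evXn evX.
case: m => [|m] in Dg EgW.
  by move: PU; rewrite oU EgW mulr1 ohW ltxx.
have W0 : W != 0.
  by apply: contraNneq Eg0 => W0; rewrite EgW W0 exprS mul0r mulr0.
have PW : 1 <= P W by exact/ordge_neq0.
pose h1 := h *+ m.+1 + h^`() * 'X.
have h10 : h1`_0 != 0.
  rewrite coefD coefMX /= addr0 coefMn -mulr_natr mulf_neq0 //.
  by have /pcharf0P -> := char_k.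
have [h1W0 oh1W] := ord_ev_unit W1 h10.
have Dg' : (restr0 G)^`() = h1 * 'X^m.
  rewrite Dg derivM derivXn /h1 mulrDl mulrnAr -mulrnAl addrC; congr (_ + _).
  by rewrite -mulrA -exprS.
have og' : P (ev iota W (restr0 G)^`()) = P W *+ m.
  by rewrite Dg' evM evXn evX ordM ?expf_neq0 // oh1W add0r ordX.
have g'0 : ev iota W (restr0 G)^`() != 0.
  by rewrite Dg' evM evXn evX mulf_neq0 ?expf_neq0.
have PU' : P U = P W *+ m.+1 by rewrite oU EgW ordM ?expf_neq0 // ohW add0r ordX.
rewrite ev2_restr0 restr0_deriv.
have [|n0 ->] := @ord_dominant _ _ _ P _ (U * ev2 iota U W (quot0 G^`())) g'0.
  apply: ordgeW (ordgeMr (ordge_ord P U) (ordge_ev2 _ U_ge0 W_ge0)).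
  by rewrite og' PU' mulrS [leRHS]addrC lerD2l.
by rewrite og' PU' mulrS ltrDr (lt_le_trans _ PW).
Qed.

End SmoothOrder.

(** * Orders of the derivative *)

Lemma horner_map_deriv (k : comNzRingType) (G : {poly {poly k}}) (eta : k) :
  (map_poly (@deriv k) G).[eta%:P] = (G.[eta%:P])^`().
Proof.
rewrite (horner_coef_wide _ (size_poly _ _ : (size (map_poly _ G) <= size G)%N)).
rewrite horner_coef raddf_sum; apply: eq_bigr => j _.
by rewrite /= coef_map_id0 ?deriv0 // -!polyC_exp derivM derivC mulr0 addr0.
Qed.

Section DerivativeOrder.
Variables (k : closedFieldType) (K : fieldType) (iota : {rmorphism k -> K}).
Variables (X Y : K) (F : {poly {poly k}}) (d : nat).
Hypothesis pc : plane_curve iota X Y F d.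
Hypothesis char_k : [pchar k] =i pred0.
Implicit Types (G H : {poly {poly k}}).

Lemma derivF_neq0 : ev2 iota X Y F^`() != 0.
Proof.
have F0 : F != 0 by rewrite -size_poly_eq0 (pc_size pc).
have d0 := pc_gt0 pc; apply/eqP => /(pc_min pc).
rewrite -ltnS -(pc_size pc) lt_size_deriv // => /(_ isT).
move=> /(congr1 (fun g : {poly {poly k}} => g`_d.-1)).
rewrite coef_deriv prednK // coef0 -scaler_nat => /eqP.
rewrite scaler_eq0; have /pcharf0P -> := char_k; rewrite eqn0Ngt d0 /=.
by apply/negP; exact: pc_lead pc.
Qed.

Lemma coef0_shift (p : {poly k}) c : (p \Po ('X + c%:P))`_0 = p.[c].
Proof. by rewrite -horner_coef0 horner_comp !hornerE. Qed.

Lemma coef1_shift (p : {poly k}) c : (p \Po ('X + c%:P))`_1 = p^`().[c].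
Proof.
have := coef_deriv (p \Po ('X + c%:P)) 0; rewrite mulr1n => <-.
by rewrite deriv_comp derivD derivX derivC addr0 mulr1 coef0_shift.
Qed.

(** G as a polynomial in X - c and Y. *)
Definition shiftX (c : k) (G : {poly {poly k}}) : {poly {poly k}} :=
  \poly_(j < size G) (G`_j \Po ('X + c%:P)).

Lemma coef_shiftX c G j : (shiftX c G)`_j = G`_j \Po ('X + c%:P).
Proof.
by rewrite coef_poly; case: ltnP => // /(nth_default 0) ->; rewrite comp_poly0.
Qed.

Lemma ev2_shiftX c G W : ev2 iota (X - iota c) W (shiftX c G) = ev2 iota X W G.
Proof.
rewrite (ev2_widen _ _ _ (size_poly _ _ : (size (shiftX c G) <= size G)%N)).
rewrite [RHS]ev2E; apply: eq_bigr => j _; rewrite coef_shiftX; congr (_ * _).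
by rewrite ev_comp_poly evD evX evC subrK.
Qed.

Lemma shiftX_deriv c G : (shiftX c G)^`() = shiftX c G^`().
Proof.
by apply/polyP => j; rewrite coef_deriv !coef_shiftX coef_deriv raddfMn.
Qed.

Lemma horner_shiftX c G eta :
  (shiftX c G).[eta%:P] = G.[eta%:P] \Po ('X + c%:P).
Proof.
rewrite (horner_coef_wide _ (size_poly _ _ : (size (shiftX c G) <= size G)%N)).
rewrite horner_coef rmorph_sum; apply: eq_bigr => j _ /=.
by rewrite coef_shiftX rmorphM /= -!polyC_exp comp_polyC.
Qed.

Lemma euler_sum G W N : (size G <= N)%N ->
  W * ev2 iota X W G^`() = \sum_(j < N) (ev iota X G`_j *+ j) * W ^+ j.
Proof.
move=> sN; rewrite -{1}(ev2X iota X W) -ev2M (@ev2_widen _ _ _ _ _ _ N).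
  apply: eq_bigr => -[[|j] jN] _ /=; rewrite coefXM /=.
    by rewrite rmorph0 !mul0r.
  by rewrite coef_deriv raddfMn.
have [->|G0] := eqVneq G 0; first by rewrite deriv0 mulr0 size_poly0.
have [->|G'0] := eqVneq G^`() 0; first by rewrite mulr0 size_poly0.
by rewrite mulrC size_mulX // (leq_trans _ sN) // lt_size_deriv.
Qed.

(** F as a polynomial in X and Y^-1, up to a power of Y. *)
Definition reverseY : {poly {poly k}} := \poly_(j < d.+1) F`_(d - j).

Lemma coef_reverseY j : (j <= d)%N -> reverseY`_j = F`_(d - j).
Proof. by move=> le_jd; rewrite coef_poly ltnS le_jd. Qed.

Lemma reverse_sum (u : nat -> K) :
  \sum_(j < d.+1) u (d - j)%N * Y^-1 ^+ j = Y^-1 ^+ d * \sum_(i < d.+1) u i * Y ^+ i.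
Proof.
rewrite (reindex_inj rev_ord_inj) mulr_sumr; apply: eq_bigr => i _ /=.
rewrite subSS subKn; last by rewrite -ltnS.
rewrite mulrCA; congr (_ * _).
have -> : Y^-1 ^+ d = Y^-1 ^+ (d - i) * Y^-1 ^+ i.
  by rewrite -exprD subnK // -ltnS.
by rewrite -mulrA -exprMn mulVf ?(pc_Y0 pc) // expr1n mulr1.
Qed.

Lemma reverseY_root : ev2 iota X Y^-1 reverseY = 0.
Proof.
rewrite (ev2_widen _ _ _ (size_poly _ _ : (size reverseY <= d.+1)%N)).
under eq_bigr => j _ do rewrite coef_reverseY ?(ltn_ord j : (j <= d)%N) //.
rewrite (reverse_sum (fun i => ev iota X F`_i)).
rewrite -(@ev2_widen _ _ _ _ _ F d.+1) ?(pc_size pc) //.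
by rewrite (pc_root pc) mulr0.
Qed.

Lemma reverseY_deriv :
  Y^-1 * ev2 iota X Y^-1 reverseY^`() = - (Y^-1 ^+ d * (Y * ev2 iota X Y F^`())).
Proof.
rewrite (euler_sum _ (size_poly _ _ : (size reverseY <= d.+1)%N)).
rewrite (@euler_sum F _ d.+1) ?(pc_size pc) //.
transitivity (\sum_(j < d.+1) (ev iota X F`_(d - j) *+ (d - (d - j))) * Y^-1 ^+ j).
  by apply: eq_bigr => j _; rewrite coef_reverseY ?subKn // -ltnS.
rewrite (reverse_sum (fun i => ev iota X F`_i *+ (d - i))) -mulrN; congr (_ * _).
apply/eqP; rewrite -addr_eq0 -big_split /=; apply/eqP.
transitivity (ev2 iota X Y F *+ d); last by rewrite (pc_root pc) mul0rn.
rewrite (@ev2_widen _ _ _ _ _ F d.+1) ?(pc_size pc) // -sumrMnl.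
apply: eq_bigr => i _; rewrite -mulrDl -mulrnDr subnK ?mulrnAl //.
by rewrite -ltnS.
Qed.

Variables (P : point iota) (c : k).
Hypothesis Pc : 0 < P (X - iota c).

Let Xc0 : X - iota c != 0.
Proof. by apply: contraTneq Pc => ->; rewrite ord0. Qed.

Hypothesis smooth : forall eta, eta != 0 -> F.[eta%:P].[c] = 0 ->
  (map_poly (@deriv k) F).[eta%:P].[c] != 0 \/ F^`().[eta%:P].[c] != 0.
Hypothesis smooth_bottom : (F`_0).[c] = 0 -> (F`_0)^`().[c] != 0.
Hypothesis smooth_top : (F`_d).[c] = 0 -> (F`_d)^`().[c] != 0.

(** The curve is smooth at the points over X = c in the coordinates X - c and
    W, where W is Y^-1, Y or Y - eta according to the sign of the order of Y,
    so that smooth_order applies. In the first case F_Y differs from its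
    counterpart by a power of Y, which is absorbed as l < d. *)
Lemma derivative_order l : (0 < l < d)%N ->
  P (ev2 iota X Y F^`()) < P Y *+ l.-1 + P (X - iota c).
Proof.
move=> /andP[l0 ld]; have d1 : (1 < d)%N by exact: leq_ltn_trans ld.
have [Y_lt0|Y_gt0|Y_eq0] := ltgtP (P Y) 0.
- have W1 : ordge P Y^-1 1 by right; rewrite ordV; lia.
  have root : ev2 iota (X - iota c) Y^-1 (shiftX c reverseY) = 0.
    by rewrite ev2_shiftX reverseY_root.
  have [|] := smooth_order char_k Xc0 Pc W1 root.
    rewrite !coef_shiftX coef0_shift coef1_shift coef_reverseY // subn0.
    by move=> /smooth_top; left.
  rewrite shiftX_deriv ev2_shiftX => n0 lt.
  have := congr1 P reverseY_deriv.
  rewrite ordN !ordM ?mulf_neq0 ?expf_neq0 ?invr_eq0 ?(pc_Y0 pc) ?derivF_neq0 //.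
  rewrite ordX !ordV => E.
  have -> : P (ev2 iota X Y F^`()) =
      - P Y + P (ev2 iota X Y^-1 reverseY^`()) + P Y *+ d - P Y.
    by rewrite E mulNrn; ring.
  have -> : P Y *+ d = P Y + P Y *+ l + P Y *+ (d.-1 - l).
    by rewrite -mulrS -mulrnDr; congr (_ *+ _); lia.
  have : P Y *+ (d.-1 - l) <= 0 by apply: mulrn_wle0; exact: ltW.
  have -> : P Y *+ l = P Y + P Y *+ l.-1 by rewrite -mulrS prednK.
  lia.
- have W1 : ordge P Y 1 by right; lia.
  have root : ev2 iota (X - iota c) Y (shiftX c F) = 0.
    by rewrite ev2_shiftX (pc_root pc).
  have [|] := smooth_order char_k Xc0 Pc W1 root.
    by rewrite !coef_shiftX coef0_shift coef1_shift => /smooth_bottom; left.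
  rewrite shiftX_deriv ev2_shiftX => _ lt; apply: lt_le_trans lt _.
  by rewrite lerDr; apply: mulrn_wge0; exact: ltW.
- have [|eta Yeta] := residue_exists Xc0 (finite_over_shift c (finite_over_X pc)) Pc (t := Y).
    by right; rewrite Y_eq0.
  have eta0 : eta != 0.
    apply: contraPneq Yeta => ->; rewrite rmorph0 subr0.
    by move=> /ordge_neq0 => /(_ (pc_Y0 pc)); rewrite Y_eq0.
  pose G := shiftX c F \Po ('X + eta%:P%:P).
  have root : ev2 iota (X - iota c) (Y - iota eta) G = 0.
    rewrite /G ev2_comp_poly ev2D ev2X ev2C evC subrK.
    by rewrite ev2_shiftX (pc_root pc).
  have G_0 H : (H \Po ('X + eta%:P%:P))`_0 = H.[eta%:P] :> {poly k}.
    by rewrite -horner_coef0 horner_comp !hornerE.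
  have G' : G^`() = shiftX c F^`() \Po ('X + eta%:P%:P).
    by rewrite deriv_comp derivD derivX derivC addr0 mulr1 shiftX_deriv.
  have [|_] := smooth_order char_k Xc0 Pc Yeta root.
    have -> : G`_1 = G^`()`_0 by rewrite coef_deriv mulr1n.
    rewrite G' !G_0 !horner_shiftX !coef0_shift coef1_shift -horner_map_deriv.
    exact: smooth.
  rewrite G' ev2_comp_poly ev2D ev2X ev2C evC subrK ev2_shiftX.
  by rewrite Y_eq0 mul0rn add0r.
Qed.

End DerivativeOrder.

(** * Initial forms *)

Lemma seq_minimum (T : eqType) (g : T -> int) (s : seq T) : s != [::] ->
  exists2 z, z \in s & forall z', z' \in s -> g z <= g z'.
Proof.
elim: s => [//|z s IHs] _; have [->|s0] := eqVneq s [::].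
  by exists z; rewrite ?mem_head // => z'; rewrite mem_seq1 => /eqP->.
have [y ys ymin] := IHs s0; have [le|lt] := leP (g y) (g z).
  exists y; first by rewrite in_cons ys orbT.
  by move=> z'; rewrite in_cons => /orP[/eqP->|/ymin].
exists z; first exact: mem_head.
by move=> z'; rewrite in_cons => /orP[/eqP->//|/ymin]; apply: le_trans; exact: ltW.
Qed.

Section Families.
Variables (k : fieldType) (T : eqType) (r : seq T) (e1 e2 : T -> nat).
Implicit Types (b : T -> k).

(** Coefficients are separate from exponents, so that F and its logarithmic
    derivatives belong to one family. *)
Definition fam_poly b : {poly {poly k}} :=
  \sum_(z <- r) (b z *: 'X^(e1 z)) *: 'X^(e2 z).

Definition fam_face (p q M : int) : pred T :=
  fun z => p * (e1 z)%:Z + q * (e2 z)%:Z == M.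

Lemma coef_fam_poly b j :
  (fam_poly b)`_j = \sum_(z <- r | e2 z == j) b z *: 'X^(e1 z).
Proof.
rewrite coef_sum [RHS]big_mkcond; apply: eq_bigr => z _.
by rewrite coefZ coefXn eq_sym; case: eqP; rewrite ?mulr1 ?mulr0.
Qed.

Lemma horner_fam_poly b eta c : (fam_poly b).[eta%:P].[c] =
  \sum_(z <- r) b z * (c ^+ e1 z * eta ^+ e2 z).
Proof.
rewrite /fam_poly !horner_sum; apply: eq_bigr => z _.
by rewrite hornerZ hornerXn -polyC_exp hornerM hornerZ hornerXn hornerC mulrA.
Qed.

Lemma deriv_fam_poly b : 'X * (fam_poly b)^`() = fam_poly (fun z => b z *+ e2 z).
Proof.
rewrite raddf_sum mulr_sumr; apply: eq_bigr => z _ /=.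
rewrite derivZ derivXn; case: (e2 z) => [|n] /=.
  by rewrite !mulr0n scaler0 mulr0 !scale0r.
by rewrite -scalerAr mulrnAr -exprS -scalerMnr -!scalerMnl.
Qed.

Lemma ev2_fam_poly (K : fieldType) (iota : {rmorphism k -> K}) (X Y : K) b :
  ev2 iota X Y (fam_poly b) = \sum_(z <- r) iota (b z) * (X ^+ e1 z * Y ^+ e2 z).
Proof.
rewrite /fam_poly rmorph_sum; apply: eq_bigr => z _ /=.
by rewrite ev2Z rmorphXn /= ev2X mulrA -mul_polyC evM evC evXn evX.
Qed.

(** Non-degeneracy for the faces that are cut out by integer weights.
    Logarithmic derivatives replace the partial derivatives: they have the
    same zeros on the torus and preserve the exponents. *)
Definition nondegenerate_family b := forall p q M : int,
  (forall z, z \in r -> M <= p * (e1 z)%:Z + q * (e2 z)%:Z) ->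
  (exists2 z, z \in r & fam_face p q M z) ->
  forall xi eta : k, xi != 0 -> eta != 0 ->
  \sum_(z <- r | fam_face p q M z) b z * (xi ^+ e1 z * eta ^+ e2 z) = 0 ->
  \sum_(z <- r | fam_face p q M z) (b z *+ e1 z) * (xi ^+ e1 z * eta ^+ e2 z) = 0 ->
  \sum_(z <- r | fam_face p q M z) (b z *+ e2 z) * (xi ^+ e1 z * eta ^+ e2 z) = 0 ->
  False.

Lemma fam_minimum (p q : int) : r != [::] -> exists2 M,
  forall z, z \in r -> M <= p * (e1 z)%:Z + q * (e2 z)%:Z &
  exists2 z, z \in r & fam_face p q M z.
Proof.
move=> /(seq_minimum (fun z => p * (e1 z)%:Z + q * (e2 z)%:Z)) [z zr zmin].
by exists (p * (e1 z)%:Z + q * (e2 z)%:Z) => //; exists z; rewrite // /fam_face.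
Qed.

Lemma sum_face0 b (xi eta : k) (Q : pred T) (e : T -> nat) n :
  (forall z, Q z -> e z = n) ->
  \sum_(z <- r | Q z) b z * (xi ^+ e1 z * eta ^+ e2 z) = 0 ->
  \sum_(z <- r | Q z) (b z *+ e z) * (xi ^+ e1 z * eta ^+ e2 z) = 0.
Proof.
move=> Qn S0; transitivity (0 *+ n : k); last by rewrite mul0rn.
by rewrite -[X in X *+ n]S0 -sumrMnl; apply: eq_bigr => z /Qn ->; rewrite mulrnAl.
Qed.

Lemma horner_row b j c : ((fam_poly b)`_j).[c] =
  \sum_(z <- r | e2 z == j) b z * (c ^+ e1 z * 1 ^+ e2 z).
Proof.
rewrite coef_fam_poly horner_sum; apply: eq_bigr => z _.
by rewrite hornerZ hornerXn expr1n mulr1.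
Qed.

Lemma horner_row_deriv b j c : c * (((fam_poly b)`_j)^`()).[c] =
  \sum_(z <- r | e2 z == j) (b z *+ e1 z) * (c ^+ e1 z * 1 ^+ e2 z).
Proof.
rewrite coef_fam_poly raddf_sum horner_sum mulr_sumr; apply: eq_bigr => z _ /=.
rewrite derivZ hornerZ derivXn hornerMn hornerXn expr1n mulr1.
case: (e1 z) => [|n] /=; first by rewrite !mulr0n !mulr0 mul0r.
by rewrite mulrnAl !mulrnAr mulrCA -exprS.
Qed.

(** The initial form along a horizontal edge is a polynomial in X times a
    power of Y, so that its logarithmic derivative by Y vanishes where it
    does, and only the derivative by X is left. *)
Lemma nondegenerate_row b j (q : int) : nondegenerate_family b ->
  (forall z, z \in r -> q * j%:Z <= q * (e2 z)%:Z) -> q != 0 ->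
  (fam_poly b)`_j != 0 ->
  forall c, c != 0 -> ((fam_poly b)`_j).[c] = 0 -> (((fam_poly b)`_j)^`()).[c] != 0.
Proof.
move=> nd qj q0 rj0 c c0; rewrite horner_row => S0; apply/eqP => D0.
have faceE z : fam_face 0 q (q * j%:Z) z = (e2 z == j).
  by rewrite /fam_face mul0r add0r (inj_eq (mulfI q0)).
have sumE (u : T -> k) :
    \sum_(z <- r | fam_face 0 q (q * j%:Z) z) u z = \sum_(z <- r | e2 z == j) u z.
  by apply: eq_bigl => z; exact: faceE.
apply: (nd 0 q (q * j%:Z) _ _ c 1 c0 (oner_neq0 k)); rewrite ?sumE //.
- by move=> z /qj; rewrite mul0r add0r.
- have [/hasP[z zr zj]|/hasPn none] := boolP (has (fun z => e2 z == j) r).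
    by exists z => //; rewrite faceE.
  case/eqP: rj0; rewrite coef_fam_poly big_seq_cond big1 // => z /andP[/none].
  by move/negPf->.
- by rewrite -horner_row_deriv D0 mulr0.
- by apply: (sum_face0 (n := j)) => // z /eqP.
Qed.

Lemma nondegenerate_interior b : nondegenerate_family b -> r != [::] ->
  forall c eta, c != 0 -> eta != 0 -> (fam_poly b).[eta%:P].[c] = 0 ->
  (map_poly (@deriv k) (fam_poly b)).[eta%:P].[c] != 0 \/
  (fam_poly b)^`().[eta%:P].[c] != 0.
Proof.
move=> nd r0 c eta c0 eta0 S0.
have [DX|] := eqVneq (map_poly (@deriv k) (fam_poly b)).[eta%:P].[c] 0; last by left.
right; apply/eqP => DY.
have faceE z : fam_face 0 0 0 z by rewrite /fam_face !mul0r.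
have sumE (u : T -> k) :
    \sum_(z <- r | fam_face 0 0 0 z) u z = \sum_(z <- r) u z.
  by apply: eq_bigl => z; exact: faceE.
apply: (nd 0 0 0 _ _ c eta c0 eta0); rewrite ?sumE -?horner_fam_poly //.
- by case: (r) r0 => // z s _; exists z; [exact: mem_head|exact: faceE].
- move: DX; rewrite horner_map_deriv => DX.
  rewrite horner_fam_poly.
  transitivity (c * ((fam_poly b).[eta%:P])^`().[c]); last by rewrite DX mulr0.
  rewrite /fam_poly horner_sum raddf_sum horner_sum mulr_sumr.
  apply: eq_bigr => z _; rewrite hornerZ hornerXn -polyC_exp /= derivM derivC mulr0 addr0.
  rewrite derivZ hornerM hornerZ hornerC derivXn hornerMn hornerXn.
  by case: (e1 z) => [|n] /=; rewrite ?mulr0n ?mul0r ?mulr0 ?mul0r ?mulr0 // exprS; ring.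
- by rewrite -deriv_fam_poly hornerM hornerX hornerM DY mulr0.
Qed.

End Families.

(** * Orders at the boundary of the torus *)

Section ResidueArithmetic.
Variables (k K : fieldType) (iota : {rmorphism k -> K}) (P : point iota).

Definition residue (a : K) (c : k) := ordge P (a - iota c) 1.

Lemma residue_ge0 a c : residue a c -> ordge P a 0.
Proof.
move=> ac; rewrite -(subrK (iota c) a); apply: ordgeD; last exact: ordge_const.
exact: ordgeW ac.
Qed.

Lemma residueM a a' c c' : residue a c -> residue a' c' -> residue (a * a') (c * c').
Proof.
move=> ac ac'; rewrite /residue.
have -> : a * a' - iota (c * c') = a * (a' - iota c') + (a - iota c) * iota c'.
  by rewrite rmorphM; ring.
apply: ordgeD; first exact: ordgeMl (residue_ge0 ac) ac'.
exact: ordgeMr ac (ordge_const _ _).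
Qed.

Lemma residueX a c n : residue a c -> residue (a ^+ n) (c ^+ n).
Proof.
move=> ac; elim: n => [|n IHn]; last by rewrite !exprS; exact: residueM.
by rewrite /residue rmorph1 subrr; exact: ordge0.
Qed.

Lemma residue_unit a c : a != 0 -> P a = 0 -> residue a c -> c != 0.
Proof.
move=> a0 Pa; apply: contraPneq => ->; rewrite /residue rmorph0 subr0.
by move=> /(ordge_neq0 _ _ a0); rewrite Pa.
Qed.

Lemma residue_ord a c : c != 0 -> residue a c -> a != 0 /\ P a = 0.
Proof. exact: ord_unit_const. Qed.

Lemma residue_const0 a c : a = 0 -> residue a c -> c = 0.
Proof.
move=> ->; rewrite /residue sub0r => H; apply/eqP; apply: contraTT isT => c0.
have : ordge P (iota c) 1 by rewrite -[iota c]opprK; exact: ordgeN.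
by move=> /ordge_neq0; rewrite fmorph_eq0 ord_const // => /(_ c0).
Qed.

End ResidueArithmetic.

Section InitialForm.
Variables (k K : fieldType) (iota : {rmorphism k -> K}) (P : point iota).
Variables (T : eqType) (r : seq T) (e1 e2 : T -> nat) (X Y t : K) (xi eta : k).
Hypotheses (X0 : X != 0) (Y0 : Y != 0) (t0 : t != 0) (Pt : P t = 1).
Hypothesis Xxi : residue P (X / t ^ (P X)) xi.
Hypothesis Yeta : residue P (Y / t ^ (P Y)) eta.

(** A monomial of weight w has order w; divided by t^M, only those on the face
    keep a nonzero residue. *)
Lemma initial_form (b : T -> k) M :
  (forall z, z \in r -> M <= P X * (e1 z)%:Z + P Y * (e2 z)%:Z) ->
  residue P (t ^ (- M) * ev2 iota X Y (fam_poly r e1 e2 b))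
    (\sum_(z <- r | fam_face e1 e2 (P X) (P Y) M z) b z * (xi ^+ e1 z * eta ^+ e2 z)).
Proof.
move=> Mle; rewrite /residue ev2_fam_poly mulr_sumr rmorph_sum /=.
rewrite [X in _ - X]big_mkcond -sumrB big_seq; apply: ordge_sum => z zr.
pose x1 := X / t ^ (P X); pose y1 := Y / t ^ (P Y).
have tn (m : int) : t ^ m != 0 by rewrite expfz_neq0.
have E : t ^ (- M) * (iota (b z) * (X ^+ e1 z * Y ^+ e2 z)) =
   iota (b z) * (t ^ (P X * (e1 z)%:Z + P Y * (e2 z)%:Z - M) * (x1 ^+ e1 z * y1 ^+ e2 z)).
  have tX (m : int) (e : nat) : t ^ (m * e%:Z) = (t ^ m) ^+ e by rewrite -exprz_exp.
  rewrite /x1 /y1 !expr_div_n !expfzDr // !tX.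
  by field; rewrite !expf_neq0 ?tn.
have xy := residueM (residueX (e1 z) Xxi) (residueX (e2 z) Yeta).
rewrite E; case: ifPn => [/eqP ->|].
  rewrite subrr expr0z mul1r rmorphM -mulrBr.
  exact: ordgeMl (ordge_const _ _) xy.
rewrite /fam_face subr0 => ne; apply: ordgeMl; first exact: ordge_const.
apply: ordgeMr (residue_ge0 xy); right; rewrite ordXz Pt mulr1.
have := Mle z zr; rewrite le_eqVlt eq_sym (negPf ne) /=; lia.
Qed.

End InitialForm.

Section BoundaryOrder.
Variables (k : closedFieldType) (K : fieldType) (iota : {rmorphism k -> K}).
Variables (X Y : K) (T : eqType) (r : seq T) (e1 e2 : T -> nat) (b : T -> k) (d : nat).
Let F := fam_poly r e1 e2 b.
Hypothesis pc : plane_curve iota X Y F d.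
Hypothesis char_k : [pchar k] =i pred0.
Hypothesis nd : nondegenerate_family r e1 e2 b.

(** With w = (ord X, ord Y), quasi-homogeneity makes w_1 X F_X + w_2 Y F_Y a
    multiple of F on the initial form.  If the initial form of Y F_Y vanished
    at the residues of X and Y, so would that of X F_X, as w_1 != 0. *)
Lemma boundary_order (P : point iota) M : P X != 0 ->
  (forall z, z \in r -> M <= P X * (e1 z)%:Z + P Y * (e2 z)%:Z) ->
  (exists2 z, z \in r & fam_face e1 e2 (P X) (P Y) M z) ->
  P (Y * ev2 iota X Y F^`()) = M.
Proof.
move=> PX0 Mle Mex.
have [t t0 Pt] := ord_uniformizer P.
have res a : a != 0 -> P a = 0 -> exists2 c, c != 0 & residue P a c.
  move=> a0 Pa; have aP : ordge P a 0 by right; rewrite Pa.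
  have [c ac] : exists c, residue P a c.
    have [lt|gt|/eqP] := ltgtP (P X) 0; last by rewrite (negPf PX0).
      apply: (residue_exists _ (finite_over_inv (pc_X0 pc) (finite_over_X pc))) => //.
        by rewrite invr_eq0 (pc_X0 pc).
      by rewrite ordV oppr_gt0.
    exact: (residue_exists (pc_X0 pc) (finite_over_X pc)).
  by exists c; first exact: residue_unit ac.
have unit a : a != 0 -> a / t ^ (P a) != 0 /\ P (a / t ^ (P a)) = 0.
  move=> a0; rewrite mulf_neq0 ?invr_eq0 ?expfz_neq0 // ord_div ?expfz_neq0 //.
  by rewrite ordXz Pt mulr1 subrr.
have [xi xi0 Xxi] := res _ (unit X (pc_X0 pc)).1 (unit X (pc_X0 pc)).2.
have [eta eta0 Yeta] := res _ (unit Y (pc_Y0 pc)).1 (unit Y (pc_Y0 pc)).2.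
have init b' := initial_form (pc_X0 pc) (pc_Y0 pc) t0 Pt Xxi Yeta b' Mle.
have S0 := residue_const0 _ (init b); rewrite -/F (pc_root pc) mulr0 in S0.
have {}S0 := S0 erefl.
have := init (fun z => b z *+ e2 z); rewrite -deriv_fam_poly ev2M ev2X.
set S2 := \sum_(z <- r | _) _ => S2res; set D := Y * _ in S2res *.
have tM0 : t ^ (- M) != 0 by rewrite expfz_neq0.
suff S2_neq0 : S2 != 0.
  have [n0 o0] := residue_ord S2_neq0 S2res.
  have D0 : D != 0 by apply: contraNneq n0 => ->; rewrite mulr0.
  by move: o0; rewrite ordM // ordXz Pt mulr1 addrC => /eqP; rewrite subr_eq0 => /eqP.
apply/eqP => S20; apply: (nd Mle Mex xi0 eta0 S0 _ S20).
set S1 := \sum_(z <- r | _) _.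
have E : (P X)%:~R * S1 + (P Y)%:~R * S2 = 0.
  rewrite /S1 /S2 !mulr_sumr -big_split /=.
  transitivity (M%:~R * \sum_(z <- r | fam_face e1 e2 (P X) (P Y) M z)
      b z * (xi ^+ e1 z * eta ^+ e2 z)); last by rewrite S0 mulr0.
  rewrite mulr_sumr; apply: eq_bigr => z /eqP <-.
  by rewrite intrD !intrM /= -!pmulrn -[b z *+ e1 z]mulr_natr -[b z *+ e2 z]mulr_natr; ring.
move/eqP: E; rewrite S20 mulr0 addr0 mulf_eq0 => /orP[|/eqP//].
have -> : (P X)%:~R = (-1) ^+ (P X < 0)%R * `|P X|%N%:R :> k.
  by rewrite [in LHS](intEsign (P X)) rmorphM rmorph_sign.
rewrite mulf_eq0 signr_eq0 /=; have /pcharf0P -> := char_k.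
by rewrite absz_eq0 (negPf PX0).
Qed.

End BoundaryOrder.

(** * Places over a point of the projective line *)

Record place (k L : fieldType) (iota : {rmorphism k -> L}) (s : L) (V : set L) :
  Prop := Place {
  place_ring : valuation_ring V;
  place_const : forall c, V (iota c);
  place_max : vmax V s }.

(** As k is algebraically closed, an element that is algebraic over k lies in
    k. *)
Lemma ev_transcendental (k : closedFieldType) (L : fieldType)
    (iota : {rmorphism k -> L}) (s : L) (a : {poly k}) :
  (forall c, s != iota c) -> ev iota s a = 0 -> a = 0.
Proof.
move=> sk a0; apply/eqP; apply: contraTT isT => an0.
have [rs [_ E]] := ev_roots iota s an0.
move/eqP: E; rewrite a0 eq_sym mulf_eq0 fmorph_eq0 lead_coef_eq0 (negPf an0) /=.
by rewrite prodf_seq_eq0 => /hasP[z _ /=]; rewrite subr_eq0 (negPf (sk z)).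
Qed.

(** A transcendental s is not invertible in k[s]. *)
Lemma place_exists (k : closedFieldType) (L : fieldType)
    (iota : {rmorphism k -> L}) (s : L) :
  (forall c, s != iota c) -> exists V, place iota s V.
Proof.
move=> sk; pose A0 := [set x | exists a : {poly k}, x = ev iota s a].
have s0 : s != 0 by rewrite -(rmorph0 iota) sk.
have [|||||V [vV A0V Vs]] := @valuation_ring_exists L A0 s.
- by exists 1; rewrite rmorph1.
- by move=> _ _ [a ->] [b ->]; exists (a - b); rewrite evB.
- by move=> _ _ [a ->] [b ->]; exists (a * b); rewrite evM.
- by exists 'X; rewrite evX.
- move=> [a sa]; have E : ev iota s ('X * a - 1) = 0.
    by rewrite evB evM evX rmorph1 -sa divff // subrr.
  have := congr1 (fun p : {poly k} => p`_0) (ev_transcendental sk E).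
  rewrite coefB coefXM coef1 coef0 /= sub0r => /eqP.
  by rewrite oppr_eq0 oner_eq0.
exists V; split=> //; last by right.
by move=> c; apply: A0V; exists c%:P; rewrite evC.
Qed.

(** The preimage of V under sigma is a valuation ring of K with s in its
    maximal ideal, hence the ring of a point. *)
Lemma place_point (k K L : fieldType) (iota : {rmorphism k -> K})
    (iota' : {rmorphism k -> L}) (sigma : {rmorphism K -> L}) (s : K) (n : nat) V :
  (forall c, sigma (iota c) = iota' c) -> s != 0 -> finite_over iota s n ->
  place iota' (sigma s) V -> exists P : point iota,
    [/\ 0 < P s, forall t, ordge P t 0 -> V (sigma t) &
        forall t, ordge P t 1 -> vmax V (sigma t)].
Proof.
move=> sk s0 fin [vV Vk Vs].
pose W := [set t | V (sigma t)].
have vW : valuation_ring W.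
  split.
  - by rewrite /W /= rmorph1; exact: (vring1 vV).
  - by move=> a b Wa Wb; rewrite /W /= rmorphB; exact: (vringB vV).
  - by move=> a b Wa Wb; rewrite /W /= rmorphM; exact: (vringM vV).
  - by move=> a; rewrite /W /= fmorphV; exact: (vringV vV).
have Wk c : W (iota c) by rewrite /W /= sk; exact: Vk.
have maxW t : vmax W t <-> vmax V (sigma t).
  rewrite /vmax /W /= fmorphV; split=> -[t0|]; try by right.
    by left; rewrite t0 rmorph0.
  by left; apply/eqP; rewrite -(fmorph_eq0 sigma) t0.
have [P HP] := valuation_ring_point vW Wk ((maxW s).2 Vs) s0 fin.
have WP t : t != 0 -> vmax W t <-> 0 < P t.
  move=> t0; have tV0 : t^-1 != 0 by rewrite invr_eq0.
  rewrite vmaxE // (HP _ tV0) ordV; split=> [/negP|]; rewrite oppr_ge0 ?ltNge //.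
  by move/negP.
exists P; split=> [|t|t]; first by apply/WP => //; exact/maxW.
  have [->|t0] := eqVneq t 0; first by rewrite rmorph0 => _; exact: (vring0 vV).
  by move=> /ordge_neq0 => /(_ t0) /(HP t t0).
move=> [->|Pt]; first by rewrite rmorph0; left.
have [->|t0] := eqVneq t 0; first by rewrite rmorph0; left.
by apply/maxW/WP => //; lia.
Qed.

Lemma ev_reverse (k K : fieldType) (iota : {rmorphism k -> K}) (s : K)
    (a : {poly k}) N : s != 0 -> (size a <= N.+1)%N ->
  ev iota s a = s ^+ N * ev iota s^-1 (\poly_(m < N.+1) a`_(N - m)).
Proof.
move=> s0 sN; rewrite (ev_widen _ _ sN) [ev iota s^-1 _](ev_widen _ _ (size_poly _ _)).
rewrite (reindex_inj rev_ord_inj) mulr_sumr; apply: eq_bigr => m _ /=.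
rewrite coef_poly ltn_ord subSS mulrCA; congr (_ * _).
have -> : s ^+ N = s ^+ (N - m) * s ^+ m by rewrite -exprD subnK // -ltnS.
by rewrite exprVn mulfK ?expf_neq0.
Qed.

(** * Rational functions of X *)

Section Rational.
Variables (k : closedFieldType) (L : fieldType) (iota : {rmorphism k -> L}).
Variable X : L.
Hypothesis X_trans : forall c, X != iota c.

Let ev_eq0 (a : {poly k}) : (ev iota X a == 0) = (a == 0).
Proof.
apply/eqP/eqP => [|->]; [exact: ev_transcendental|exact: rmorph0].
Qed.

Lemma place_unit c V (a : {poly k}) : place iota (X - iota c) V -> a.[c] != 0 ->
  ~ vmax V (ev iota X a).
Proof.
move=> [vV Vk Vs] ac; have -> : ev iota X a = ev iota (X - iota c) (a \Po ('X + c%:P)).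
  by rewrite ev_comp_poly evD evX evC subrK.
by apply: (ev_unit vV Vk Vs); rewrite coef0_shift.
Qed.

(** At a common root c of a and q, both can be divided by X - c. At a root c
    of q alone, (X - c) * a / q is not in the maximal ideal. *)
Lemma rational_regular (a q : {poly k}) : q != 0 ->
  (forall c, exists2 V, place iota (X - iota c) V &
     vmax V ((X - iota c) * (ev iota X a / ev iota X q))) ->
  exists a', ev iota X a / ev iota X q = ev iota X a'.
Proof.
move: {2}(size q) (leqnn (size q)) => m.
elim: m a q => [|m IHm] a q; first by rewrite leqn0 size_poly_eq0 => ->.
move=> sq q0 reg; have [sq1|sq1] := leqP (size q) 1.
  have E := size1_polyC sq1; have u0 : q`_0 != 0 by rewrite -polyC_eq0 -E.
  exists ((q`_0)^-1 *: a); rewrite -mul_polyC evM evC E evC fmorphV coefC /=.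
  by rewrite mulrC.
have [c qc] : exists c, root q c.
  by apply/closed_rootP; rewrite neq_ltn sq1 orbT.
have [q1 Dq] := factor_theorem _ _ qc.
have q10 : q1 != 0 by apply: contraNneq q0 => q10; rewrite Dq q10 mul0r.
have Eq : ev iota X q = ev iota X q1 * (X - iota c) by rewrite Dq evM evB evX evC.
have Xc0 : X - iota c != 0 by rewrite subr_eq0.
have [ac|ac] := eqVneq a.[c] 0.
  have /factor_theorem [a1 Da] : root a c by apply/rootP.
  have E : ev iota X a / ev iota X q = ev iota X a1 / ev iota X q1.
    by rewrite Eq Da evM evB evX evC invfM mulrACA divff // mulr1.
  rewrite E; apply: IHm => //; last by move=> c'; rewrite -E; exact: reg.
  by move: sq; rewrite Dq size_Mmonic ?monicXsubC // size_XsubC addn2.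
exfalso; have [V pV mV] := reg c; apply: (place_unit pV ac).
have -> : ev iota X a = ev iota X q1 * ((X - iota c) * (ev iota X a / ev iota X q)).
  by rewrite Eq; field; rewrite ev_eq0 q10 Xc0.
have [vV Vk Vs] := pV; apply: (vmaxM vV) => //; apply: (vring_ev vV Vk).
rewrite -(subrK (iota c) X); apply: (vringD vV) => //; exact: (vmaxW vV).
Qed.

Lemma place_root0 V (a : {poly k}) : place iota X V -> vmax V (ev iota X a) -> a`_0 = 0.
Proof.
move=> [vV Vk Vs] ma; apply/eqP; apply: contraPT ma => a0.
exact: (ev_unit vV Vk Vs).
Qed.

Lemma place_infty V (a : {poly k}) : place iota X^-1 V ->
  vmax V (ev iota X a / X) -> (size a <= 1)%N.
Proof.
move=> [vV Vk Vs] ma; rewrite leqNgt; apply/negP => sa.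
have X0 : X != 0 by rewrite -(rmorph0 iota) X_trans.
have [N DN] : exists N, size a = N.+2 by exists (size a).-2; lia.
move: ma; rewrite (@ev_reverse _ _ _ _ _ N.+1 X0) ?DN //.
set b := \poly_(m < _) _ => mb.
have b0 : b`_0 != 0.
  rewrite coef_poly subn0 (_ : a`_N.+1 = lead_coef a); last by rewrite lead_coefE DN.
  by rewrite lead_coef_eq0 -size_poly_eq0 DN.
apply: (ev_unit vV Vk Vs b0).
have -> : ev iota X^-1 b = X^-1 ^+ N * (X ^+ N.+1 * ev iota X^-1 b / X).
  by rewrite exprVn exprS; field; rewrite X0 expf_neq0.
by apply: (vmaxM vV) => //; apply: (vringX vV); exact: (vmaxW vV).
Qed.

End Rational.

(** * Lagrange interpolation *)

(** Both sides are the leading coefficient of the interpolation polynomial of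
    g at the roots of p. *)
Lemma euler_formula (L : fieldType) (c : L) (rs : seq L) (g : {poly L}) :
  c != 0 -> uniq rs -> (size g <= size rs)%N ->
  let p := c *: \prod_(z <- rs) ('X - z%:P) in
  \sum_(y <- rs) g.[y] / p^`().[y] = g`_(size rs).-1 / c.
Proof.
move=> c0 urs sg p.
have [rs0|rs_gt0] := posnP (size rs).
  move: sg; rewrite (size0nil rs0) big_nil leqn0 size_poly_eq0 => /eqP->.
  by rewrite coef0 mul0r.
pose q y := c *: \prod_(z <- rem y rs) ('X - z%:P).
have Dp y : y \in rs -> p = ('X - y%:P) * q y.
  move=> yrs; rewrite /p (perm_big _ (perm_to_rem yrs)) big_cons /=.
  by rewrite -scalerAr.
have p'E y : y \in rs -> p^`().[y] = (q y).[y].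
  move=> yrs; rewrite {1}(Dp y yrs) derivM derivXsubC !hornerE.
  by rewrite subrr mul0r addr0.
have qE y z : y \in rs -> z \in rs -> y != z -> (q z).[y] = 0.
  move=> yrs zrs yz; rewrite hornerZ horner_prod.
  have yr : y \in rem z rs by rewrite mem_rem_uniq // inE yz.
  by rewrite (big_rem y yr) /= hornerXsubC subrr mul0r mulr0.
have sq y : y \in rs -> size (q y) = size rs.
  by move=> yrs; rewrite size_scale // size_prod_XsubC size_rem // prednK.
have q'0 y : y \in rs -> (q y).[y] != 0.
  move=> yrs; rewrite hornerZ mulf_neq0 // horner_prod prodf_seq_neq0.
  apply/allP => z; rewrite mem_rem_uniq // inE => /andP[zy _] /=.
  by rewrite hornerXsubC subr_eq0 eq_sym.
pose h := \sum_(y <- rs) (g.[y] / p^`().[y]) *: q y.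
have hg : g = h.
  apply/eqP; rewrite -subr_eq0; apply/negPn/negP => gh0.
  have gh_roots : all (root (g - h)) rs.
    apply/allP => y yrs; rewrite /root hornerD hornerN horner_sum.
    rewrite (big_rem y yrs) /= big1_seq => [|z].
      by rewrite hornerZ p'E // addr0 divfK ?q'0 // subrr.
    move=> /andP[_]; rewrite mem_rem_uniq // inE => /andP[zy zrs].
    by rewrite hornerZ qE ?mulr0 // eq_sym.
  have := max_poly_roots gh0 gh_roots urs; rewrite ltnNge => /negP; apply.
  apply: (leq_trans (size_polyD _ _)); rewrite size_polyN geq_max sg /=.
  apply: (leq_trans (size_sum _ _ _)); apply/bigmax_leqP_seq => y yrs _.
  by rewrite (leq_trans (size_scale_leq _ _)) // sq.
rewrite [in RHS]hg coef_sum mulr_suml; apply: eq_big_seq => y yrs.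
rewrite coefZ; have -> : (q y)`_(size rs).-1 = c; last by rewrite mulfK.
rewrite -{1}(sq y yrs) -lead_coefE lead_coefZ lead_coef_prod_XsubC ?mulr1 //.
Qed.

(** * Traces from K to k(X) *)

Section Trace.
Variables (k : closedFieldType) (K : fieldType) (iota : {rmorphism k -> K}).
Variables (X Y : K) (F : {poly {poly k}}) (d : nat).
Hypothesis pc : plane_curve iota X Y F d.
Hypothesis char_k : [pchar k] =i pred0.

Lemma X_neq_const c : X != iota c.
Proof.
rewrite -subr_eq0; have := evX_eq0 pc ('X - c%:P).
by rewrite evB evX evC polyXsubC_eq0 => ->.
Qed.

Let FK := map_poly (ev iota X) F.

Let lead_FK : ev iota X F`_d != 0.
Proof. by rewrite (evX_eq0 pc) (pc_lead pc). Qed.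

Let size_FK : size FK = d.+1.
Proof. by rewrite size_poly_eq (pc_size pc) // lead_FK. Qed.

(** The roots of F(X, T) in a splitting field are the images of Y under
    embeddings of K over k(X); they are simple because F_Y is not 0 in K. *)
Lemma conjugates_exist : exists (L : fieldType) (j : {rmorphism K -> L})
    (rs : seq L) (sigma : L -> {rmorphism K -> L}),
  [/\ uniq rs, size rs = d,
      map_poly j FK = j (ev iota X F`_d) *: \prod_(z <- rs) ('X - z%:P) &
      forall y, y \in rs -> [/\ forall c, sigma y (iota c) = j (iota c),
        sigma y X = j X & sigma y Y = y]].
Proof.
have FK0 : FK != 0 by rewrite -size_poly_eq0 size_FK.
have [L [j [rs DF]]] := splitting_extension FK0.
have lFK : lead_coef FK = ev iota X F`_d.
  by rewrite lead_coefE size_FK coef_map.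
rewrite {}lFK in DF.
have ev2E y g : ev2 (j \o iota) (j X) y g = (map_poly j (map_poly (ev iota X) g)).[y].
  rewrite [LHS]ev2E (horner_coef_wide (n := size g)); last first.
    by rewrite (leq_trans (size_poly _ _)) ?size_poly.
  by apply: eq_bigr => i _; rewrite !coef_map /= ev_rmorph.
have root_y y : y \in rs -> ev2 (j \o iota) (j X) y F = 0.
  move=> yrs; rewrite ev2E -/FK DF hornerZ horner_prod (big_rem y yrs) /=.
  by rewrite hornerXsubC subrr mul0r mulr0.
have /choice [sigma sigmaP] : forall y, exists s : {rmorphism K -> L}, y \in rs ->
    [/\ forall c, s (iota c) = j (iota c), s X = j X & s Y = y].
  move=> y; have [yrs|yrs] := boolP (y \in rs); last by exists j.
  by have [s sP] := conjugate_exists pc (root_y y yrs); exists s.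
have srs : size rs = d.
  have := size_map_poly j FK; rewrite DF size_scale ?fmorph_eq0 // size_prod_XsubC.
  by rewrite size_FK => -[].
exists L, j, rs, sigma; split=> //.
(* A double root would be a zero of F_Y. *)
have simple y : y \in rs -> (map_poly j FK)^`().[y] != 0.
  move=> yrs; rewrite deriv_map /FK deriv_map -ev2E.
  by rewrite (conj_eq0 pc (root_y y yrs)) (derivF_neq0 pc).
have count1 y : y \in rs -> y \notin rem y rs.
  move=> yrs; apply/negP => yrs'; have := simple y yrs; rewrite DF.
  rewrite (perm_big _ (perm_to_rem yrs)) /= big_cons (perm_big _ (perm_to_rem yrs')) /=.
  rewrite big_cons mulrA -expr2 derivZ derivM deriv_exp !hornerE /=.
  by rewrite subrr expr2 !mul0r !(addr0, add0r, mul0r, mulr0) eqxx.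
elim: (rs) count1 => //= y s IHs H; apply/andP; split.
  by have := H y (mem_head _ _); rewrite eqxx.
apply: IHs => z zs; have := H z; rewrite in_cons zs orbT => /(_ isT).
case: eqVneq => [_|yz]; first by rewrite zs.
by rewrite in_cons negb_or => /andP[].
Qed.

Variables (L : fieldType) (j : {rmorphism K -> L}) (rs : seq L).
Variable sigma : L -> {rmorphism K -> L}.
Hypothesis urs : uniq rs.
Hypothesis srs : size rs = d.
Hypothesis DF : map_poly j FK = j (ev iota X F`_d) *: \prod_(z <- rs) ('X - z%:P).
Hypothesis sigmaP : forall y, y \in rs -> [/\ forall c, sigma y (iota c) = j (iota c),
        sigma y X = j X & sigma y Y = y].

Lemma conj_evX y (a : {poly k}) : y \in rs -> sigma y (ev iota X a) = j (ev iota X a).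
Proof.
move=> yrs; have [sk sX _] := sigmaP yrs; rewrite !evE !rmorph_sum.
by apply: eq_bigr => i _; rewrite !rmorphM !rmorphXn sk sX.
Qed.

Lemma conj_ev2 y g : y \in rs ->
  sigma y (ev2 iota X Y g) = (map_poly j (map_poly (ev iota X) g)).[y].
Proof.
move=> yrs; have [_ _ sY] := sigmaP yrs.
rewrite ev2E rmorph_sum (horner_coef_wide (n := size g)); last first.
  by rewrite (leq_trans (size_poly _ _)) ?size_poly.
by apply: eq_bigr => i _; rewrite rmorphM rmorphXn sY /= conj_evX // !coef_map.
Qed.

(** The left-hand side is the trace from K to k(X). Only the coefficient of
    Y^m in n contributes to the degree d - 1 that Euler's formula picks
    out. *)
Lemma trace_formula (n : {poly {poly k}}) (q : {poly k}) (e i m : nat) :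
  (size n <= m.+1)%N -> (m + i = d.-1)%N ->
  \sum_(y <- rs) sigma y (X ^+ e * (ev2 iota X Y n / ev iota X q) * Y ^+ i /
                          ev2 iota X Y F^`()) =
  j (ev iota X ('X^e * n`_m) / ev iota X (q * F`_d)).
Proof.
move=> sn mi.
have jl0 : j (ev iota X F`_d) != 0 by rewrite fmorph_eq0.
pose g := map_poly j (map_poly (ev iota X) n) * 'X^i.
have sg : (size g <= size rs)%N.
  apply: (leq_trans (size_polyMleq _ _)); rewrite size_polyXn addnS /= srs.
  rewrite -(prednK (pc_gt0 pc)) -mi -addSn leq_add2r.
  by apply: leq_trans sn; rewrite (leq_trans (size_poly _ _)) ?size_poly.
have := euler_formula jl0 urs sg; rewrite /= -DF => E.
transitivity (j X ^+ e / j (ev iota X q) * (\sum_(y <- rs) g.[y] / (map_poly j FK)^`().[y])).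
  rewrite mulr_sumr; apply: eq_big_seq => y yrs.
  have [_ sX sY] := sigmaP yrs.
  rewrite !fmorph_div !rmorphM fmorphV !rmorphXn sX sY conj_evX // !conj_ev2 //.
  by rewrite /g hornerM hornerXn deriv_map /FK deriv_map; ring.
rewrite E srs /g coefMXn -mi (_ : m + i < i = false)%N ?addnK; last by lia.
rewrite !coef_map fmorph_div !evM evXn evX !rmorphM rmorphXn invfM /=.
by ring.
Qed.

(** The place induces a point of K along each embedding, and s vanishes at it;
    so all conjugates of w lie in the maximal ideal. *)
Lemma trace_vanishes (s : K) (n : nat) V (w : K) : s != 0 -> finite_over iota s n ->
  (forall y, y \in rs -> sigma y s = j s) -> place (j \o iota) (j s) V ->
  (forall P : point iota, 0 < P s -> ordge P w 1) ->
  vmax V (\sum_(y <- rs) sigma y w).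
Proof.
move=> s0 fin ss pV Hw; have [vV _ _] := pV.
rewrite big_seq; apply: (vmax_sum vV) => y yrs.
have [sk _ _] := sigmaP yrs; rewrite -(ss y yrs) in pV.
by have [P [/Hw Pw _ H]] := place_point (iota' := j \o iota) sk s0 fin pV; apply: H.
Qed.

End Trace.

(** * Sections of the pencil *)

Section Sections.
Variables (k : closedFieldType) (K : fieldType) (iota : {rmorphism k -> K}).
Variables (X Y : K) (T : eqType) (r : seq T) (e1 e2 : T -> nat) (b : T -> k) (d : nat).
Let F := fam_poly r e1 e2 b.
Hypothesis pc : plane_curve iota X Y F d.
Hypothesis char_k : [pchar k] =i pred0.
Hypothesis nd : nondegenerate_family r e1 e2 b.
Hypothesis F0 : F`_0 != 0.
Hypothesis e2d : forall z, z \in r -> (e2 z <= d)%N.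

(** The exponent (i, l) lies strictly on the inner side of all supporting
    lines of the Newton polygon that have rational slope. *)
Definition interior_exponent (i l : nat) := forall p q : int, (p != 0) || (q != 0) ->
  exists2 z, z \in r & p * (e1 z)%:Z + q * (e2 z)%:Z < p * i%:Z + q * l%:Z.

Let r0 : r != [::].
Proof.
apply: contraNneq F0 => E; rewrite /F coef_fam_poly E big_nil //.
Qed.

Let Fd : F`_d != 0 := pc_lead pc.

Let FY0 : ev2 iota X Y F^`() != 0 := derivF_neq0 pc char_k.

(** The order is the weight of the exponent (i, l + 1) minus the minimal
    weight, which is the order of Y F_Y. *)
Lemma interior_order (P : point iota) i l : interior_exponent i l.+1 ->
  P X != 0 -> 0 < P (X ^+ i * Y ^+ l / ev2 iota X Y F^`()).
Proof.
move=> il PX0; have [M Mle Mex] := fam_minimum e1 e2 (P X) (P Y) r0.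
have [|z zr lt] := il (P X) (P Y); first by rewrite PX0.
have := boundary_order pc char_k nd PX0 Mle Mex.
have X0 := pc_X0 pc; have Y0 := pc_Y0 pc.
have mulrn_int (x : int) (n : nat) : x *+ n = x * n%:Z by rewrite -mulr_natr natz.
rewrite ordM // ord_div ?mulf_neq0 ?expf_neq0 // ordM ?expf_neq0 // !ordX !mulrn_int.
move: (P (ev2 _ _ _ _)) => D E; have := le_lt_trans (Mle z zr) lt.
by rewrite -E -addn1 PoszD mulrDr mulr1; lia.
Qed.

(** In other words, the differential X^i Y^l dX / F_Y is regular at the points
    over c. *)
Lemma interior_order_finite (P : point iota) i l (c : k) : (l.+1 < d)%N -> c != 0 ->
  0 < P (X - iota c) ->
  0 < P (X - iota c) + P (X ^+ i * Y ^+ l / ev2 iota X Y F^`()).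
Proof.
move=> ld c0 Pc; have X0 := pc_X0 pc; have Y0 := pc_Y0 pc.
have [_ PX] : X != 0 /\ P X = 0.
  by apply: (@ord_unit_const _ _ _ P c X c0); right; rewrite -gtz0_ge1.
have smooth eta := nondegenerate_interior nd r0 (eta := eta) c0.
have bot := nondegenerate_row (j := 0%N) (q := 1) nd _ (oner_neq0 _) F0 c0.
have top := nondegenerate_row (j := d) (q := -1) nd _ _ Fd c0.
have := @derivative_order _ _ _ X Y F d pc char_k P c Pc smooth (bot _) (top _ _) l.+1 ld.
rewrite ord_div ?mulf_neq0 ?expf_neq0 // ordM ?expf_neq0 // !ordX PX mul0rn add0r /=.
move=> H; rewrite addrA subr_gt0 addrC; apply: H.
- by move=> z _; rewrite mulr0 mul1r.
- by move=> z /e2d; rewrite !mulN1r lerN2 lez_nat.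
- by [].
Qed.

Hypothesis interiors : forall l, (0 < l < d)%N -> exists i, interior_exponent i l.

Section OneSection.
Variable t : K.
Hypothesis t_section : forall P : point iota, ordge P t (Num.min 0 (P X)).

Let t_finite (P : point iota) (c : k) : 0 < P (X - iota c) -> ordge P t 0.
Proof.
move=> Pc; apply: ordgeW (t_section P); rewrite le_min lexx /=.
have [c0|c0] := eqVneq c 0; first by move: Pc; rewrite c0 rmorph0 subr0 => /ltW.
have [_ -> //] : X != 0 /\ P X = 0.
by apply: (@ord_unit_const _ _ _ P c X c0); right; rewrite -gtz0_ge1.
Qed.

Let t_infty (P : point iota) : P X < 0 -> ordge P t (P X).
Proof. by move=> PX; have := t_section P; rewrite min_r // ltW. Qed.

(** Up to the factor X^i / (q F_d), the coefficient of Y^m in n is the trace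
    of t times a differential with interior exponent in row d - m. The trace
    is regular on the projective line and vanishes at 0. *)
Lemma top_coefficient_eq0 (n : {poly {poly k}}) (q : {poly k}) m :
  q != 0 -> t = ev2 iota X Y n / ev iota X q -> (size n <= m.+1)%N ->
  (0 < m < d)%N -> n`_m = 0.
Proof.
move=> q0 Dt sn /andP[m0 md].
have [L [j [rs [sigma [urs srs DF sigmaP]]]]] := conjugates_exist pc char_k.
have [|i il] := interiors (l := (d.-1 - m).+1); first lia.
set l := (d.-1 - m)%N in il.
have ml : (m + l)%N = d.-1 by rewrite /l; lia.
have ld : (l.+1 < d)%N by rewrite /l; lia.
pose w := X ^+ i * Y ^+ l / ev2 iota X Y F^`() * t.
have X0 := pc_X0 pc; have Y0 := pc_Y0 pc.
pose X' := j X; pose iota' : {rmorphism k -> L} := j \o iota.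
pose rho := ev iota' X' ('X^i * n`_m) / ev iota' X' (q * F`_d).
have tr : \sum_(y <- rs) sigma y w = rho.
  have := trace_formula pc urs srs DF sigmaP q i sn ml.
  rewrite -Dt fmorph_div (ev_rmorph _ _ _ ('X^i * n`_m)) (ev_rmorph _ _ _ (q * F`_d)) => E.
  rewrite /rho /iota' /X' -E.
  by apply: eq_bigr => y _; congr (sigma y _); rewrite /w; ring.
have Xk c : X' != iota' c by rewrite /X' /= (inj_eq (fmorph_inj j)) (X_neq_const pc).
have trs s : (forall y, y \in rs -> sigma y s = j s) ->
    \sum_(y <- rs) sigma y (s * w) = j s * rho.
  move=> ss; rewrite -tr mulr_sumr; apply: eq_big_seq => y yrs.
  by rewrite rmorphM ss.
have sX y : y \in rs -> sigma y X = j X by move=> /sigmaP[].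
have sk y c : y \in rs -> sigma y (iota c) = j (iota c) by move=> /sigmaP[->].
have Xc c : X - iota c != 0 by rewrite subr_eq0 (X_neq_const pc).
have at_finite c : exists2 V, place iota' (X' - iota' c) V & vmax V ((X' - iota' c) * rho).
  have [V pV] : exists V, place iota' (X' - iota' c) V.
    by apply: place_exists => c'; rewrite subr_eq -rmorphD.
  exists V => //; have jE : X' - iota' c = j (X - iota c) by rewrite rmorphB.
  rewrite jE in pV *; have ss y : y \in rs -> sigma y (X - iota c) = j (X - iota c).
    by move=> yrs; rewrite !rmorphB sX ?sk.
  rewrite -(trs _ ss).
  apply: (trace_vanishes sigmaP (Xc c) (finite_over_shift c (finite_over_X pc)) ss pV).
  move=> P Pc; have tP := t_finite Pc.
  rewrite /w mulrA; apply: ordgeMr tP; right.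
  rewrite ordM ?mulf_neq0 ?invr_eq0 ?expf_neq0 //.
  have [c0|c0] := eqVneq c 0.
    move: Pc; rewrite c0 rmorph0 subr0 => PX; rewrite -gtz0_ge1.
    exact: addr_gt0 (interior_order il (lt0r_neq0 PX)).
  by rewrite -gtz0_ge1; exact: interior_order_finite.
have at_0 : exists2 V, place iota' X' V & vmax V rho.
  have [V pV] := place_exists Xk; exists V => //.
  rewrite -tr; apply: (trace_vanishes sigmaP X0 (finite_over_X pc) sX pV).
  move=> P PX; have tP : ordge P t 0 by apply: (t_finite (c := 0)); rewrite rmorph0 subr0.
  by apply: ordgeMr tP; right; rewrite -gtz0_ge1; exact: interior_order (lt0r_neq0 PX).
have at_infty : exists2 V, place iota' X'^-1 V & vmax V (rho / X').
  have [V pV] : exists V, place iota' X'^-1 V.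
    by apply: place_exists => c; rewrite -[X'^-1]/(_) -(inj_eq invr_inj) invrK -fmorphV.
  exists V => //; have jE : X'^-1 = j X^-1 by rewrite fmorphV.
  rewrite jE in pV *; have ss y : y \in rs -> sigma y X^-1 = j X^-1.
    by move=> yrs; rewrite !fmorphV sX.
  rewrite mulrC -(trs _ ss).
  apply: (trace_vanishes sigmaP _ (finite_over_inv X0 (finite_over_X pc)) ss pV).
    by rewrite invr_eq0.
  move=> P; rewrite ordV oppr_gt0 => PX; have tP := t_infty PX.
  have PXw := interior_order il (ltr0_neq0 PX).
  have := ordgeM (ordgeM (ordge_ord P X^-1)
    (ordge_ord P (X ^+ i * Y ^+ l / ev2 iota X Y F^`()))) tP.
  rewrite -mulrA ordV => H; apply: ordgeW H.
  by rewrite addrAC addNr add0r -gtz0_ge1.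
have [|a Da] := rational_regular Xk _ at_finite; first by rewrite mulf_neq0.
have {at_0} a0 : a`_0 = 0.
  by have [V pV] := at_0; rewrite /rho Da; exact: place_root0.
have {at_infty} sa : (size a <= 1)%N.
  by have [V pV] := at_infty; rewrite /rho Da; exact: place_infty.
have {a0 sa} a0 : a = 0 by rewrite (size1_polyC sa) a0.
have ev'0 p : (ev iota' X' p == 0) = (p == 0).
  by rewrite (_ : ev iota' X' p = j (ev iota X p)) ?fmorph_eq0 ?(evX_eq0 pc) // ev_rmorph.
move/eqP: Da; rewrite a0 rmorph0 mulf_eq0 invr_eq0 !ev'0 !mulf_eq0.
by rewrite expf_eq0 polyX_eq0 andbF (negPf q0) (negPf Fd) !orbF => /eqP.
Qed.

Lemma section_rational : exists a q : {poly k}, q != 0 /\ t = ev iota X a / ev iota X q.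
Proof.
have [n [q [q0 sn Dt]]] := representation pc t.
suff [n1 sn1 Dn1] : exists2 n1 : {poly {poly k}}, (size n1 <= 1)%N &
    t = ev2 iota X Y n1 / ev iota X q.
  by exists n1`_0, q; split=> //; rewrite Dn1 (size1_polyC sn1) ev2C coefC.
have : exists2 m, (m < d)%N & (size n <= m.+1)%N.
  by exists d.-1; rewrite prednK ?(pc_gt0 pc).
case=> m; elim: m => [|m IHm] md sm; first by exists n.
apply: IHm; first exact: ltnW.
have nm := top_coefficient_eq0 q0 Dt sm (_ : 0 < m.+1 < d)%N.
apply/leq_sizeP => i; rewrite leq_eqVlt => /orP[/eqP<-|lt]; first exact: nm.
exact: (leq_sizeP _ _ sm).
Qed.

(** A section is a rational function of X without finite poles, hence a
    polynomial in X, and its order at infinity bounds the degree by 1. *)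
Theorem section_affine : exists al be : k, t = iota al + iota be * X.
Proof.
have [a [q [q0 Dt]]] := section_rational.
have Xk := X_neq_const pc; have X0 := pc_X0 pc.
have [|a' Da'] := rational_regular Xk q0 (a := a).
  move=> c; have [V pV] : exists V, place iota (X - iota c) V.
    by apply: place_exists => c'; rewrite subr_eq -rmorphD.
  exists V => //; rewrite -Dt.
  have Xc0 : X - iota c != 0 by rewrite subr_eq0.
  have [P [Pc _ H]] := place_point (sigma := idfun) (fun c => erefl) Xc0
    (finite_over_shift c (finite_over_X pc)) pV.
  by apply: H; apply: ordgeMr (t_finite Pc); right; rewrite -gtz0_ge1.
pose a'' := drop_poly 1 a'.
have Dt' : t = ev iota X a'' * X + iota a'`_0 by rewrite Dt Da' ev_headE.
have [V pV] : exists V, place iota X^-1 V.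
  by apply: place_exists => c; rewrite -(inj_eq invr_inj) invrK -fmorphV.
have XV0 : X^-1 != 0 by rewrite invr_eq0.
have [P []] := place_point (sigma := idfun) (fun c => erefl)
    XV0 (finite_over_inv X0 (finite_over_X pc)) pV.
rewrite ordV oppr_gt0 => PX _ H.
have sa : (size a'' <= 1)%N.
  apply: (place_infty Xk pV); apply: (H (ev iota X a'' / X)).
  have -> : ev iota X a'' / X = (t - iota a'`_0) * (X^-1 * X^-1).
    by rewrite Dt' addrK; field.
  have tX : ordge P (t - iota a'`_0) (P X).
    by apply: ordgeB (t_infty PX) _; apply: ordgeW (ordge_const P _); exact: ltW.
  apply: ordgeW (ordgeM tX (ordge_ord P _)); rewrite ordM // ordV; lia.
exists a'`_0, a''`_0; rewrite [LHS]Dt' addrC; congr (_ + _ * _).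
by rewrite (size1_polyC sa) evC coefC.
Qed.

End OneSection.
End Sections.

(** * A section from a row without interior points *)

Section ExtraSection.
Variables (k K : fieldType) (iota : {rmorphism k -> K}).
Variables (X Y : K) (T : eqType) (r : seq T) (e1 e2 : T -> nat) (b : T -> k) (d : nat).
Let F := fam_poly r e1 e2 b.
Hypothesis pc : plane_curve iota X Y F d.
Hypothesis e2d : forall z, z \in r -> (e2 z <= d)%N.

(** Segments from exponents above row l to exponents on or below it cross the
    row between e and e + 1; denominators are cleared. *)
Definition narrow_row (e l : nat) := forall z z', z \in r -> z' \in r ->
  (l < e2 z)%N -> (e2 z' <= l)%N ->
  (e * (e2 z - e2 z') <= e1 z * (l - e2 z') + e1 z' * (e2 z - l) <=
     e.+1 * (e2 z - e2 z'))%N.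

(** Relative to (e, l) a crossing has weight p * x with 0 <= x <= 1, and this
    is a weighted mean of the weights of the ends of the segment. *)
Lemma narrow_weight (p q : int) (e l : nat) z z' : narrow_row e l ->
  z \in r -> z' \in r -> (l < e2 z)%N -> (e2 z' <= l)%N ->
  Num.min 0 p <= p * ((e1 z)%:Z - e%:Z) + q * ((e2 z)%:Z - l%:Z) \/
  Num.min 0 p <= p * ((e1 z')%:Z - e%:Z) + q * ((e2 z')%:Z - l%:Z).
Proof.
move=> nr zr z'r lz z'l; have := nr z z' zr z'r lz z'l.
move: (e1 z) (e2 z) (e1 z') (e2 z') lz z'l => a1 a2 b1 b2 la bl H.
set w := p * _ + _; set w' := p * (b1%:Z - _) + _; set m := Num.min _ _.
have [|lt] := leP m w; first by left.
have [|lt'] := leP m w'; [by right|exfalso].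
pose A : int := l%:Z - b2%:Z; pose B : int := a2%:Z - l%:Z.
have A0 : 0 <= A by rewrite /A; lia.
have B0 : 0 < B by rewrite /B; lia.
(* The weighted sum of the two weights is p times the position of the crossing. *)
pose C : int := a1%:Z * A + b1%:Z * B - e%:Z * (A + B).
have E : A * w + B * w' = p * C by rewrite /w /w' /C /A /B; ring.
have [C0 C1] : 0 <= C /\ C <= A + B.
  have Dn m' n' : (n' <= m')%N -> (m' - n')%N%:Z = m'%:Z - n'%:Z by move=> ?; rewrite subzn.
  have DA : (l - b2)%N%:Z = A by rewrite Dn.
  have DB : (a2 - l)%N%:Z = B by rewrite Dn // ltnW.
  have DAB : (a2 - b2)%N%:Z = A + B by rewrite Dn; [rewrite /A /B; ring|lia].
  move: H; rewrite -2!lez_nat !PoszD !PoszM DA DB DAB /C => /andP[H1 H2].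
  by split; [rewrite subr_ge0|rewrite lerBlDr].
have le1 : A * w + B * w' < (A + B) * m.
  have h1 : A * w <= A * m by apply: ler_wpM2l => //; exact: ltW.
  have h2 : B * w' < B * m by rewrite ltr_pM2l.
  by rewrite [ltRHS]mulrDl; exact: ler_ltD h1 h2.
have : (A + B) * m <= p * C.
  rewrite /m; have [p0|p0] := leP 0 p; first by rewrite mulr0; apply: mulr_ge0.
  by rewrite mulrC ler_wnM2l // ltW.
by rewrite -E leNgt le1.
Qed.

(** Multiplied by X^-e Y^-l, the part of F above row l and the negative of the
    part on or below it are equal in K. By narrow_weight, at each point the
    terms of one of the two expressions all have order at least min(0, ord X).
    The section is not affine in X since its degree in Y is d - l. *)
Lemma extra_section (e l : nat) : (0 < l < d)%N -> narrow_row e l -> exists h : K,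
  (forall P : point iota, ordge P h (Num.min 0 (P X))) /\
  forall al be, h <> iota al + iota be * X.
Proof.
move=> /andP[l0 ld] nr; have X0 := pc_X0 pc; have Y0 := pc_Y0 pc.
pose up := \sum_(z <- r | (l < e2 z)%N) iota (b z) * (X ^+ e1 z * Y ^+ e2 z).
pose lo := \sum_(z <- r | (e2 z <= l)%N) iota (b z) * (X ^+ e1 z * Y ^+ e2 z).
have uplo : up = - lo.
  apply/eqP; rewrite -addr_eq0 -[X in _ == X](pc_root pc) ev2_fam_poly.
  rewrite [X in _ == X](bigID (fun z => (l < e2 z)%N)) /=; apply/eqP; congr (_ + _).
  by apply: eq_bigl => z; rewrite -leqNgt.
exists (X ^- e * Y ^- l * up); split=> [P|al be Eh].
  have term z : P X * ((e1 z)%:Z - e%:Z) + P Y * ((e2 z)%:Z - l%:Z) >= Num.min 0 (P X) ->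
      ordge P (X ^- e * Y ^- l * (iota (b z) * (X ^+ e1 z * Y ^+ e2 z))) (Num.min 0 (P X)).
    move=> H; rewrite mulrCA; apply: ordgeMl; first exact: ordge_const.
    right; rewrite !ordM ?mulf_neq0 ?invr_eq0 ?expf_neq0 // !ordV !ordX.
    have mulrn_int (x : int) (n : nat) : x *+ n = x * n%:Z by rewrite -mulr_natr natz.
    by rewrite !mulrn_int (le_trans H) // le_eqVlt; apply/orP; left; apply/eqP; ring.
  have [[z zr [lz lt]]|all_up] := pselect (exists2 z, z \in r & (l < e2 z)%N /\
      P X * ((e1 z)%:Z - e%:Z) + P Y * ((e2 z)%:Z - l%:Z) < Num.min 0 (P X)).
    rewrite uplo mulrN; apply: ordgeN; rewrite /lo mulr_sumr big_seq_cond.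
    apply: ordge_sum => z' /andP[z'r z'l]; apply: term.
    have [|//] := narrow_weight (P X) (P Y) nr zr z'r lz z'l.
    by rewrite leNgt lt.
  rewrite /up mulr_sumr big_seq_cond; apply: ordge_sum => z /andP[zr lz]; apply: term.
  by rewrite leNgt; apply/negP => lt; apply: all_up; exists z.
pose G : {poly {poly k}} := \sum_(z <- r | (l < e2 z)%N) (b z *: 'X^(e1 z)) *: 'X^(e2 z - l).
pose A : {poly k} := 'X^e * (al%:P + be *: 'X).
have EG : ev2 iota X Y G = Y ^- l * up.
  rewrite /G rmorph_sum /up mulr_sumr; apply: eq_bigr => z lz /=.
  rewrite ev2Z rmorphXn /= ev2X -mul_polyC evM evC evXn evX.
  have -> : Y ^+ e2 z = Y ^+ (e2 z - l) * Y ^+ l by rewrite -exprD subnK // ltnW.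
  by field; rewrite expf_neq0.
have E0 : ev2 iota X Y (G - A%:P) = 0.
  rewrite ev2B ev2C EG evM evXn evX evD evC -mul_polyC evM evC evX.
  have -> : iota al + iota be * X = X ^- e * Y ^- l * up by rewrite Eh.
  by rewrite !mulrA divff ?expf_neq0 // mul1r subrr.
have sG : (size G <= d)%N.
  apply: (leq_trans (size_sum _ _ _)); apply/bigmax_leqP_seq => z zr lz.
  apply: (leq_trans (size_scale_leq _ _)); rewrite size_polyXn; have := e2d zr; lia.
have /(congr1 (fun g : {poly {poly k}} => g`_(d - l))) : G - A%:P = 0.
  apply: (pc_min pc) E0; apply: (leq_trans (size_polyD _ _)).
  rewrite size_polyN geq_max sG /=.
  exact: leq_trans (size_polyC_leq1 _) (pc_gt0 pc).
rewrite coef0 coefB coefC subn_eq0 leqNgt ld /= subr0 coef_sum => /eqP; apply/negP.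
have -> : \sum_(z <- r | (l < e2 z)%N) ((b z *: 'X^(e1 z)) *: 'X^(e2 z - l))`_(d - l) = F`_d.
  rewrite coef_fam_poly big_mkcond [RHS]big_mkcond; apply: eq_big_seq => z zr.
  have := e2d zr; rewrite coefZ coefXn; case: ltnP => lz zd.
    have -> : (d - l == e2 z - l)%N = (e2 z == d) by lia.
    by case: eqP; rewrite ?mulr1 ?mulr0.
  by case: eqP => // zd'; lia.
exact: pc_lead pc.
Qed.

End ExtraSection.

(** * Completeness of the pencil of X *)

Section Pencil.
Variables (k : closedFieldType) (K : fieldType) (iota : {rmorphism k -> K}).
Variables (X Y : K) (F : {poly {poly k}}) (d : nat).
Hypothesis pc : plane_curve iota X Y F d.

Let X0 : X != 0 := pc_X0 pc.
Let Xk c : X != iota c := X_neq_const pc c.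
Let Xc0 c : X - iota c != 0. Proof. by rewrite subr_eq0. Qed.

Lemma finite_zeros_shift c : finite_set [set P : point iota | 0 < P (X - iota c)].
Proof. exact: finite_zeros (Xc0 c) (finite_over_shift c (finite_over_X pc)). Qed.

Lemma finite_poles : finite_set [set P : point iota | 0 < P X^-1].
Proof.
by apply: finite_zeros (finite_over_inv X0 (finite_over_X pc)); rewrite invr_eq0.
Qed.

Lemma ord_ev_gt0 (P : point iota) (p : {poly k}) : p != 0 -> ordge P X 0 ->
  ordge P (ev iota X p) 1 -> exists2 z, root p z & 0 < P (X - iota z).
Proof.
move=> p0 PX; have [rs [Dp ->]] := ev_roots iota X p0.
move=> /ordge_prod_root[]; rewrite ?lead_coef_eq0 // => z zrs /ordge_neq0 => /(_ (Xc0 z)) Pz.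
exists z; last by rewrite gtz0_ge1.
by rewrite Dp rootZ ?lead_coef_eq0 // root_prod_XsubC.
Qed.

(** A zero of t is a pole of X, or a zero of the constant term of an equation
    of t over k[X]. *)
Lemma finite_zeros_all (t : K) : t != 0 -> finite_set [set P : point iota | 0 < P t].
Proof.
move=> t0; have [p p0 Dp] := algebraic_dep X0 (finite_over_X pc) t0.
have [rs [Dp0 _]] := ev_roots iota X p0.
pose A := \bigcup_(z in [set` rs]) [set P : point iota | 0 < P (X - iota z)].
apply: (@sub_finite_set _ _ ([set P : point iota | 0 < P X^-1] `|` A)); last first.
  rewrite finite_setU; split; first exact: finite_poles.
  by apply: bigcup_finite => // z _; exact: finite_zeros_shift.
move=> P /= Pt; have [PX|PX] := ltP (P X) 0; [left|right].
  by rewrite /= ordV oppr_gt0.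
have XP : ordge P X 0 by right.
have tP : ordge P t 0 by right; exact: ltW.
have [z pz Pz] : exists2 z, root p`_0 z & 0 < P (X - iota z).
  apply: ord_ev_gt0 => //.
  have sp := coef0_size_gt0 p0.
  case: (size p) sp Dp => // m _; rewrite big_ord_recl expr0 mulr1 => /eqP.
  rewrite addr_eq0 => /eqP ->; apply: ordgeN; apply: ordge_sum => i _.
  apply: ordgeMl; first exact: ordge_ev.
  rewrite lift0 exprS; apply: ordgeMr (ordgeX _ tP).
  by right; rewrite -gtz0_ge1.
exists z => //=; move: pz; rewrite Dp0 rootZ ?lead_coef_eq0 //.
by rewrite root_prod_XsubC.
Qed.

Lemma finite_support (t : K) : t != 0 -> finite_set [set P : point iota | P t != 0].
Proof.
move=> t0; apply: (@sub_finite_set _ _ ([set P : point iota | 0 < P t] `|`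
    [set P : point iota | 0 < P t^-1])); last first.
  by rewrite finite_setU; split; apply: finite_zeros_all; rewrite ?invr_eq0.
move=> P /= Pt; rewrite ordV oppr_gt0.
by have [lt|gt|e] := ltgtP (P t) 0; [right|left|rewrite e eqxx in Pt].
Qed.

(** Otherwise s would lie in the maximal ideal of a valuation ring that
    contains k, and such a ring belongs to a point. *)
Lemma ord0_const (s : K) : s != 0 -> (forall P : point iota, P s = 0) ->
  exists c, s = iota c.
Proof.
move=> s0 Ps; apply: contrapT => /forallNP sk.
have [V pV] : exists V, place iota s V by apply: place_exists => c; exact/eqP/sk.
have [vV Vk Vs] := pV.
have noP u : u != 0 -> finite_over iota u d -> vmax V u -> False.
  move=> u0 fin mu; have pu : place iota (idfun u) V by split.
  have [P [_ H0 _]] := place_point (sigma := idfun) (fun c => erefl) u0 fin pu.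
  have : V s^-1 by apply: (H0 s^-1); right; rewrite ordV Ps.
  by case: Vs => [/eqP|//]; rewrite (negPf s0).
have VX : V X.
  apply: contrapT => nX; apply: (noP X^-1); rewrite ?invr_eq0 //.
    exact: finite_over_inv (finite_over_X pc).
  by right; rewrite invrK.
have unitX (p : {poly k}) : p != 0 -> ~ vmax V (ev iota X p).
  move=> p0; have [rs [_ ->]] := ev_roots iota X p0; elim: rs => [|z rs IHrs].
    rewrite big_nil mulr1; apply: vmax_unit; rewrite ?fmorph_eq0 ?lead_coef_eq0 //.
    by rewrite -fmorphV; exact: Vk.
  rewrite big_cons mulrCA => /(vmax_prime vV) H; have [| |mz|//] := H.
  - exact: (vringB vV).
  - apply: (vringM vV); first exact: Vk.
    elim: (rs) => [|z' s' IHs]; first by rewrite big_nil; exact: (vring1 vV).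
    by rewrite big_cons; apply: (vringM vV) => //; exact: (vringB vV).
  - exact: noP (Xc0 z) (finite_over_shift z (finite_over_X pc)) mz.
have [p p0 Dp] := algebraic_dep X0 (finite_over_X pc) s0.
apply: (unitX _ p0).
have sp := coef0_size_gt0 p0.
case: (size p) sp Dp => // m _; rewrite big_ord_recl expr0 mulr1 => /eqP.
rewrite addr_eq0 => /eqP ->; apply: (vmaxN vV); apply: (vmax_sum vV) => i _.
apply: (vmaxM vV); first exact: vring_ev.
rewrite lift0 exprSr; apply: (vmaxM vV) => //; apply: (vringX vV); exact: (vmaxW vV).
Qed.

(** The fiber over c differs from the polar divisor of X by the divisor of
    fiber_function c. *)
Definition fiber_function (c : option k) : K := if c is Some c then X - iota c else 1.

Lemma fiber_function_neq0 c : fiber_function c != 0.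
Proof. by case: c => [c|] /=; [exact: Xc0|exact: oner_neq0]. Qed.

Lemma fiber_ord c (P : point iota) :
  fiber X c P = fiber X None P + P (fiber_function c).
Proof.
case: c => [c|] /=; last by rewrite ord1 addr0.
rewrite ordV; have [PX|PX] := ltP (P X) 0.
  have [|_ E] := @ord_dominant _ _ _ P X (- iota c) X0.
    by apply: ordgeN; apply: ordgeW (ordge_const P c); lia.
  by rewrite E max_l ?ltW // max_r ?oppr_ge0 ?ltW // addNr.
have : ordge P (X - iota c) 0 by apply: ordgeB; [right|exact: ordge_const].
move=> /ordge_neq0 => /(_ (Xc0 c)) Pc; rewrite max_r // max_l; first by rewrite add0r.
by rewrite oppr_le0.
Qed.

Lemma fiber_divisor c : is_divisor (@fiber _ _ iota X c).
Proof.
have [s fin_s Hs] : exists2 s, finite_set [set P : point iota | 0 < P s] &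
    forall P : point iota, fiber X c P = Num.max 0 (P s).
  by case: c => [c|]; [exists (X - iota c); first exact: finite_zeros_shift|
    exists X^-1; first exact: finite_poles].
apply: sub_finite_set fin_s => P /=; rewrite Hs.
by case: (leP (P s) 0) => //; rewrite eqxx.
Qed.

Lemma fiber_effective c : effective (@fiber _ _ iota X c).
Proof. by case: c => [c|] P /=; rewrite le_max lexx. Qed.

Definition pencil_section (t : K) :=
  forall P : point iota, ordge P t (Num.min 0 (P X)).

Lemma fiber_None (P : point iota) : fiber X None P = - Num.min 0 (P X).
Proof. by rewrite /= ordV oppr_min oppr0. Qed.

(** Adding the polar divisor of X to the divisors of sections gives the
    complete linear system, and the sections b (X - c) and b give the fibers
    over c and infinity. A member of the system that is a fiber determines its
    section up to a constant, by ord0_const. *)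
Theorem complete_pencil_affine : complete_pencil (fiber_pencil X : set (point iota -> int)) <->
  forall t, pencil_section t -> exists al be : k, t = iota al + iota be * X.
Proof.
split=> [comp t tsec|aff _ [c0 _ <-]].
  have [->|t0] := eqVneq t 0; first by exists 0, 0; rewrite !rmorph0 mul0r addr0.
  pose E (P : point iota) := P t + fiber X None P.
  have : complete_linear_system (@fiber _ _ iota X None) E.
    split.
    - apply: (@sub_finite_set _ _ ([set P : point iota | P t != 0] `|`
        [set P : point iota | fiber X None P != 0])).
        move=> P /=; rewrite /E; have [->|] := eqVneq (P t) 0; last by left.
        by rewrite add0r; right.
      by rewrite finite_setU; split; [exact: finite_support|exact: fiber_divisor].
    - move=> P; rewrite /E fiber_None subr_ge0.
      by have /ordge_neq0 := tsec P; apply.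
    - by exists t => // P; rewrite /E addrK.
  rewrite -(comp (@fiber _ _ iota X None)); last by exists None.
  move=> [c _ Ec]; have u0 := fiber_function_neq0 c.
  have [||g Dg] := @ord0_const (t / fiber_function c).
  - by rewrite mulf_neq0 ?invr_eq0.
  - move=> P; rewrite ord_div //; apply/eqP; rewrite subr_eq0; apply/eqP.
    have := congr1 (fun D => D P) Ec; rewrite fiber_ord /E [RHS]addrC.
    by move/addrI.
  have {Dg} Dt : t = iota g * fiber_function c by rewrite -Dg divfK.
  case: c => [c|] /= in Ec u0 Dt *.
    by exists (- (g * c)), g; rewrite Dt rmorphN rmorphM; ring.
  by exists g, 0; rewrite Dt rmorph0 mul0r addr0 mulr1.
apply/seteqP; split=> [_ [c _ <-]|E [Ediv Eeff [t t0 Et]]].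
  split; [exact: fiber_divisor|exact: fiber_effective|].
  exists (fiber_function c / fiber_function c0).
    by rewrite mulf_neq0 ?invr_eq0 ?fiber_function_neq0.
  move=> P; rewrite ord_div ?fiber_function_neq0 //.
  by rewrite (fiber_ord c) (fiber_ord c0); ring.
pose s := t * fiber_function c0.
have s0 : s != 0 by rewrite mulf_neq0 ?fiber_function_neq0.
have Es P : E P = fiber X None P + P s.
  rewrite /s ordM ?fiber_function_neq0 // -Et (fiber_ord c0); ring.
have [P|al [be Ds]] := aff s.
  by right; have := Eeff P; rewrite Es fiber_None; lia.
have [be0|be0] := eqVneq be 0.
  exists None => //; apply/funext => P; rewrite Es Ds be0 rmorph0 mul0r addr0.
  rewrite ord_const ?addr0 //; apply: contraNneq s0 => al0.
  by rewrite Ds al0 be0 !rmorph0 mul0r addr0.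
exists (Some (- (al / be))) => //; apply/funext => P; rewrite fiber_ord Es; congr (_ + _).
have -> : s = iota be * (X - iota (- (al / be))).
  by rewrite Ds rmorphN fmorph_div; field; rewrite fmorph_eq0.
by rewrite ordM ?fmorph_eq0 // ord_const // add0r.
Qed.

End Pencil.

(** * Convex sets in the plane *)

Section Plane.
Variable R : realType.
Implicit Types (A : set (R * R)) (p q w : R * R).

Definition combination_closed A := forall p q (t : R), A p -> A q -> 0 <= t <= 1 ->
  A (t * p.1 + (1 - t) * q.1, t * p.2 + (1 - t) * q.2).

Lemma convex_setP A : convex_set (A : set (convex_lmodType (R * R)%type)) <->
  combination_closed A.
Proof.
split=> [cA p q t Ap Aq /andP[t0 t1]|cA p q t].
  have := cA p q (Itv01 t0 t1); rewrite !inE => /(_ Ap Aq).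
  exact.
rewrite !inE => Ap Aq; have := cA p q t%:num Ap Aq; rewrite ge0 le1 => /(_ isT).
exact.
Qed.

Lemma sub_convex_hull A : A `<=` convex_hull A.
Proof. exact: sub_gen_smallest. Qed.

Lemma convex_hull_min A (C : set (R * R)) : combination_closed C -> A `<=` C ->
  convex_hull A `<=` C.
Proof. by move=> /convex_setP cC AC; apply: smallest_sub. Qed.

Lemma convex_hull_closed A : combination_closed (convex_hull A).
Proof.
move=> p q t Ap Aq t01 C HC; have [/convex_setP cC _] := HC.
by apply: cC t01; [exact: Ap|exact: Aq].
Qed.

Lemma closed_halfplane w (M : R) :
  combination_closed [set p | M <= w.1 * p.1 + w.2 * p.2].
Proof.
move=> p q t /= Mp Mq /andP[t0 t1].
have -> : w.1 * (t * p.1 + (1 - t) * q.1) + w.2 * (t * p.2 + (1 - t) * q.2) =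
  t * (w.1 * p.1 + w.2 * p.2) + (1 - t) * (w.1 * q.1 + w.2 * q.2) by ring.
have h1 := ler_wpM2l t0 Mp.
have h2 : (1 - t) * M <= (1 - t) * (w.1 * q.1 + w.2 * q.2).
  by apply: ler_wpM2l => //; rewrite subr_ge0.
by have := lerD h1 h2; rewrite -mulrDl addrC subrK mul1r.
Qed.

Lemma open_halfplane w (M : R) :
  combination_closed [set p | M < w.1 * p.1 + w.2 * p.2].
Proof.
move=> p q t /= Mp Mq /andP[t0 t1].
have -> : w.1 * (t * p.1 + (1 - t) * q.1) + w.2 * (t * p.2 + (1 - t) * q.2) =
  t * (w.1 * p.1 + w.2 * p.2) + (1 - t) * (w.1 * q.1 + w.2 * q.2) by ring.
move: Mp Mq; set u := _ + _; set v := w.1 * q.1 + _ => Mp Mq.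
pose N := Num.min u v.
have MN : M < N by rewrite lt_min Mp.
apply: lt_le_trans MN _; have -> : N = t * N + (1 - t) * N by ring.
apply: lerD; apply: ler_wpM2l; rewrite ?subr_ge0 //.
  by rewrite ge_min lexx.
by rewrite ge_min lexx orbT.
Qed.

Lemma affine_near (c : R) w p : 0 < w.1 * p.1 + w.2 * p.2 + c ->
  \forall q \near p, 0 < w.1 * q.1 + w.2 * q.2 + c.
Proof.
move=> H; set L := _ + c in H; pose K := `|w.1| + `|w.2| + 1.
have K0 : 0 < K by rewrite ltr_wpDl // addr_ge0.
exists (ball p.1 (L / K), ball p.2 (L / K)) => /=.
  by split; apply: nbhsx_ballx; rewrite divr_gt0.
move=> [q1 q2] /= [B1 B2]; rewrite /ball /= in B1 B2.
have E : w.1 * q1 + w.2 * q2 + c = L - (w.1 * (p.1 - q1) + w.2 * (p.2 - q2)).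
  by rewrite /L; ring.
rewrite E subr_gt0; apply: le_lt_trans (ler_norm _) _.
apply: le_lt_trans (ler_normD _ _) _; rewrite !normrM.
have e0 : 0 < L / K by rewrite divr_gt0.
apply: (@le_lt_trans _ _ ((`|w.1| + `|w.2|) * (L / K))).
  by rewrite mulrDl; apply: lerD; apply: ler_wpM2l => //; exact: ltW.
have {2}-> : L = K * (L / K) by rewrite mulrC divfK ?gt_eqF.
by rewrite ltr_pM2r // /K ltrDl.
Qed.

(** A small step against w from an interior point stays in A and strictly
    lowers the value of w. *)
Lemma interior_halfplane A w (M : R) p : w.1 != 0 \/ w.2 != 0 ->
  A `<=` [set q | M <= w.1 * q.1 + w.2 * q.2] -> A^° p ->
  M < w.1 * p.1 + w.2 * p.2.
Proof.
move=> w0 AM [[B1 B2] /= [/nbhs_ballP[e1 /= e10 H1] /nbhs_ballP[e2 /= e20 H2]] BA].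
pose n := w.1 ^+ 2 + w.2 ^+ 2; pose K := `|w.1| + `|w.2| + 1.
have n0 : 0 < n.
  rewrite /n; case: w0 => w0; [apply: ltr_pwDl|apply: ltr_wpDl];
    by rewrite ?sqr_ge0 // lt_def sqr_ge0 sqrf_eq0 w0.
have K0 : 0 < K by rewrite ltr_wpDl // addr_ge0.
pose e := Num.min e1 e2; have e0 : 0 < e by rewrite lt_min e10.
pose s := e / K; have s0 : 0 < s by rewrite divr_gt0.
have small x : `|x| < K -> `|s * x| < e.
  move=> xK; rewrite normrM gtr0_norm // /s mulrAC ltr_pdivrMr //.
  by rewrite ltr_pM2l.
have := AM (p.1 - s * w.1, p.2 - s * w.2); rewrite /=.
have -> : w.1 * (p.1 - s * w.1) + w.2 * (p.2 - s * w.2) =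
   w.1 * p.1 + w.2 * p.2 - s * n by rewrite /n; ring.
move=> H; have {}H : M <= w.1 * p.1 + w.2 * p.2 - s * n.
  apply: H; apply: (BA (_, _)); split=> /=.
    apply: H1; rewrite /ball /= opprB addrC subrK.
    apply: lt_le_trans (small _ _) _; last by rewrite ge_min lexx.
    by rewrite /K -addrA ltrDl ltr_wpDl.
  apply: H2; rewrite /ball /= opprB addrC subrK.
  apply: lt_le_trans (small _ _) _; last by rewrite ge_min lexx orbT.
  by rewrite /K addrAC ltrDr ltr_wpDl.
by apply: le_lt_trans H _; rewrite gtrBl mulr_gt0.
Qed.

(** Twice the signed area of a triangle. *)
Definition area p q r : R := (q.1 - p.1) * (r.2 - p.2) - (q.2 - p.2) * (r.1 - p.1).

Lemma area_near p q r : 0 < area p q r -> \forall p' \near p, 0 < area p' q r.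
Proof.
have E p' : area p' q r =
    (q.2 - r.2) * p'.1 + (r.1 - q.1) * p'.2 + (q.1 * r.2 - q.2 * r.1).
  by rewrite /area; ring.
rewrite E => /(@affine_near _ (q.2 - r.2, r.1 - q.1)).
by apply: filterS => p'; rewrite E.
Qed.

(** The ratios of areas are the barycentric coordinates of s in the
    triangle. *)
Lemma triangle_closed A p q r s : combination_closed A -> A p -> A q -> A r ->
  0 < area p q r -> 0 < area s q r -> 0 < area p s r -> 0 <= area p q s -> A s.
Proof.
move=> cA Ap Aq Ar D0 a0 b0 c0; set D := area p q r in D0.
set a := area s q r in a0; set b := area p s r in b0; set c := area p q s in c0.
have DE : D = a + b + c by rewrite /D /a /b /c /area; ring.
have ab0 : 0 < a + b by rewrite addr_gt0.
pose m := (a / (a + b) * p.1 + (1 - a / (a + b)) * q.1,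
           a / (a + b) * p.2 + (1 - a / (a + b)) * q.2).
have Am : A m.
  apply: cA => //; apply/andP; split; first by apply: divr_ge0; exact: ltW.
  by rewrite ler_pdivrMr // mul1r lerDl ltW.
have -> : s = ((a + b) / D * m.1 + (1 - (a + b) / D) * r.1,
               (a + b) / D * m.2 + (1 - (a + b) / D) * r.2).
  have Dn : area p q r != 0 by rewrite gt_eqF.
  have abn : area s q r + area p s r != 0 by rewrite gt_eqF.
  rewrite [s]surjective_pairing /m /= /D /a /b; congr (_, _).
    by move: Dn abn; rewrite /area => Dn abn; field; rewrite Dn abn.
  by move: Dn abn; rewrite /area => Dn abn; field; rewrite Dn abn.
apply: cA => //; apply/andP; split; first by apply: divr_ge0; exact: ltW.
by rewrite ler_pdivrMr // mul1r DE lerDl.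
Qed.

(** The point has a neighborhood in the union of the triangles with base on
    the segment and apex r or s. *)
Lemma segment_interior A p q r s (t : R) : combination_closed A ->
  A p -> A q -> A r -> A s -> 0 < area p q r -> area p q s < 0 -> 0 < t < 1 ->
  A^° (t * p.1 + (1 - t) * q.1, t * p.2 + (1 - t) * q.2).
Proof.
move=> cA Ap Aq Ar As r0 s0 /andP[t0 t1]; set z := (_, _).
have s0' : 0 < area q p s by rewrite (_ : area q p s = - area p q s) ?oppr_gt0 // /area; ring.
have t1' : 0 < 1 - t by rewrite subr_gt0.
have z1 : 0 < area z q r.
  by rewrite (_ : area z q r = t * area p q r) ?mulr_gt0 // /area /z /=; ring.
have z2 : 0 < area z r p.
  by rewrite (_ : area z r p = (1 - t) * area p q r) ?mulr_gt0 // /area /z /=; ring.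
have z3 : 0 < area z p s.
  by rewrite (_ : area z p s = (1 - t) * area q p s) ?mulr_gt0 // /area /z /=; ring.
have z4 : 0 < area z s q.
  by rewrite (_ : area z s q = t * area q p s) ?mulr_gt0 // /area /z /=; ring.
rewrite /interior /=; near=> p'.
have h1 : 0 < area p' q r by near: p'; exact: area_near.
have h2 : 0 < area p' r p by near: p'; exact: area_near.
have h3 : 0 < area p' p s by near: p'; exact: area_near.
have h4 : 0 < area p' s q by near: p'; exact: area_near.
have [side|/ltW side] := leP 0 (area p q p').
  apply: (triangle_closed cA Ap Aq Ar) => //.
  by rewrite (_ : area p p' r = area p' r p) // /area; ring.
apply: (triangle_closed cA Aq Ap As) => //.
  by rewrite (_ : area q p' s = area p' s q) // /area; ring.
by rewrite (_ : area q p p' = - area p q p') ?oppr_ge0 // /area; ring.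
Unshelve. all: by end_near. Qed.

End Plane.

(** * Evaluation of Laurent polynomials *)

Section Leval.
Variables (k S : fieldType) (iota : {rmorphism k -> S}) (x y : S).
Hypotheses (x0 : x != 0) (y0 : y != 0).
Implicit Types (f g : laurent k).

Lemma leval_widen f (D : {fset int * int}) : (lsupp f `<=` D)%fset ->
  leval iota x y f = \sum_(z <- D) iota (lcoef f z) * (x ^ z.1 * y ^ z.2).
Proof.
move=> sD; apply: (sum_lsupp (F := fun z c => iota c * (x ^ z.1 * y ^ z.2)) sD).
by move=> z; rewrite rmorph0 mul0r.
Qed.

Lemma levalD f g : leval iota x y (f + g) = leval iota x y f + leval iota x y g.
Proof.
pose D := (lsupp f `|` lsupp g `|` lsupp (f + g)%R)%fset.
have [sf sg sfg] : [/\ lsupp f `<=` D, lsupp g `<=` D & lsupp (f + g)%R `<=` D]%fset.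
  by split; apply/fsubsetP => z; rewrite !in_fsetU => ->; rewrite ?orbT.
rewrite (leval_widen sf) (leval_widen sg) (leval_widen sfg) -big_split.
apply: eq_bigr => z _; rewrite [lcoef (f + g) z]lcoef_add rmorphD.
by rewrite mulrDl.
Qed.

Lemma leval0 : leval iota x y 0 = 0.
Proof. by apply: (@addrI _ (leval iota x y 0)); rewrite -levalD !addr0. Qed.

Lemma leval_sum (I : Type) (s : seq I) (G : I -> laurent k) :
  leval iota x y (\sum_(i <- s) G i) = \sum_(i <- s) leval iota x y (G i).
Proof. exact: (big_morph _ levalD leval0). Qed.

Lemma leval_mono z c : leval iota x y (lmono z c) = iota c * (x ^ z.1 * y ^ z.2).
Proof.
rewrite (leval_widen (D := [fset z]%fset)) ?big_seq_fset1 ?lcoef_mono ?eqxx //.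
apply/fsubsetP => w; rewrite in_fset1 mem_finsupp -/(lcoef _ _) lcoef_mono [w == z]eq_sym.
by case: (z == w) => //; rewrite mulr0n eqxx.
Qed.

Lemma levalM f g : leval iota x y (f * g) = leval iota x y f * leval iota x y g.
Proof.
rewrite [f * g]/(lmul f g) /lmul leval_sum mulr_suml; apply: eq_bigr => u _.
rewrite leval_sum mulr_sumr; apply: eq_bigr => v _; rewrite leval_mono rmorphM /=.
by rewrite !expfzDr //; ring.
Qed.

End Leval.

(** * Newton polygons *)

Section NewtonPolygon.
Variables (R : realType) (k : fieldType) (f : laurent k).
Implicit Types (z : int * int) (p q M : int).

Let Delta := newton_polygon R f.

Lemma lsupp_nonempty : lsupp f != fset0 -> (lsupp f : seq (int * int)) != [::].
Proof.
apply: contraNneq => E; apply/eqP/fsetP => u.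
by rewrite in_fset0 -[u \in _]/(u \in (lsupp f : seq _)) E.
Qed.

Lemma newton_supp z : z \in lsupp f -> Delta (lattice_pt R z).
Proof. by move=> zf; apply: sub_convex_hull; exists z. Qed.

Lemma newton_halfplane p q M : (forall z, z \in lsupp f -> M <= p * z.1 + q * z.2) ->
  Delta `<=` [set P | M%:~R <= p%:~R * P.1 + q%:~R * P.2].
Proof.
move=> Mle; apply: (convex_hull_min (@closed_halfplane R (p%:~R, q%:~R) M%:~R)).
move=> _ [z zf <-] /=; rewrite -!intrM -intrD ler_int; exact: Mle.
Qed.

Lemma newton_lattice_halfplane p q M z :
  (forall z, z \in lsupp f -> M <= p * z.1 + q * z.2) ->
  Delta (lattice_pt R z) -> M <= p * z.1 + q * z.2.
Proof.
move=> Mle /(newton_halfplane Mle) /=.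
by rewrite -!intrM -intrD ler_int.
Qed.

(** The points of the polygon with minimal weight form a face, and on the
    torus the partial derivatives have the zeros of the logarithmic ones. *)
Lemma newton_nondegenerate_weight : newton_nondegenerate R f -> forall p q M,
  (forall z, z \in lsupp f -> M <= p * z.1 + q * z.2) ->
  (exists2 z, z \in lsupp f & p * z.1 + q * z.2 == M) ->
  forall xi eta : k, xi != 0 -> eta != 0 ->
  let face_sum (c : int * int -> k) :=
    \sum_(z <- lsupp f | p * z.1 + q * z.2 == M) c z * (xi ^ z.1 * eta ^ z.2) in
  face_sum (lcoef f) = 0 -> face_sum (fun z => lcoef f z *~ z.1) = 0 ->
  face_sum (fun z => lcoef f z *~ z.2) = 0 -> False.
Proof.
move=> nd p q M Mle [z0 z0f /eqP z0M] xi eta xi0 eta0 face_sum S0 S1 S2.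
pose w : R * R := (p%:~R, q%:~R).
pose tau : set (R * R) := [set P | Delta P /\
    forall Q, Delta Q -> w.1 * P.1 + w.2 * P.2 <= w.1 * Q.1 + w.2 * Q.2].
have tauE z : z \in lsupp f -> `[< tau (lattice_pt R z) >] = (p * z.1 + q * z.2 == M).
  move=> zf; apply/asboolP/eqP => [[_ H]|E].
    apply/le_anti; rewrite Mle // andbT -z0M.
    by have := H _ (newton_supp z0f); rewrite /= -!intrM -!intrD ler_int.
  split=> [|Q DQ]; first exact: newton_supp.
  rewrite /= -!intrM -intrD E; exact: (newton_halfplane Mle DQ).
have face_tau : face Delta tau by exists w.
apply: (nd tau face_tau); exists xi, eta; split; [exact/eqP|exact/eqP|].
pose g := face_part f tau.
have gE z : lcoef g z = if (z \in lsupp f) && (p * z.1 + q * z.2 == M) then lcoef f z else 0.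
  rewrite /g /lcoef /face_part fsfun_fun; case: ifP => //= zf.
  by rewrite tauE.
have gf : (lsupp g `<=` lsupp f)%fset.
  apply/fsubsetP => z; rewrite [z \in lsupp g]mem_finsupp -/(lcoef _ _) gE.
  by case: (z \in lsupp f) => //; rewrite eqxx.
have sumE (F : int * int -> k) :
    \sum_(z <- lsupp f) (if (z \in lsupp f) && (p * z.1 + q * z.2 == M) then F z else 0) =
    \sum_(z <- lsupp f | p * z.1 + q * z.2 == M) F z.
  by rewrite [RHS]big_mkcond; apply: eq_big_seq => z ->.
split.
- rewrite (leval_widen idfun _ _ gf) -[RHS]S0 /face_sum -sumE; apply: eq_bigr => z _.
  by rewrite gE /=; case: ifP => //; rewrite mul0r.
- rewrite /dx leval_sum.
  rewrite (sum_lsupp (F := fun z c => leval idfun xi eta (lmono (z.1 - 1, z.2) (c *~ z.1))) gf).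
    apply: (mulfI xi0); rewrite mulr0 -[RHS]S1 /face_sum -sumE mulr_sumr.
    apply: eq_bigr => z _; rewrite leval_mono gE /= expfzDr // exprN1.
    by case: ifP => _; [field|rewrite mul0rz mul0r mulr0].
  by move=> z; rewrite mul0rz lmono0 leval0.
- rewrite /dy leval_sum.
  rewrite (sum_lsupp (F := fun z c => leval idfun xi eta (lmono (z.1, z.2 - 1) (c *~ z.2))) gf).
    apply: (mulfI eta0); rewrite mulr0 -[RHS]S2 /face_sum -sumE mulr_sumr.
    apply: eq_bigr => z _; rewrite leval_mono gE /= expfzDr // exprN1.
    by case: ifP => _; [field|rewrite mul0rz mul0r mulr0].
  by move=> z; rewrite mul0rz lmono0 leval0.
Qed.

(** A half-plane that contains the polygon contains its interior in the open
    half-plane, hence also the hull of the interior lattice points. *)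
Lemma interior_hull_weight z p q : lsupp f != fset0 ->
  interior_hull Delta (lattice_pt R z) -> (p != 0) || (q != 0) ->
  exists2 z', z' \in lsupp f & p * z'.1 + q * z'.2 < p * z.1 + q * z.2.
Proof.
move=> f0 iz pq; have s0 := lsupp_nonempty f0.
have [z' z'f zmin] := seq_minimum (fun z => p * z.1 + q * z.2) s0.
exists z' => //; pose w : R * R := (p%:~R, q%:~R).
have w0 : w.1 != 0 \/ w.2 != 0.
  by case/orP: pq => H; [left|right]; rewrite /= intr_eq0.
have : interior_hull Delta `<=` [set P | (p * z'.1 + q * z'.2)%:~R < w.1 * P.1 + w.2 * P.2].
  apply: (convex_hull_min (@open_halfplane R w _)) => _ [u iu <-].
  exact: interior_halfplane w0 (newton_halfplane zmin) iu.
by move=> /(_ _ iz) /=; rewrite -!intrM -intrD ltr_int.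
Qed.

Lemma interior_hull_sub : interior_hull Delta `<=` Delta.
Proof.
apply: convex_hull_min; first exact: convex_hull_closed.
by move=> _ [z iz <-]; exact: interior_subset iz.
Qed.

Lemma newton_bounded : exists N : nat, forall z, Delta (lattice_pt R z) ->
  `|z.1| <= N%:Z /\ `|z.2| <= N%:Z.
Proof.
pose N := (\sum_(z <- lsupp f) (`|z.1| + `|z.2|))%N.
have bd z : z \in lsupp f -> `|z.1| <= N%:Z /\ `|z.2| <= N%:Z.
  move=> zf; have : (`|z.1| + `|z.2| <= N)%N by rewrite /N (big_rem z zf) leq_addr.
  lia.
exists N => z Dz; move: (N) bd => {}N bd.
have {}bd u : u \in lsupp f -> [/\ - N%:Z <= u.1, u.1 <= N%:Z, - N%:Z <= u.2 & u.2 <= N%:Z].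
  by move=> /bd[]; rewrite !ler_norml => /andP[? ?] /andP[].
have H p q : (forall u, u \in lsupp f -> - N%:Z <= p * u.1 + q * u.2) ->
    - N%:Z <= p * z.1 + q * z.2 by move=> Hu; exact: newton_lattice_halfplane Hu Dz.
have h1 : - N%:Z <= 1 * z.1 + 0 * z.2 by apply: H => u /bd[*]; lia.
have h2 : - N%:Z <= -1 * z.1 + 0 * z.2 by apply: H => u /bd[*]; lia.
have h3 : - N%:Z <= 0 * z.1 + 1 * z.2 by apply: H => u /bd[*]; lia.
have h4 : - N%:Z <= 0 * z.1 + -1 * z.2 by apply: H => u /bd[*]; lia.
by rewrite !ler_norml; lia.
Qed.

(** The row is finite, so that the cardinal counts its points. *)
Lemma width_invariant_ge0 v m (l : nat) : 0 <= width_invariant Delta v m l <->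
  exists z, interior_hull Delta (lattice_pt R z) /\ v.1 * z.2 - v.2 * z.1 = m + l%:Z.
Proof.
rewrite /width_invariant; set A := [set z | _].
have finA : finite_set A.
  have [N HN] := newton_bounded.
  pose s := [seq (i%:Z - N%:Z, j%:Z - N%:Z) | i <- iota 0 (N + N).+1, j <- iota 0 (N + N).+1].
  apply: (@sub_finite_set _ _ [set` s]); last exact: finite_seq.
  move=> z /= [/interior_hull_sub /HN [z1 z2] _]; apply/allpairsP.
  exists (absz (z.1 + N%:Z), absz (z.2 + N%:Z)); rewrite !mem_iota /=; split.
  - lia.
  - lia.
  - by rewrite [LHS]surjective_pairing; congr (_, _) => /=; lia.
rewrite subr_ge0 lez_nat cardfs_gt0; split=> [|[z Az]].
  by move=> /fset0Pn[z]; rewrite in_fset_set // inE => Az; exists z.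
by apply/fset0Pn; exists z; rewrite in_fset_set // inE.
Qed.

(** The strip between the extreme rows of the support contains the polygon, so
    the minimal strip is not wider and has these rows as its boundary. *)
Lemma width_strip_rows v m d : lsupp f != fset0 -> width_strip Delta v m d ->
  [/\ forall z, z \in lsupp f -> m <= v.1 * z.2 - v.2 * z.1 <= m + d%:Z,
      exists2 z, z \in lsupp f & v.1 * z.2 - v.2 * z.1 = m &
      exists2 z, z \in lsupp f & v.1 * z.2 - v.2 * z.1 = m + d%:Z].
Proof.
move=> f0 [strip wmin]; have s0 := lsupp_nonempty f0.
pose u z := v.1 * z.2 - v.2 * z.1.
have in_rows z : z \in lsupp f -> m <= u z <= m + d%:Z.
  by move=> /newton_supp /strip; rewrite /= -!intrM -intrB !ler_int.
have [z0 z0f min0] := seq_minimum u s0.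
have [z1 z1f max1] := seq_minimum (fun z => - u z) s0.
have {}max1 z : z \in lsupp f -> u z <= u z1 by move=> /max1; rewrite lerN2.
have strip' : in_strip Delta v (u z0) (absz (u z1 - u z0)).
  move=> P DP; have u01 := min0 _ z1f.
  have h1 := @newton_halfplane (- v.2) v.1 (u z0) _ _ DP.
  have h2 := @newton_halfplane v.2 (- v.1) (- u z1) _ _ DP.
  have E : u z0 + `|u z1 - u z0|%N%:Z = u z1 by lia.
  rewrite E; apply/andP; split.
    have : (u z0)%:~R <= (- v.2)%:~R * P.1 + v.1%:~R * P.2 :> R.
      by apply: h1 => z /min0; rewrite /u; lia.
    by rewrite mulrNz mulNr addrC.
  have : (- u z1)%:~R <= v.2%:~R * P.1 + (- v.1)%:~R * P.2 :> R.
    by apply: h2 => z /max1; rewrite /u; lia.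
  by rewrite !mulrNz mulNr -[X in _ <= X]opprB lerN2 .
have dle := wmin _ _ strip'.
have := in_rows _ z0f; have := in_rows _ z1f; have := min0 _ z1f => h1 h2 h3.
split; first exact: in_rows.
  by exists z0 => //; rewrite -/(u z0); lia.
by exists z1 => //; rewrite -/(u z1); lia.
Qed.

Section Rows.
Variables (a b c e : int).
Hypothesis det1 : a * e - b * c = 1.

(** The unimodular coordinates: z = along z * (a, b) + height z * (c, e). *)
Definition along z := e * z.1 - c * z.2.
Definition height z := a * z.2 - b * z.1.

Lemma along_heightE z : z = (a * along z + c * height z, b * along z + e * height z).
Proof.
rewrite [LHS]surjective_pairing /along /height; congr (_, _).
  by rewrite -[LHS]mul1r -det1; ring.
by rewrite -[LHS]mul1r -det1; ring.
Qed.

Let rat (i : int) : R := i%:~R.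
Let coord (s t : R) : R * R := (rat a * s + rat c * t, rat b * s + rat e * t).

Let lattice_coord z : lattice_pt R z = coord (rat (along z)) (rat (height z)).
Proof.
rewrite /lattice_pt /coord /rat -!intrM -!intrD; have E := along_heightE z.
have E1 : z.1 = a * along z + c * height z := congr1 fst E.
have E2 : z.2 = b * along z + e * height z := congr1 snd E.
by rewrite -E1 -E2.
Qed.

Let detR : rat a * rat e - rat b * rat c = 1.
Proof. by rewrite /rat -!intrM -intrB det1. Qed.

(** The intersection of the segment from z to z' with row h has crossing h z
    z' / (height z - height z') as its coordinate along (a, b). *)
Definition crossing (h : int) z z' :=
  along z * (h - height z') + along z' * (height z - h).

Let crossing_mem h z z' : z \in lsupp f -> z' \in lsupp f ->
  h < height z -> height z' <= h ->
  Delta (coord (rat (crossing h z z') / rat (height z - height z')) (rat h)).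
Proof.
move=> zf z'f hz z'h; have D0 : 0 < rat (height z - height z').
  by rewrite /rat ltr0z; lia.
pose t := rat (h - height z') / rat (height z - height z').
have -> : coord (rat (crossing h z z') / rat (height z - height z')) (rat h) =
   (t * (lattice_pt R z).1 + (1 - t) * (lattice_pt R z').1,
    t * (lattice_pt R z).2 + (1 - t) * (lattice_pt R z').2).
  have D0n : rat (height z - height z') != 0 by rewrite gt_eqF.
  rewrite !lattice_coord /coord /t /= /crossing.
  move: D0n; rewrite /rat !(intrD, intrM, intrB, mulrNz) => D0n.
  by congr (_, _); field.
apply: convex_hull_closed; [exact: newton_supp|exact: newton_supp|].
apply/andP; split; first by apply: divr_ge0; rewrite /rat ler0z; lia.
by rewrite ler_pdivrMr // mul1r /rat ler_int; lia.
Qed.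

(** Two crossings on both sides of n span a segment of row h inside the
    polygon, and there are points of the support above and below the row. *)
Lemma crossing_interior h n z z' y y' zt zb :
  z \in lsupp f -> z' \in lsupp f -> y \in lsupp f -> y' \in lsupp f ->
  zt \in lsupp f -> zb \in lsupp f ->
  h < height z -> height z' <= h -> h < height y -> height y' <= h ->
  h < height zt -> height zb < h ->
  crossing h z z' < n * (height z - height z') ->
  n * (height y - height y') < crossing h y y' ->
  Delta^° (lattice_pt R (a * n + c * h, b * n + e * h)).
Proof.
move=> zf z'f yf y'f ztf zbf hz z'h hy y'h ht bh lt1 lt2.
have A := crossing_mem zf z'f hz z'h; have B := crossing_mem yf y'f hy y'h.
set al := _ / _ in A; set be := _ / _ in B.
have al_lt : al < rat n.
  by rewrite ltr_pdivrMr /rat ?ltr0z ?subr_gt0 -?intrM ?ltr_int // (le_lt_trans z'h).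
have be_gt : rat n < be.
  by rewrite ltr_pdivlMr /rat ?ltr0z ?subr_gt0 -?intrM ?ltr_int // (le_lt_trans y'h).
have ab : 0 < be - al by rewrite subr_gt0; exact: lt_trans be_gt.
have areaE w : area (coord al (rat h)) (coord be (rat h)) (lattice_pt R w) =
    (be - al) * (rat (height w) - rat h).
  rewrite lattice_coord /area /coord /= -[RHS]mulr1 -detR; ring.
pose t := (be - rat n) / (be - al).
have -> : lattice_pt R (a * n + c * h, b * n + e * h) =
   (t * (coord al (rat h)).1 + (1 - t) * (coord be (rat h)).1,
    t * (coord al (rat h)).2 + (1 - t) * (coord be (rat h)).2).
  have abn : be - al != 0 by rewrite gt_eqF.
  rewrite /lattice_pt /coord /t /= !intrD !intrM -/(rat _).
  by rewrite /rat; congr (_, _); field.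
apply: (segment_interior (@convex_hull_closed R _) A B (newton_supp ztf) (newton_supp zbf)).
- by rewrite areaE mulr_gt0 // subr_gt0 /rat ltr_int.
- by rewrite areaE pmulr_rlt0 // subr_lt0 /rat ltr_int.
- apply/andP; split; first by rewrite divr_gt0 // subr_gt0.
  by rewrite ltr_pdivrMr // mul1r ltrD2l ltrN2.
Qed.

(** On a row without interior lattice points, the least integral part e of the
    crossings bounds them all by e + 1: otherwise e + 1 would be interior. *)
Lemma empty_row_narrow h zt zb : zt \in lsupp f -> zb \in lsupp f ->
  h < height zt -> height zb < h ->
  (forall z, height z = h -> ~ Delta^° (lattice_pt R z)) ->
  exists e0 : int, forall z z', z \in lsupp f -> z' \in lsupp f ->
    h < height z -> height z' <= h ->
    e0 * (height z - height z') <= crossing h z z' <= (e0 + 1) * (height z - height z').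
Proof.
move=> ztf zbf ht bh none.
pose s := [seq w <- [seq (z, z') | z <- lsupp f, z' <- lsupp f] |
             (h < height w.1) && (height w.2 <= h)].
have in_s z z' : ((z, z') \in s) =
    [&& z \in lsupp f, z' \in lsupp f, h < height z & height z' <= h].
  rewrite mem_filter /=; apply/andP/and4P => [[/andP[hz z'h]]|[zf z'f -> ->]].
    by move=> /allpairsP[[u u'] [/= uf u'f [Ez Ez']]]; rewrite Ez Ez' in hz z'h *.
  by split=> //; apply/allpairsP; exists (z, z').
have s0 : s != [::].
  apply/eqP => E; have := in_s zt zb.
  by rewrite E ztf zbf ht (ltW bh).
pose fl (w : (int * int) * (int * int)) :=
  (crossing h w.1 w.2 %/ (height w.1 - height w.2))%Z.
have [[z0 z0'] z0s z0min] := seq_minimum fl s0; exists (fl (z0, z0')) => z z' zf z'f hz z'h.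
have zs : (z, z') \in s by rewrite in_s zf z'f hz.
have D0 : 0 < height z - height z' by lia.
have := z0s; rewrite in_s => /and4P[z0f z0'f hz0 z0'h].
have D00 : 0 < height z0 - height z0' by lia.
apply/andP; split.
  apply: le_trans (lez_floor _ (lt0r_neq0 D0)).
  by rewrite ler_wpM2r ?(ltW D0) //; exact: (z0min (z, z')).
rewrite leNgt; apply/negP => lt.
set n := fl (z0, z0') + 1 in lt.
apply: (none (a * n + c * h, b * n + e * h)).
  by rewrite /height /= -[RHS]mul1r -det1; ring.
apply: (crossing_interior z0f z0'f zf z'f ztf zbf) => //.
exact: ltz_ceil.
Qed.

End Rows.

End NewtonPolygon.

(** * Unimodular coordinates *)

Lemma nat_shift (T : eqType) (s : seq T) (u : T -> int) :
  exists N : nat, forall M : nat, (N <= M)%N -> forall z, z \in s -> 0 < u z + M%:Z.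
Proof.
exists (\sum_(z <- s) `|u z|).+1 => M NM z zs.
have : (`|u z| <= \sum_(z <- s) `|u z|)%N by rewrite (big_rem z zs) leq_addr.
lia.
Qed.

Lemma laurent_exponents (k : fieldType) (a b c e : int) (h : laurent k) :
  exists N : nat, forall M : nat, (N <= M)%N ->
  exists e1 e2 : int * int -> nat, forall z, z \in lsupp h ->
    (e1 z)%:Z = along c e z + M%:Z /\ (e2 z)%:Z = height a b z + M%:Z.
Proof.
have [N1 H1] := nat_shift (lsupp h) (along c e).
have [N2 H2] := nat_shift (lsupp h) (height a b).
exists (maxn N1 N2) => M; rewrite geq_max => /andP[M1 M2].
exists (fun z => absz (along c e z + M%:Z)), (fun z => absz (height a b z + M%:Z)).
by move=> z zh; have := H1 M M1 z zh; have := H2 M M2 z zh; split; lia.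
Qed.

Section Coordinates.
Variables (k : fieldType) (a b c e : int).
Hypothesis det1 : a * e - b * c = 1.

Section Monomials.
Variables (S : fieldType) (x y : S).
Hypotheses (x0 : x != 0) (y0 : y != 0).

Definition coordX := x ^ a * y ^ b.
Definition coordY := x ^ c * y ^ e.

Lemma coordX_neq0 : coordX != 0. Proof. by rewrite mulf_neq0 ?expfz_neq0. Qed.
Lemma coordY_neq0 : coordY != 0. Proof. by rewrite mulf_neq0 ?expfz_neq0. Qed.

Lemma coord_pow (i j : int) :
  coordX ^ i * coordY ^ j = x ^ (a * i + c * j) * y ^ (b * i + e * j).
Proof. by rewrite !expfzMl !exprz_exp !expfzDr //; ring. Qed.

Lemma coord_monomial z :
  x ^ z.1 * y ^ z.2 = coordX ^ along c e z * coordY ^ height a b z.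
Proof.
rewrite coord_pow; have E := along_heightE det1 z.
have E1 : z.1 = a * along c e z + c * height a b z := congr1 fst E.
have E2 : z.2 = b * along c e z + e * height a b z := congr1 snd E.
by rewrite -E1 -E2.
Qed.

Variable iota : {rmorphism k -> S}.

Lemma leval_fam (h : laurent k) (N M : int) (e1 e2 : int * int -> nat) :
  (forall z, z \in lsupp h -> (e1 z)%:Z = along c e z + N /\
                              (e2 z)%:Z = height a b z + M) ->
  ev2 iota coordX coordY (fam_poly (lsupp h) e1 e2 (lcoef h)) =
  coordX ^ N * coordY ^ M * leval iota x y h.
Proof.
move=> H; rewrite ev2_fam_poly /leval mulr_sumr; apply: eq_big_seq => z zh.
have [E1 E2] := H z zh; rewrite coord_monomial !exprnP E1 E2.
by rewrite !expfzDr ?coordX_neq0 ?coordY_neq0 //; ring.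
Qed.

(** The Laurent polynomial g(x^a y^b, x^c y^e). *)
Definition laurent_of (g : {poly {poly k}}) : laurent k :=
  \sum_(j < size g) \sum_(i < size g`_j)
    lmono (a * i%:Z + c * j%:Z, b * i%:Z + e * j%:Z) (g`_j)`_i.

Lemma leval_laurent_of g : leval iota x y (laurent_of g) = ev2 iota coordX coordY g.
Proof.
rewrite /laurent_of leval_sum // ev2E; apply: eq_bigr => j _.
rewrite leval_sum // evE mulr_suml; apply: eq_bigr => i _.
by rewrite leval_mono //= -coord_pow -!exprnP mulrA.
Qed.

End Monomials.

Lemma coord_inverse (S : fieldType) (X Y : S) : X != 0 -> Y != 0 ->
  coordX (X ^ e * Y ^ (- b)) (X ^ (- c) * Y ^ a) = X /\
  coordY (X ^ e * Y ^ (- b)) (X ^ (- c) * Y ^ a) = Y.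
Proof.
move=> X0 Y0; have P (i j : int) : (X ^ e * Y ^ (- b)) ^ i * (X ^ (- c) * Y ^ a) ^ j =
    X ^ (e * i - c * j) * Y ^ (a * j - b * i).
  have -> : e * i - c * j = e * i + - c * j by ring.
  have -> : a * j - b * i = - b * i + a * j by ring.
  by rewrite !expfzMl !exprz_exp !expfzDr //; ring.
have h1 : e * a - c * b = 1 by rewrite -det1; ring.
have h2 : a * b - b * a = 0 by ring.
have h3 : e * c - c * e = 0 by ring.
by rewrite /coordX /coordY !P h1 h2 h3 det1 !expr1z !expr0z mulr1 mul1r.
Qed.

End Coordinates.

Lemma ev2_rmorph (A B C : comNzRingType) (iota : {rmorphism A -> B})
    (j : {rmorphism B -> C}) (X Y : B) (g : {poly {poly A}}) :
  j (ev2 iota X Y g) = ev2 (j \o iota) (j X) (j Y) g.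
Proof.
rewrite !ev2E rmorph_sum; apply: eq_bigr => i _.
by rewrite rmorphM rmorphXn ev_rmorph.
Qed.

Lemma ev2_generic (A : comNzRingType) (g : {poly {poly A}}) :
  ev2 (polyC \o polyC : {rmorphism A -> {poly {poly A}}}) 'X%:P 'X g = g.
Proof.
rewrite ev2E -[RHS]coefK poly_def; apply: eq_bigr => j _.
rewrite -mul_polyC; congr (_ * _); rewrite evE -[in RHS](coefK g`_j) poly_def.
rewrite rmorph_sum; apply: eq_bigr => i _ /=.
by rewrite -mul_polyC rmorphM rmorphXn.
Qed.

(** As Y does not divide F, the power of Y divides H. *)
Lemma size_divisor (A : idomainType) (F G H : {poly A}) n : F`_0 != 0 -> G != 0 ->
  'X^n * G = F * H -> (size F <= size G)%N.
Proof.
move=> F0 G0; elim: n H => [|n IHn] H.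
  rewrite mul1r => E; have : F * H != 0 by rewrite -E.
  rewrite mulf_eq0 negb_or => /andP[Fn Hn]; rewrite E size_mul //.
  have : (0 < size H)%N by rewrite size_poly_gt0.
  lia.
move=> E; have H0 : H`_0 = 0.
  have := congr1 (fun p : {poly A} => p`_0) E.
  rewrite exprS -mulrA coefXM eqxx coef0M => /esym/eqP.
  by rewrite mulf_eq0 (negPf F0) => /eqP.
have DH : H = drop_poly 1 H * 'X by rewrite [LHS]poly_headE H0 polyC0 addr0.
have X0 : 'X != 0 :> {poly A} by rewrite polyX_eq0.
apply: (IHn (drop_poly 1 H)); apply: (mulfI X0).
by rewrite mulrA -exprS E {1}DH; ring.
Qed.

(** * The curve in unimodular coordinates *)

(** The columns (a, b), (c, e) of a unimodular matrix are coordinates in which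
    the exponents of f lie in the rows 0, ..., d after a shift by (N, -m). *)
Record adapted_frame (k : fieldType) (f : laurent k) (a b c e m : int) (d N : nat) :
  Prop := AdaptedFrame {
  frame_det : a * e - b * c = 1;
  frame_rows : forall z, z \in lsupp f -> m <= height a b z <= m + d%:Z;
  frame_bottom : exists2 z, z \in lsupp f & height a b z = m;
  frame_top : exists2 z, z \in lsupp f & height a b z = m + d%:Z;
  frame_shift : forall z, z \in lsupp f -> 0 < along c e z + N%:Z }.

Section Model.
Variables (R : realType) (k : closedFieldType) (f : laurent k).
Variables (a b c e m : int) (d N : nat).
Hypothesis frame : adapted_frame f a b c e m d N.

Definition expX z : nat := absz (along c e z + N%:Z).
Definition expY z : nat := absz (height a b z - m).

Lemma expXE z : z \in lsupp f -> (expX z)%:Z = along c e z + N%:Z.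
Proof. by move=> /(frame_shift frame); rewrite /expX; lia. Qed.

Lemma expYE z : z \in lsupp f -> (expY z)%:Z = height a b z - m.
Proof. by move=> /(frame_rows frame); rewrite /expY; lia. Qed.

Definition modelF : {poly {poly k}} := fam_poly (lsupp f) expX expY (lcoef f).

Let det1 := frame_det frame.
Let bottom := frame_bottom frame.
Let top := frame_top frame.

Lemma expY_le z : z \in lsupp f -> (expY z <= d)%N.
Proof. by move=> zf; have := expYE zf; have := frame_rows frame zf; lia. Qed.

Lemma exp_inj z z' : z \in lsupp f -> z' \in lsupp f ->
  expX z = expX z' -> expY z = expY z' -> z = z'.
Proof.
move=> zf z'f EX EY; have := expXE zf; have := expXE z'f; have := expYE zf; have := expYE z'f.
rewrite EX EY => -> h2 -> h4.
rewrite (along_heightE det1 z) (along_heightE det1 z').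
have -> : along c e z = along c e z' by lia.
by have -> : height a b z = height a b z' by lia.
Qed.

Lemma coef_modelF z : z \in lsupp f -> (modelF`_(expY z))`_(expX z) = lcoef f z.
Proof.
move=> zf; rewrite coef_fam_poly coef_sum (big_rem z zf) /= eqxx coefZ coefXn eqxx mulr1.
rewrite big_seq_cond big1 ?addr0 // => u /andP[ur /eqP EY].
have uf := mem_rem ur; rewrite coefZ coefXn; case: eqP => [EX|_]; last by rewrite mulr0.
by move: ur; rewrite (exp_inj uf zf (esym EX) EY) mem_rem_uniqF ?fset_uniq.
Qed.

Lemma modelF_row z : z \in lsupp f -> modelF`_(expY z) != 0.
Proof.
move=> zf; apply/eqP => E; have := coef_modelF zf; rewrite E coef0 => /esym/eqP.
by apply/negP; rewrite -[_ != 0]mem_finsupp.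
Qed.

Lemma modelF_top : modelF`_d != 0.
Proof.
by have [z zf zt] := top; have := modelF_row zf; rewrite (_ : expY z = d) // /expY zt; lia.
Qed.

Lemma modelF_bottom : modelF`_0 != 0.
Proof.
by have [z zf zb] := bottom; have := modelF_row zf; rewrite (_ : expY z = 0%N) // /expY zb; lia.
Qed.

Lemma size_modelF : size modelF = d.+1.
Proof.
apply/eqP; rewrite eqn_leq; apply/andP; split.
  apply: (leq_trans (size_sum _ _ _)); apply/bigmax_leqP_seq => z zf _.
  by rewrite (leq_trans (size_scale_leq _ _)) // size_polyXn ltnS expY_le.
by rewrite ltnNge; apply/negP => /leq_sizeP /(_ d (leqnn d)); apply/eqP/modelF_top.
Qed.

Lemma leval_modelF (S : fieldType) (iota' : {rmorphism k -> S}) (x' y' : S) :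
  x' != 0 -> y' != 0 ->
  ev2 iota' (coordX a b x' y') (coordY c e x' y') modelF =
  coordX a b x' y' ^ N%:Z * coordY c e x' y' ^ (- m) * leval iota' x' y' f.
Proof.
move=> x'0 y'0; apply: (leval_fam det1 x'0 y'0) => z zf.
by rewrite expXE // expYE.
Qed.

Let weightE (p q : int) z : z \in lsupp f ->
  p * (expX z)%:Z + q * (expY z)%:Z =
  (p * e - q * b) * z.1 + (q * a - p * c) * z.2 + (p * N%:Z - q * m).
Proof.
by move=> zf; rewrite expXE // expYE // /along /height; ring.
Qed.

Let weight_neq0 (p q : int) : (p != 0) || (q != 0) ->
  (p * e - q * b != 0) || (q * a - p * c != 0).
Proof.
apply: contraTT; rewrite !negb_or !negbK => /andP[/eqP h1 /eqP h2].
have -> : p = 0.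
  transitivity (a * (p * e - q * b) + b * (q * a - p * c)).
    by rewrite -[LHS]mulr1 -det1; ring.
  by rewrite h1 h2 !mulr0.
have -> : q = 0; last by rewrite eqxx.
transitivity (c * (p * e - q * b) + e * (q * a - p * c)).
  by rewrite -[LHS]mulr1 -det1; ring.
by rewrite h1 h2 !mulr0.
Qed.

Lemma model_nondegenerate : newton_nondegenerate R f ->
  nondegenerate_family (lsupp f) expX expY (lcoef f).
Proof.
move=> nd p q M Mle [z0 z0f face0] xi eta xi0 eta0 S0 S1 S2.
pose p' := p * e - q * b; pose q' := q * a - p * c; pose M' := M - (p * N%:Z - q * m).
pose xi' := xi ^ e * eta ^ (- b); pose eta' := xi ^ (- c) * eta ^ a.
have xi'0 : xi' != 0 by rewrite mulf_neq0 ?expfz_neq0.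
have eta'0 : eta' != 0 by rewrite mulf_neq0 ?expfz_neq0.
have [EX EY] := coord_inverse det1 xi0 eta0.
pose u := xi ^ N%:Z * eta ^ (- m).
have u0 : u != 0 by rewrite mulf_neq0 ?expfz_neq0.
have mono z : z \in lsupp f ->
    xi ^+ expX z * eta ^+ expY z = u * (xi' ^ z.1 * eta' ^ z.2).
  move=> zf; rewrite (coord_monomial det1 xi'0 eta'0) EX EY !exprnP expXE // expYE //.
  by rewrite !expfzDr // /u; ring.
have faceE z : z \in lsupp f -> fam_face expX expY p q M z = (p' * z.1 + q' * z.2 == M').
  by move=> zf; rewrite /fam_face weightE // /M' -/p' -/q' -subr_eq opprK.
have sumE (F G : int * int -> k) : (forall z, z \in lsupp f -> F z = G z) ->
    \sum_(z <- lsupp f | fam_face expX expY p q M z) F z * (xi ^+ expX z * eta ^+ expY z) =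
    u * \sum_(z <- lsupp f | p' * z.1 + q' * z.2 == M') G z * (xi' ^ z.1 * eta' ^ z.2).
  move=> FG; rewrite mulr_sumr big_seq_cond [RHS]big_seq_cond; apply: eq_big => z.
    by case zf: (z \in _); rewrite //= faceE.
  by move=> /andP[zf _]; rewrite mono // FG //; ring.
pose sum' (G : int * int -> k) :=
  \sum_(z <- lsupp f | p' * z.1 + q' * z.2 == M') G z * (xi' ^ z.1 * eta' ^ z.2).
have sum'0 F G : (forall z, z \in lsupp f -> F z = G z) ->
    \sum_(z <- lsupp f | fam_face expX expY p q M z) F z * (xi ^+ expX z * eta ^+ expY z) = 0 ->
    sum' G = 0.
  by move=> FG; rewrite (sumE F G FG) => /eqP; rewrite mulf_eq0 (negPf u0) => /eqP.
have S0' : sum' (lcoef f) = 0 by apply: sum'0 S0.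
have S1' : sum' (fun z => lcoef f z *~ (along c e z + N%:Z)) = 0.
  by apply: sum'0 S1 => z zf; rewrite -expXE // pmulrn.
have S2' : sum' (fun z => lcoef f z *~ (height a b z - m)) = 0.
  by apply: sum'0 S2 => z zf; rewrite -expYE // pmulrn.
have lin (i j n : int) (G : int * int -> int) :
    (forall z, G z = i * (along c e z + N%:Z) + j * (height a b z - m) + n) ->
    sum' (fun z => lcoef f z *~ G z) = 0.
  move=> EG; transitivity (i%:~R * sum' (fun z => lcoef f z *~ (along c e z + N%:Z)) +
     j%:~R * sum' (fun z => lcoef f z *~ (height a b z - m)) + n%:~R * sum' (lcoef f)).
    rewrite /sum' !mulr_sumr -!big_split; apply: eq_bigr => z _ /=.
    have zE (t : int) : lcoef f z *~ t = lcoef f z * t%:~R by rewrite mulrzr.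
    by rewrite EG !zE !(intrD, intrM); ring.
  by rewrite S0' S1' S2' !mulr0 !addr0.
apply: (newton_nondegenerate_weight nd (p := p') (q := q') (M := M') _ _ xi'0 eta'0 S0').
- by move=> z zf; have := Mle z zf; rewrite weightE // /M' lerBlDr.
- by exists z0; rewrite // -faceE.
- apply: (lin a c (c * m - a * N%:Z)) => z; rewrite {1}(along_heightE det1 z) /=; ring.
- apply: (lin b e (e * m - b * N%:Z)) => z; rewrite {1}(along_heightE det1 z) /=; ring.
Qed.

Lemma model_interior z l : lsupp f != fset0 ->
  interior_hull (newton_polygon R f) (lattice_pt R z) -> height a b z = m + l%:Z ->
  exists i, interior_exponent (lsupp f) expX expY i l.
Proof.
move=> f0 iz hz.
have [z0 z0f lt0] : exists2 z', z' \in lsupp f & along c e z' < along c e z.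
  have [|z' z'f] := interior_hull_weight (p := e) (q := - c) f0 iz.
    have := weight_neq0 (p := 1) (q := 0); rewrite !mul1r !mul0r subr0 sub0r.
    by apply; rewrite oner_neq0.
  by exists z'; rewrite // /along -!mulNr.
have N0 := frame_shift frame z0f.
exists (absz (along c e z + N%:Z)) => p q pq.
have [z' z'f lt] := interior_hull_weight f0 iz (weight_neq0 pq).
exists z' => //; rewrite weightE //.
have -> : (absz (along c e z + N%:Z))%:Z = along c e z + N%:Z by lia.
have -> : l%:Z = height a b z - m by rewrite hz; ring.
rewrite (_ : p * _ + q * _ = (p * e - q * b) * z.1 + (q * a - p * c) * z.2 + (p * N%:Z - q * m)).
  by rewrite ltrD2r.
by rewrite /along /height; ring.
Qed.

Lemma model_narrow l : (0 < l < d)%N ->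
  (forall z, height a b z = m + l%:Z -> ~ (newton_polygon R f)^° (lattice_pt R z)) ->
  exists i, narrow_row (lsupp f) expX expY i l.
Proof.
move=> /andP[l0 ld] none; have [zt ztf ht] := top; have [zb zbf hb] := bottom.
have ht' : m + l%:Z < height a b zt by rewrite ht; lia.
have hb' : height a b zb < m + l%:Z by rewrite hb; lia.
have [e0 He0] := empty_row_narrow det1 ztf zbf ht' hb' none.
have crossE z z' : z \in lsupp f -> z' \in lsupp f ->
    crossing a b c e (m + l%:Z) z z' + N%:Z * (height a b z - height a b z') =
    (expX z)%:Z * (l%:Z - (expY z')%:Z) + (expX z')%:Z * ((expY z)%:Z - l%:Z).
  by move=> zf z'f; rewrite /crossing !expXE // !expYE //; ring.
have e0N : 0 <= e0 + N%:Z.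
  have /andP[_ H] := He0 zt zb ztf zbf ht' (ltW hb').
  have E := crossE zt zb ztf zbf.
  have h1 : 1 <= (expX zt)%:Z by rewrite expXE //; have := frame_shift frame ztf; lia.
  have h2 : 1 <= (expX zb)%:Z by rewrite expXE //; have := frame_shift frame zbf; lia.
  have h3 : (expY zt)%:Z = d%:Z by rewrite expYE // ht; ring.
  have h4 : (expY zb)%:Z = 0 by rewrite expYE // hb; ring.
  have hd : height a b zt - height a b zb = d%:Z by rewrite ht hb; ring.
  move: E H; rewrite h3 h4 hd subr0.
  move: (crossing _ _ _ _ _ _ _) => C E H.
  have h5 : (expX zt)%:Z * l%:Z + (expX zb)%:Z * (d%:Z - l%:Z) >= d%:Z by nia.
  have h6 : 0 <= (e0 + N%:Z) * d%:Z by move: H h5; rewrite mulrDl mul1r -E mulrDl; lia.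
  by move: h6; rewrite pmulr_lge0 //; lia.
exists (absz (e0 + N%:Z)) => z z' zf z'f lz z'l.
have zh : m + l%:Z < height a b z by have := expYE zf; lia.
have zh' : height a b z' <= m + l%:Z by have := expYE z'f; lia.
have /andP[H1 H2] := He0 z z' zf z'f zh zh'.
have E := crossE z z' zf z'f.
have D m' n' : (n' <= m')%N -> (m' - n')%N%:Z = m'%:Z - n'%:Z by move=> ?; rewrite subzn.
have DA : (expY z - expY z')%N%:Z = height a b z - height a b z'.
  by rewrite D ?(leq_trans z'l (ltnW lz)) // !expYE //; ring.
have DE : (absz (e0 + N%:Z))%:Z = e0 + N%:Z by lia.
have DE1 : (absz (e0 + N%:Z)).+1%:Z = e0 + N%:Z + 1 by lia.
apply/andP; split; rewrite -lez_nat PoszD !PoszM DA (D _ _ z'l) (D _ _ (ltnW lz)) -E ?DE ?DE1.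
  by rewrite mulrDl lerD2r.
have -> : e0 + N%:Z + 1 = e0 + 1 + N%:Z by ring.
by rewrite mulrDl lerD2r.
Qed.

Section Curve.
Variables (K : fieldType) (iota : {rmorphism k -> K}) (x y : K).
Hypothesis K_ff : is_function_field iota f x y.
Let X := coordX a b x y.
Let Y := coordY c e x y.

Let x0 : x != 0. Proof. by have [/eqP] := K_ff. Qed.
Let y0 : y != 0. Proof. by have [_ /eqP] := K_ff. Qed.

(** A relation g(X, Y) = 0 is a multiple of f in the Laurent ring. After
    clearing monomials in a field that contains k[X, Y], it becomes a
    polynomial multiple of F, up to a monomial. *)
Lemma modelF_min_embedded (Q : fieldType) (to : {rmorphism {poly {poly k}} -> Q})
    (g : {poly {poly k}}) : injective to ->
  (size g <= d)%N -> ev2 iota X Y g = 0 -> g = 0.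
Proof.
move=> to_inj sg g0; have [_ _ ker _] := K_ff.
have [h Dh] : exists h, laurent_of a b c e g = f * h.
  by apply/ker; rewrite leval_laurent_of.
pose iQ : {rmorphism k -> Q} := to \o (polyC \o polyC : {rmorphism k -> {poly {poly k}}}).
pose XQ : Q := to 'X%:P; pose YQ : Q := to 'X.
have XQ0 : XQ != 0.
  by rewrite -(rmorph0 to) (inj_eq to_inj) polyC_eq0 polyX_eq0.
have YQ0 : YQ != 0 by rewrite -(rmorph0 to) (inj_eq to_inj) polyX_eq0.
pose xQ := XQ ^ e * YQ ^ (- b); pose yQ := XQ ^ (- c) * YQ ^ a.
have xQ0 : xQ != 0 by rewrite mulf_neq0 ?expfz_neq0.
have yQ0 : yQ != 0 by rewrite mulf_neq0 ?expfz_neq0.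
have [EX EY] := coord_inverse det1 XQ0 YQ0.
have ev2Q p : ev2 iQ XQ YQ p = to p.
  by rewrite -[in RHS](ev2_generic p) (ev2_rmorph _ to).
have [n Hn] := laurent_exponents a b c e h.
have [//|h1 [h2 hP]] := Hn (maxn n (absz m)) _; first exact: leq_maxl.
set M := maxn _ _ in hP.
have := leval_fam det1 xQ0 yQ0 iQ hP.
rewrite -/xQ -/yQ EX EY ev2Q; set H := fam_poly _ _ _ _ => EH.
have EF := leval_modelF iQ xQ0 yQ0; rewrite EX EY ev2Q in EF.
have Eg := leval_laurent_of a b c e xQ0 yQ0 iQ g; rewrite EX EY ev2Q Dh levalM // in Eg.
have le_mM : 0 <= M%:Z - m by rewrite /M; lia.
have [r Dr] : exists r : nat, M%:Z - m = r%:Z by exists (absz (M%:Z - m)); lia.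
have E : 'X^r * (('X^(N + M))%:P * g) = modelF * H.
  apply: to_inj; rewrite !rmorphM /= polyC_exp !rmorphXn /= -/XQ -/YQ.
  by rewrite -Eg EF EH !exprnP PoszD -Dr !expfzDr //; ring.
apply/eqP; apply: contraTT sg => gn; rewrite -ltnNge.
have XM0 : 'X^(N + M) != 0 :> {poly k} by rewrite expf_neq0 // polyX_eq0.
have G0 : ('X^(N + M))%:P * g != 0 by rewrite mulf_neq0 ?polyC_eq0.
by have := size_divisor modelF_bottom G0 E; rewrite mul_polyC size_modelF size_scale.
Qed.

Lemma modelF_min (g : {poly {poly k}}) : (size g <= d)%N -> ev2 iota X Y g = 0 -> g = 0.
Proof.
apply: (@modelF_min_embedded _ (@tofrac {poly {poly k}})) => p q /eqP.
by rewrite tofrac_eq => /eqP.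
Qed.

Lemma model_curve : (0 < d)%N -> plane_curve iota X Y modelF d.
Proof.
move=> d_gt0; have [_ _ ker gen] := K_ff; split=> //.
- exact: size_modelF.
- exact: coordX_neq0.
- exact: coordY_neq0.
- rewrite leval_modelF // (_ : leval iota x y f = 0) ?mulr0 //.
  by apply/ker; exists 1; rewrite mulr1.
- exact: modelF_min.
- move=> t; have [g [h [h0 ->]]] := gen t.
  have [n1 H1] := laurent_exponents a b c e g; have [n2 H2] := laurent_exponents a b c e h.
  have [g1 [g2 gP]] := H1 (maxn n1 n2) (leq_maxl _ _).
  have [h1 [h2 hP]] := H2 (maxn n1 n2) (leq_maxr _ _).
  exists (fam_poly (lsupp g) g1 g2 (lcoef g)), (fam_poly (lsupp h) h1 h2 (lcoef h)).
  rewrite (leval_fam det1 x0 y0 iota gP) (leval_fam det1 x0 y0 iota hP) -/X -/Y.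
  have X0 : X != 0 by exact: coordX_neq0.
  have Y0 : Y != 0 by exact: coordY_neq0.
  set u := X ^ _ * _; have u0 : u != 0 by rewrite mulf_neq0 ?expfz_neq0.
  by split; [rewrite mulf_neq0 //; exact/eqP|rewrite -mulf_div divff // mul1r].
Qed.

End Curve.

End Model.

Theorem corollary9p3 (R : realType) (k : closedFieldType)
    (char_k : [pchar k] =i pred0)
    (f : laurent k)
    (f_irr : irreducible f)
    (f_nondeg : newton_nondegenerate R f)
    (dim2 : two_dimensional (interior_hull (newton_polygon R f)))
    (K : fieldType) (iota : {rmorphism k -> K}) (x y : K)
    (K_ff : is_function_field iota f x y)
    (v : int * int) (v_dir : lattice_direction v)
    (m : int) (d : nat) (md : width_strip (newton_polygon R f) v m d) :
  complete_pencil (combinatorial_pencil iota x y v) <->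
  (forall l : nat, (1 <= l < d)%N ->
     0 <= width_invariant (newton_polygon R f) v m l).
Proof.
have f0 : lsupp f != fset0.
  apply/negP => /eqP E; have [fn0 _ _] := f_irr; apply: fn0.
  by rewrite (lmono_sum f) E big_seq_fset0.
have [e [c det1]] : exists e c, v.1 * e - v.2 * c = 1.
  have [u [w E]] := Bezoutz v.1 v.2; exists u, (- w).
  by move: v_dir; rewrite /lattice_direction /coprimez -E => /eqP <-; ring.
have [rows bottom top] := width_strip_rows f0 md.
have [N HN] := nat_shift (lsupp f) (along c e).
have frame : adapted_frame f v.1 v.2 c e m d N.
  by split=> //; exact: HN.
(* A lattice point of the interior lies strictly between the extreme rows. *)
have d_gt0 : (0 < d)%N.
  have [z iz] : exists z, (newton_polygon R f)^° (lattice_pt R z).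
    apply: contrapT => /forallNP none; have [p [_ [_ [ip _ _ _]]]] := dim2.
    suff: interior_hull (newton_polygon R f) `<=` set0 by move=> /(_ _ ip).
    apply: convex_hull_min; first by move=> ? ? ? [].
    by move=> q [z iz _]; case: (none z iz).
  have ihz : interior_hull (newton_polygon R f) (lattice_pt R z).
    by apply: sub_convex_hull; exists z.
  have v0 : (- v.2 != 0) || (v.1 != 0).
    rewrite oppr_eq0 -negb_and; apply/negP => /andP[/eqP v2 /eqP v1].
    by move: det1; rewrite v1 v2 !mul0r subr0.
  have v0' : (v.2 != 0) || (- v.1 != 0) by move: v0; rewrite !oppr_eq0.
  have [z1 z1f lt1] := interior_hull_weight f0 ihz v0.
  have [z2 z2f lt2] := interior_hull_weight f0 ihz v0'.
  have h1 : height v.1 v.2 z1 < height v.1 v.2 z.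
    by move: lt1; rewrite !mulNr addrC [ltRHS]addrC.
  have h2 : height v.1 v.2 z < height v.1 v.2 z2.
    by rewrite -ltrN2 !opprB; move: lt2; rewrite !mulNr.
  have /andP[h3 _] := rows z1 z1f; have /andP[_ h4] := rows z2 z2f.
  have := le_lt_trans h3 (lt_trans h1 (lt_le_trans h2 h4)).
  by rewrite ltrDl.
have pc := model_curve frame K_ff d_gt0.
have eY := expY_le frame.
rewrite /combinatorial_pencil -/(coordX v.1 v.2 x y); split.
  move=> /(complete_pencil_affine pc) aff l ld; apply/width_invariant_ge0.
  apply: contrapT => none.
  have [|i nr] := model_narrow frame (R := R) ld.
    move=> z hz iz; apply: none; exists z; split=> //.
    by apply: sub_convex_hull; exists z.
  have [h [hs hn]] := extra_section pc eY ld nr.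
  by have [al [be E]] := aff h hs; apply: (hn al be).
move=> inv; apply/(complete_pencil_affine pc) => t ts.
apply: (section_affine pc char_k _ _ eY _ ts).
- exact: model_nondegenerate frame f_nondeg.
- exact: modelF_bottom frame.
- move=> l ld; have /width_invariant_ge0[z [iz hz]] := inv l ld.
  exact: (model_interior frame f0 iz hz).
Qed.
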